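(* For every real $b>\frac{\log3}{\pi}$ there exists $c_b>0$ such that for every $(W,N)\in(0,\frac12)\times\mathbb N$ with $$c_b\le\pi NW\le\exp\left(\alpha_b\frac{\sin(2\pi W)}{W^3}-2\log2-\frac{\pi}{b}\right),\qquad \alpha_b=\frac{3}{32\,b\,\pi}\left(1-\frac{3}{1+e^{\pi b}}\right),$$ there exists an integer $N_0\ge[2NW]$ such that, with $c=\pi NW$, $$\|\pi_{N_0}-\widetilde\pi_{N_0}\|\le W^3\left(\frac{4b\pi}{3\sin(2\pi W)}\right)\frac{\log(\pi NW)+2\log2+\frac{\pi}{b}}{1-\frac{3}{1+e^{\pi b}}} .$$
   Context: $[x]$ denotes the integer part of $x$, and $\|\cdot\|$ is the operator norm on $L^2(-1,1)$. For $c>0$, $\mathcal Q_c$ is the positive compact self-adjoint operator on $L^2(-1,1)$ given by $$\mathcal Q_cf(x)=\int_{-1}^{1}\frac{\sin(c(x-y))}{\pi(x-y)}f(y)\,dy ,$$ which has simple eigenvalues. For $W\in(0,1/2)$ and a positive integer $N$, $\widetilde L_{W,N}$ is the positive self-adjoint rank-$N$ operator on $L^2(-1,1)$ given by $$\widetilde L_{W,N}f(x)=\int_{-1}^{1}\frac{\sin(\pi NW(x-y))}{\sin(\pi W(x-y))}f(y)\,dy ,$$ which has $N$ simple nonzero eigenvalues. With $c=\pi NW$, $\pi_K$ (respectively $\widetilde\pi_K$) denotes the orthogonal projection in $L^2(-1,1)$ onto the span of the first $K$ eigenfunctions of $\mathcal Q_c$ (respectively of $\widetilde L_{W,N}$,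 for $K\le N$), i.e. the eigenfunctions associated with the $K$ largest eigenvalues. *)

(* Defs.v *)
From mathcomp Require Import all_boot all_order all_algebra.
From mathcomp Require Import all_classical all_reals all_analysis.
Set Implicit Arguments.
Unset Strict Implicit.
Unset Printing Implicit Defensive.
Import Order.TTheory GRing.Theory Num.Theory.
Import numFieldNormedType.Exports.
Local Open Scope classical_set_scope.
Local Open Scope ring_scope.

(* L^2(-1,1) is the real space [Lfun (mu11 R) 2%:E]. Its elements are          *)
(* functions rather than classes, so equality in L^2(-1,1) is almost           *)
(* everywhere equality for [mu11 R].                                           *)
Definition mu11 (R : realType) : {measure set (measurableTypeR R) -> \bar R} :=
  mrestr (@lebesgue_measure R)
    (measurable_itv `](-1 : R), (1 : R)[ : measurable `](-1 : R), (1 : R)[%classic).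

Section L2.
Variable R : realType.
Notation mu := (@mu11 R).
Implicit Types (f g h : R -> R) (T P : (R -> R) -> (R -> R)).

Definition inner f g : R := \int[mu]_x (f x * g x).

Definition norm2 f : \bar R := 'N[mu]_(2%:E)[EFin \o f]%E.

Definition opnorm T : \bar R :=
  ereal_sup [set norm2 (T f) | f in [set f | f \in Lfun mu 2%:E /\ (norm2 f <= 1)%E]].

Definition lin_span (K : nat) (psi : 'I_K -> R -> R) : set (R -> R) :=
  [set g | exists a : 'I_K -> R, g = fun x => \sum_(i < K) a i * psi i x].

Definition orth_proj (V : set (R -> R)) f : R -> R :=
  xget (cst 0) [set g | V g /\ forall v, V v -> inner (f \- g) v = 0].

Definition eigenfunction T (lam : R) f : Prop :=
  [/\ f \in Lfun mu 2%:E, ~ (f = cst 0 %[ae mu])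
    & T f = (fun x => lam * f x) %[ae mu]].

Definition orthonormal (K : nat) (psi : 'I_K -> R -> R) : Prop :=
  forall i j : 'I_K, inner (psi i) (psi j) = (i == j)%:R.

(* [psi] lists eigenfunctions for the K largest eigenvalues in nonincreasing   *)
(* order. Eigenvalues are counted with multiplicity, so that their simplicity  *)
(* is not presupposed; when they are simple, [lin_span psi] is unique up to    *)
(* almost everywhere equality.                                                 *)
Definition leading_eigenfunctions T (K : nat) (psi : 'I_K -> R -> R) : Prop :=
  orthonormal psi /\
  exists lam : 'I_K -> R,
    [/\ forall i, eigenfunction T (lam i) (psi i),
        forall i j : 'I_K, (i <= j)%N -> lam j <= lam i
      & forall (nu : R) h, eigenfunction T nu h ->
          (forall i, inner h (psi i) = 0) -> forall i, nu <= lam i].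

Definition first_eigenfunctions T (K : nat) : 'I_K -> R -> R :=
  xget (fun=> cst 0) [set psi | leading_eigenfunctions T psi].

Definition eigen_proj T (K : nat) : (R -> R) -> (R -> R) :=
  orth_proj (lin_span (@first_eigenfunctions T K)).

(* In both kernels the quotient has value 0 on the diagonal x = y, where the   *)
(* inverse of 0 is 0; this null set does not affect the integrals.             *)
Definition sinc_op (c : R) f : R -> R := fun x =>
  \int[mu]_y (sin (c * (x - y)) / (pi * (x - y)) * f y).

Definition dirichlet_op (W : R) (N : nat) f : R -> R := fun x =>
  \int[mu]_y (sin (pi * N%:R * W * (x - y)) / sin (pi * W * (x - y)) * f y).

Definition alpha (b : R) : R :=
  3 / (32 * b * pi) * (1 - 3 / (1 + expR (pi * b))).

End L2.

(* Main.v *)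
Require Import Defs.
From HB Require Import structures.
From mathcomp Require Import all_boot all_order all_algebra.
From mathcomp Require Import all_classical all_reals all_analysis measurable_realfun.
From mathcomp Require Import ring lra.
Import Order.TTheory GRing.Theory Num.Theory.
Import numFieldNormedType.Exports.
Set Implicit Arguments.
Unset Strict Implicit.
Unset Printing Implicit Defensive.
Local Open Scope classical_set_scope.
Local Open Scope ring_scope.

(* Write Q for Q_c and L for L~_{W,N}. Up to O(W^4), the kernel of Q - W L is       *)
(* - pi W^2 / 6 * t sin(c t) with t = x - y, a rank four form in cos(c x), sin(c x),  *)
(* x cos(c x), x sin(c x); these are almost orthogonal, so that                       *)
(* |Q - W L| <= pi W^2 / 10.                                                          *)
(* By Landau's test functions the eigenvalue of Q of index [2NW] - 1 is at least 1/2, *)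
(* by the trace the one of index N is at most 2W, and                                 *)
(* sum lam (1 - lam) <= (log c + 50) / pi^2. Hence the eigenvalues in between cannot  *)
(* all be close to their successors: some N0 >= [2NW] has a gap of at least           *)
(* (2/25) pi^2 / (log c + 58) just before lam_{N0}. The sine theorem of Davis and     *)
(* Kahan then bounds the difference of the projections, and the hypothesis on W and N *)
(* makes the right-hand side at most 1/8, which absorbs the perturbation of the gap.  *)

(** Write A for Q_c and B for the Dirichlet operator. Scaling by W moves eigenvalues but not
    spectral projections, so A is compared with W B. If |A - W B| <= d and two consecutive
    eigenvalues of A differ by at least delta, then Weyl's inequalities carry the gap over to W B
    with loss d. The sine theorem then bounds the difference of the projections at that index by d /
    (delta - d) ([davis_kahan], [spectral_projection_close]).

    Here d = pi W^2 / 10 by [sinc_dirichlet_form], and [sinc_spectral_gap] provides delta = (2/25)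
    pi^2 / (ln c + 58) by a pigeonhole argument. The eigenvalues fall from at least 1/2
    ([landau_lower_bound]) to at most 2 W ([sinc_trace]), while the sum of lam (1 - lam) is at most
    (ln c + 50) / pi^2 ([sinc_plunge]). If every step were shorter than delta, then delta times
    roughly this sum would exceed the integral of t (1 - t) between 2 W and 1/2, which is nearly
    1/12. The claimed bound X satisfies 5 W^2 (ln c) / (3 pi) <= X <= 1/8 ([rhs_ge], [rhs_le]),
    which is enough for d <= X (delta - d) ([gap_numerics]).

    The analysis of Q_c goes through finite cosine sums. The sinc kernel is a limit of midpoint sums
    of its Fourier integral, and the Dirichlet kernel is itself such a sum. Positivity, compactness,
    the trace and the sum of lam (1 - lam) are treated on finite sums and passed to the limit. For a
    finite sum T, the quantity (T f, f) - |T f|^2, which stands for lam (1 - lam), is the energy of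
    T f outside [-1, 1] over one period. *)

Lemma sqr_le_eps (R : realFieldType) (x C : R) :
  (forall e, 0 < e -> x ^+ 2 <= e * C) -> x = 0.
Proof.
move=> h; apply/eqP; rewrite -sqrf_eq0; apply: contrapT => /negP x0.
have {}x0 : 0 < x ^+ 2 by rewrite lt_neqAle eq_sym x0 sqr_ge0.
have C0 : 0 < C by rewrite -(@pmulr_rgt0 _ 1)// mul1r; have := h 1 ltr01; lra.
have e0 : 0 < x ^+ 2 / (2 * C) by rewrite divr_gt0// mulr_gt0.
have := h _ e0; rewrite -mulrA (_ : (2 * C)^-1 * C = 2^-1); first by lra.
by field; lra.
Qed.

(** Definiteness is left out: vectors are functions rather than classes, so a nonzero function may
    have norm zero, and the form [ip (T f) g] of a positive operator has to be an instance too. *)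
Record semi_inner (R : realType) (V : lmodType R) (ip : V -> V -> R) : Prop :=
  SemiInner {
    ipC : forall f g, ip f g = ip g f;
    ipDl : forall f g h, ip (f + g) h = ip f h + ip g h;
    ipZl : forall a f h, ip (a *: f) h = a * ip f h;
    ip_ge0 : forall f, 0 <= ip f f }.

(** * Semi-inner products *)

Section SemiInnerProduct.
Variables (R : realType) (V : lmodType R) (ip : V -> V -> R).
Hypothesis ipP : semi_inner ip.
Implicit Types (f g h : V) (a : R).

Lemma ipDr f g h : ip h (f + g) = ip h f + ip h g.
Proof. by rewrite !(ipC ipP h) ipDl. Qed.
Lemma ipZr a f h : ip h (a *: f) = a * ip h f.
Proof. by rewrite !(ipC ipP h) ipZl. Qed.
Lemma ipNl f h : ip (- f) h = - ip f h.
Proof. by rewrite -scaleN1r ipZl// mulN1r. Qed.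
Lemma ipNr f h : ip h (- f) = - ip h f.
Proof. by rewrite !(ipC ipP h) ipNl. Qed.
Lemma ipBl f g h : ip (f - g) h = ip f h - ip g h.
Proof. by rewrite ipDl// ipNl. Qed.
Lemma ipBr f g h : ip h (f - g) = ip h f - ip h g.
Proof. by rewrite ipDr ipNr. Qed.
Lemma ip0l h : ip 0 h = 0.
Proof. by rewrite -(scale0r 0) ipZl// mul0r. Qed.
Lemma ip_suml I (r : seq I) (P : pred I) (F : I -> V) h :
  ip (\sum_(i <- r | P i) F i) h = \sum_(i <- r | P i) ip (F i) h.
Proof.
exact: (big_morph (fun x => ip x h) (fun x y => ipDl ipP x y h) (ip0l h)).
Qed.
Lemma ip_sumr I (r : seq I) (P : pred I) (F : I -> V) h :
  ip h (\sum_(i <- r | P i) F i) = \sum_(i <- r | P i) ip h (F i).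
Proof.
by rewrite (ipC ipP) ip_suml; apply: eq_bigr => i _; rewrite (ipC ipP).
Qed.

Definition ipE := (ipDl ipP, ipZl ipP, ipDr, ipZr, ipNl, ipNr).

(* Shared by [ip] and by the semi-inner products [ip (T f) g] of positive operators. *)
Lemma cauchy_schwarz f g : ip f g ^+ 2 <= ip f f * ip g g.
Proof.
have p0 := ip_ge0 ipP.
have [g0|g0] := eqVneq (ip g g) 0.
  rewrite g0 mulr0; suff -> : ip f g = 0 by rewrite expr0n.
  apply/eqP; apply: contrapT => /negP fg0.
  (* Since [ip g g = 0], the square norm of [f + t *: g] is affine in [t]; this value of [t] would
     make it -1. *)
  pose t := - (ip f f + 1) / (2 * ip f g).
  have := p0 (f + t *: g); rewrite !ipE g0 (ipC ipP g f).
  rewrite /t; move: (ip f f) (ip f g) fg0 => x y y0.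
  rewrite mulr0 mulr0 addr0.
  have -> : - (x + 1) / (2 * y) * y = - (x + 1) / 2 by field.
  by lra.
have gg : 0 < ip g g by rewrite lt_neqAle eq_sym g0 p0.
have := p0 (ip g g *: f - ip f g *: g); rewrite !ipE (ipC ipP g f).
set x := ip f f; set y := ip f g; set z := ip g g in gg *.
have -> : z * (z * x + - (y * y)) + - (y * (z * y + - (y * z))) = z * (x * z - y ^+ 2)
  by ring.
by rewrite pmulr_rge0// subr_ge0.
Qed.

Definition orthonormal_fam K (psi : 'I_K -> V) :=
  forall i j, ip (psi i) (psi j) = (i == j)%:R.

Definition span_proj K (psi : 'I_K -> V) f := \sum_(i < K) ip f (psi i) *: psi i.

Lemma ip_comb K (psi : 'I_K -> V) (a : 'I_K -> R) g :
  ip (\sum_(i < K) a i *: psi i) g = \sum_(i < K) a i * ip (psi i) g.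
Proof. by rewrite ip_suml; apply: eq_bigr => i _; rewrite ipZl. Qed.

Lemma ip_comb_on K (psi : 'I_K -> V) (a : 'I_K -> R) j : orthonormal_fam psi ->
  ip (\sum_(i < K) a i *: psi i) (psi j) = a j.
Proof.
move=> on; rewrite ip_comb (bigD1 j)//= on eqxx mulr1 big1 ?addr0// => i /negPf ij.
by rewrite on ij mulr0.
Qed.

Lemma ip_proj K (psi : 'I_K -> V) f j : orthonormal_fam psi ->
  ip (span_proj psi f) (psi j) = ip f (psi j).
Proof. by move=> on; rewrite ip_comb_on. Qed.

Lemma ip_comb2 K (psi : 'I_K -> V) (a b : 'I_K -> R) : orthonormal_fam psi ->
  ip (\sum_(i < K) a i *: psi i) (\sum_(i < K) b i *: psi i) = \sum_(i < K) a i * b i.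
Proof.
move=> on; rewrite ip_sumr; apply: eq_bigr => i _.
by rewrite ipZr ip_comb_on// mulrC.
Qed.

Lemma ip_proj_proj K (psi : 'I_K -> V) f g : orthonormal_fam psi ->
  ip (span_proj psi f) (span_proj psi g) = ip (span_proj psi f) g.
Proof.
move=> on; rewrite (ip_comb2 _ _ on) ip_comb; apply: eq_bigr => i _.
by rewrite (ipC ipP g).
Qed.

Lemma proj_perp K (psi : 'I_K -> V) f i : orthonormal_fam psi ->
  ip (f - span_proj psi f) (psi i) = 0.
Proof. by move=> on; rewrite ipBl ip_proj// subrr. Qed.

Lemma pythagoras K (psi : 'I_K -> V) f : orthonormal_fam psi ->
  ip f f = ip (span_proj psi f) (span_proj psi f)
           + ip (f - span_proj psi f) (f - span_proj psi f).
Proof.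
move=> on; have := ip_proj_proj f f on.
rewrite !ipE (ipC ipP f (span_proj psi f)) => ->; lra.
Qed.

Lemma bessel K (psi : 'I_K -> V) f : orthonormal_fam psi ->
  \sum_(i < K) ip f (psi i) ^+ 2 <= ip f f.
Proof.
move=> on; rewrite (pythagoras f on) (ip_comb2 _ _ on).
by rewrite lerDl; exact: ip_ge0 ipP _.
Qed.

(** The [K] conditions on [K.+1] coefficients form a matrix with more rows than columns, hence with
    a nonzero left kernel. Both Weyl inequalities rest on this dimension count. *)
Lemma comb_perp K (e : 'I_K.+1 -> V) (g : 'I_K -> V) :
  exists2 a : 'I_K.+1 -> R, (exists i, a i != 0) &
    forall j, ip (\sum_(i < K.+1) a i *: e i) (g j) = 0.
Proof.
pose M : 'M[R]_(K.+1, K) := \matrix_(i, j) ip (e i) (g j).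
have /rowV0Pn [v vM v0] : kermx M != 0.
  by rewrite -mxrank_eq0 mxrank_ker -lt0n subn_gt0 ltnS rank_leq_col.
have [i vi] : exists i, v 0 i != 0.
  apply: contrapT => /forallNP h; case/negP: v0; apply/eqP/rowP => i.
  by rewrite mxE; apply/eqP/negPn/negP; exact: h.
exists (v 0); first by exists i.
move=> j; have /sub_kermxP/rowP/(_ j) := vM.
rewrite !mxE => <-; rewrite ip_comb; apply: eq_bigr => k _; by rewrite mxE.
Qed.

Lemma sum_sqr_gt0 K (a : 'I_K -> R) i : a i != 0 -> 0 < \sum_(i < K) a i ^+ 2.
Proof.
move=> ai; rewrite (bigD1 i)//= ltr_pwDl//; last by apply: sumr_ge0 => j _; exact: sqr_ge0.
by rewrite lt_neqAle sqr_ge0 andbT eq_sym sqrf_eq0.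
Qed.

Lemma orthonormal_perp K (e : 'I_K.+1 -> V) (g : 'I_K -> V) : orthonormal_fam e ->
  exists a : 'I_K.+1 -> R, let f := \sum_(i < K.+1) a i *: e i in
    0 < ip f f /\ forall j, ip f (g j) = 0.
Proof.
move=> on; have [a [i ai] ag] := comb_perp e g; exists a; split => //.
by rewrite (ip_comb2 _ _ on); exact: (sum_sqr_gt0 (i := i)).
Qed.

End SemiInnerProduct.

(** Symmetry makes [T] additive and homogeneous when tested against any vector, and linearity is
    only ever used in that tested form. *)
Record positive_op (R : realType) (V : lmodType R) (ip : V -> V -> R) (T : V -> V) : Prop :=
  PositiveOp {
    op_sym : forall f g, ip (T f) g = ip f (T g);
    op_ge0 : forall f, 0 <= ip (T f) f }.

(* Sequential compactness, weakened to a cluster point of [T (u n)]. *)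
Definition compact_op (R : realType) (V : lmodType R) (ip : V -> V -> R) (T : V -> V) :=
  forall u : nat -> V, (forall n, ip (u n) (u n) <= 1) ->
    exists g, forall e, 0 < e -> forall m : nat,
      exists2 n, (m <= n)%N & ip (T (u n) - g) (T (u n) - g) <= e.

Definition bounded_op (R : realType) (V : lmodType R) (ip : V -> V -> R) (T : V -> V) :=
  exists M, forall f, ip (T f) f <= M * ip f f.

(** Testing against every vector is how equality almost everywhere is expressed in the abstract
    setting. *)
Definition eigen (R : realType) (V : lmodType R) (ip : V -> V -> R) (T : V -> V)
  (lam : R) f := forall g, ip (T f) g = lam * ip f g.

(** * Positive compact operators *)

Section PositiveOperator.
Variables (R : realType) (V : lmodType R) (ip : V -> V -> R).
Hypothesis ipP : semi_inner ip.
Variable T : V -> V.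
Hypothesis TP : positive_op ip T.
Implicit Types (f g h : V) (a : R).

Let opDl f g h : ip (T (f + g)) h = ip (T f) h + ip (T g) h.
Proof. by rewrite !(op_sym TP) (ipDl ipP). Qed.

Let opZl b f h : ip (T (b *: f)) h = b * ip (T f) h.
Proof. by rewrite !(op_sym TP) (ipZl ipP). Qed.

Lemma semi_inner_op : semi_inner (fun f g => ip (T f) g).
Proof.
split=> //; last exact: op_ge0 TP.
by move=> f g; rewrite (op_sym TP) (ipC ipP).
Qed.

Lemma op_comb K (psi : 'I_K -> V) (b : 'I_K -> R) g :
  ip (T (\sum_(i < K) b i *: psi i)) g = \sum_(i < K) b i * ip (T (psi i)) g.
Proof. exact: (ip_comb semi_inner_op). Qed.

Lemma op_cauchy f g : ip (T f) g ^+ 2 <= ip (T f) f * ip (T g) g.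
Proof. exact: (cauchy_schwarz semi_inner_op). Qed.

(** Cauchy-Schwarz for the form of [T], at f and T f, gives |T f|^4 <= (T f, f) (T T f, T f) <= (T
    f, f) m |T f|^2. In the applications [H] is the orthogonal complement of eigenvectors, which [T]
    preserves. *)
Lemma op_norm_le (H : V -> Prop) m f : (forall g, H g -> ip (T g) g <= m * ip g g) ->
  H f -> H (T f) -> ip (T f) (T f) <= m * ip (T f) f.
Proof.
move=> hm Hf HTf; have := op_cauchy f (T f); have := hm _ HTf.
have T0 := ip_ge0 ipP (T f); have f0 := op_ge0 TP f.
have := hm _ Hf; have := ip_ge0 ipP f.
move: (ip (T (T f)) (T f)) (ip (T f) (T f)) (ip (T f) f) T0 f0 => z y x y0 x0 ff0 hx hz hy.
have [->|yp] := eqVneq y 0; last first.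
  have {}yp : 0 < y by rewrite lt_neqAle eq_sym yp.
  rewrite -(ler_pM2l yp) -expr2 (le_trans hy)//.
  by have := ler_wpM2l x0 hz; lra.
have [m0|m0] := leP 0 m; first by rewrite mulr_ge0.
nra.
Qed.

Lemma eigen_perp_op K (psi : 'I_K -> V) lam f :
  (forall i, eigen ip T (lam i) (psi i)) -> (forall i, ip f (psi i) = 0) ->
  forall i, ip (T f) (psi i) = 0.
Proof.
by move=> ev fp i; rewrite (op_sym TP) (ipC ipP) ev (ipC ipP) fp mulr0.
Qed.

Hypothesis Tc : compact_op ip T.
Hypothesis Tb : bounded_op ip T.

(** Let m be the supremum of (T f, f) over the unit ball of the complement. Along a maximising
    sequence u, |T u - m u|^2 <= m^2 - m (T u, u) tends to 0, and compactness makes T u cluster at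
    some g, which is then an eigenvector. It is not null because m > 0. *)
Lemma top_eigenvector K (psi : 'I_K -> V) (lam : 'I_K -> R) f0 :
  (forall i, eigen ip T (lam i) (psi i)) ->
  (forall i, ip f0 (psi i) = 0) -> 0 < ip (T f0) f0 ->
  exists m h, [/\ ip h h = 1, eigen ip T m h, forall i, ip h (psi i) = 0
    & forall f, (forall i, ip f (psi i) = 0) -> ip (T f) f <= m * ip f f].
Proof.
move=> ev f0H f0p; have [M hM] := Tb.
pose H f := forall i, ip f (psi i) = 0.
pose S := [set ip (T f) f | f in [set f | H f /\ ip f f <= 1]].
have Tf0 : 0 < ip f0 f0.
  rewrite lt_neqAle ip_ge0// andbT; apply/eqP => e.
  by have := hM f0; rewrite -e mulr0 leNgt f0p.
have HZ b f : H f -> H (b *: f) by move=> Hf i; rewrite (ipZl ipP) Hf mulr0.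
have normalize f : H f -> 0 < ip f f -> S (ip (T f) f / ip f f).
  move=> Hf ff; exists ((Num.sqrt (ip f f))^-1 *: f); last first.
    rewrite opZl (ipZr ipP) mulrA -expr2 exprVn sqr_sqrtr ?(ltW ff)//.
    by rewrite mulrC.
  split; first exact: HZ.
  rewrite (ipZl ipP) (ipZr ipP) mulrA -expr2 exprVn sqr_sqrtr ?(ltW ff)// mulVf//; exact: lt0r_neq0.
have S0 : S !=set0 by exists (ip (T f0) f0 / ip f0 f0); exact: normalize.
have Sub : has_ubound S.
  exists (Num.max M 0) => _ [f [_ f1] <-]; apply: le_trans (hM f) _.
  have mM : M <= Num.max M 0 by rewrite le_max lexx.
  have m0 : 0 <= Num.max M 0 by rewrite le_max lexx orbT.
  by have := ip_ge0 ipP f; nra.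
have Ss : has_sup S by split.
pose m := sup S.
have m0 : 0 < m.
  by apply: lt_le_trans (ub_le_sup Sub (normalize _ f0H Tf0)); rewrite divr_gt0.
have hm f : H f -> ip (T f) f <= m * ip f f.
  move=> Hf; have [ff|ff] := eqVneq (ip f f) 0.
    by have := hM f; rewrite ff !mulr0.
  have {}ff : 0 < ip f f by rewrite lt_neqAle eq_sym ff ip_ge0.
  by rewrite -ler_pdivrMr//; exact: ub_le_sup Sub _ (normalize _ Hf ff).
have HT f : H f -> H (T f) by move=> Hf; exact: eigen_perp_op ev Hf.
have /choice [u hu] : forall n : nat, exists f,
    [/\ H f, ip f f <= 1 & m - n.+1%:R^-1 < ip (T f) f].
  move=> n; have n0 : 0 < n.+1%:R^-1 :> R by rewrite invr_gt0.
  by have [_ [f [Hf f1] <-] fm] := sup_adherent n0 Ss; exists f.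
have uH n : H (u n) by case: (hu n).
have u1 n : ip (u n) (u n) <= 1 by case: (hu n).
have um n : m - n.+1%:R^-1 < ip (T (u n)) (u n) by case: (hu n).
have [g hg] := Tc u1.
have key e : 0 < e -> exists n, [/\ ip (T (u n) - g) (T (u n) - g) <= e,
    m - e < ip (T (u n)) (u n)
    & ip (T (u n) - m *: u n) (T (u n) - m *: u n) <= e].
  move=> e0; pose k := (Num.truncn (e^-1 + m / e)).
  have hk : e^-1 + m / e < k.+1%:R by exact: truncnS_gt.
  have [n kn hn] := hg e e0 k.
  have n1 : n.+1%:R^-1 * (1 + m) < e.
    rewrite mulrC ltr_pdivrMr// mulrC -ltr_pdivrMr// mulrDl mul1r.
    by apply: lt_le_trans hk _; rewrite ler_nat ltnS.
  have n0 : 0 < n.+1%:R^-1 :> R by rewrite invr_gt0.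
  have qm := mulr_gt0 n0 m0.
  have umn := um n.
  move: (n.+1%:R^-1 : R) n1 n0 qm umn => q n1 n0 qm umn.
  exists n; split => //; first by lra.
  have h1 := op_norm_le hm (uH n) (HT _ (uH n)).
  rewrite !(ipE ipP) (ipC ipP (u n) (T (u n))).
  have p1 := ler_wpM2l (ltW m0) (ltW umn).
  have p2 := ler_wpM2l (sqr_ge0 m) (u1 n).
  by lra.
have eg w : ip (T g) w - m * ip g w = 0.
  set z := T w - m *: w.
  apply: (@sqr_le_eps _ _ (2 * ip z z + 2 * ip (T w) (T w))) => e e0.
  have [n [h1 h2 h3]] := key e e0.
  (* Symmetry expresses the defect of [g] through the two small vectors T u - g and T u - m u. *)
  have -> : ip (T g) w - m * ip g w =
      - ip (T (u n) - g) z + ip (T (u n) - m *: u n) (T w).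
    rewrite /z !(ipE ipP) (op_sym TP g) (op_sym TP (u n) w); lra.
  have c1 := cauchy_schwarz ipP (T (u n) - g) z.
  have c2 := cauchy_schwarz ipP (T (u n) - m *: u n) (T w).
  have z0 := ip_ge0 ipP z; have w0 := ip_ge0 ipP (T w).
  move: (ip (T (u n) - g) z) (ip (T (u n) - m *: u n) (T w)) c1 c2 => p q c1 c2.
  have : p ^+ 2 <= e * ip z z by apply: le_trans c1 _; rewrite ler_wpM2r.
  have : q ^+ 2 <= e * ip (T w) (T w) by apply: le_trans c2 _; rewrite ler_wpM2r.
  have := sqr_ge0 (p + q); nra.
have gH : H g.
  move=> i; apply: (@sqr_le_eps _ _ (ip (psi i) (psi i))) => e e0.
  have [n [h1 _ _]] := key e e0.
  have -> : ip g (psi i) = - ip (T (u n) - g) (psi i).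
    by rewrite (ipBl ipP) (HT _ (uH n)) sub0r opprK.
  rewrite sqrrN; apply: le_trans (cauchy_schwarz ipP _ _) _.
  by rewrite ler_wpM2r// ip_ge0.
have gg : 0 < ip g g.
  rewrite lt_neqAle ip_ge0// andbT; apply/eqP => /esym g0.
  have gz w : ip g w = 0.
    by apply/eqP; rewrite -sqrf_eq0 eq_le sqr_ge0 andbT
      (le_trans (cauchy_schwarz ipP _ _))// g0 mul0r.
  (* If [g] were null, some u in the unit ball would have |T u|^2 <= m^2 / 8 and (T u, u) > m / 2,
     against Cauchy-Schwarz. *)
  pose e := Num.min (m / 2) (m ^+ 2 / 8).
  have e0 : 0 < e by rewrite lt_min !divr_gt0// exprn_gt0.
  have [n [h1 h2 _]] := key e e0.
  have em : e <= m / 2 by rewrite ge_min lexx.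
  have em2 : e <= m ^+ 2 / 8 by rewrite ge_min lexx orbT.
  move: h1; rewrite !(ipE ipP) !gz (ipC ipP _ g) gz.
  have := cauchy_schwarz ipP (T (u n)) (u n); have := u1 n; have := ip_ge0 ipP (u n).
  move: (ip (T (u n)) (T (u n))) (ip (u n) (u n)) (ip (T (u n)) (u n)) h2 => x y z h2 y0 y1 c h1.
  have x0 : x <= m ^+ 2 / 8 by lra.
  have z2 : m / 2 < z by lra.
  have xy : x * y <= m ^+ 2 / 8 by have := mulr_ge0 y0 (sqr_ge0 m); nra.
  nra.
exists m, ((Num.sqrt (ip g g))^-1 *: g); split => //.
- rewrite (ipZl ipP) (ipZr ipP) mulrA -expr2 exprVn sqr_sqrtr ?(ltW gg)// mulVf//; exact: lt0r_neq0.
- by move=> w; rewrite opZl (ipZl ipP) mulrCA; congr (_ * _); apply/eqP; rewrite -subr_eq0 eg.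
- exact: HZ.
Qed.

End PositiveOperator.

(** * Leading eigenvectors and perturbation *)

Section Leading.
Variables (R : realType) (V : lmodType R) (ip : V -> V -> R).
Hypothesis ipP : semi_inner ip.
Implicit Types (f g h : V).

(** Abstract form of [leading_eigenfunctions]. The last clause compares eigenvectors only;
    [leading_perp] upgrades it to a bound on the whole complement. *)
Definition leading (T : V -> V) K (psi : 'I_K -> V) (lam : 'I_K -> R) :=
  [/\ orthonormal_fam ip psi, forall i, eigen ip T (lam i) (psi i),
      forall i j : 'I_K, (i <= j)%N -> lam j <= lam i
    & forall nu h, ip h h != 0 -> eigen ip T nu h ->
        (forall i, ip h (psi i) = 0) -> forall i, nu <= lam i].

Variable T : V -> V.
Hypothesis TP : positive_op ip T.
Hypothesis Tc : compact_op ip T.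
Hypothesis Tb : bounded_op ip T.

(** If the form is positive somewhere on the complement, its maximum there is an eigenvalue by
    [top_eigenvector], and the last clause of [leading] applies to it. *)
Lemma leading_perp K (psi : 'I_K -> V) lam : leading T psi lam ->
  forall f, (forall i, ip f (psi i) = 0) -> forall i, ip (T f) f <= lam i * ip f f.
Proof.
move=> [on ev mono top] f fp i.
have lam0 j : 0 <= lam j.
  by have := op_ge0 TP (psi j); rewrite ev on eqxx mulr1.
have [h|h] := leP (ip (T f) f) 0.
  by rewrite (le_trans h)// mulr_ge0 ?lam0 ?ip_ge0.
have [m [g [g1 gev gp hm]]] := top_eigenvector ipP TP Tc Tb ev fp h.
apply: le_trans (hm _ fp) _; rewrite ler_wpM2r ?ip_ge0//.
by apply: top gp _ => //; rewrite g1 oner_eq0.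
Qed.

Section Weyl.
Variables (K : nat) (psi e : 'I_K -> V) (lam : 'I_K -> R) (a : R).
Hypothesis psiP : leading T psi lam.
Hypothesis one : orthonormal_fam ip e.
Hypothesis le_a : forall b : 'I_K -> R, let f := \sum_(i < K) b i *: e i in
  a * ip f f <= ip (T f) f.

(** Some nonzero combination of the [e i] is orthogonal to all the [psi] but the last. There the
    form is at least [a] and at most the last [lam]. This holds for any leading family, whether or
    not the eigenvalues are simple. *)
Lemma weyl_ge i : a <= lam i.
Proof.
have [on ev mono top] := psiP.
case: K psi e lam psiP one le_a on ev mono top i => [|k] psi' e' lam' ld one' lea on ev mono top i.
  by case: i.
apply: le_trans (_ : lam' ord_max <= _); last by apply: mono; rewrite -ltnS.
have [b /= [ff fp]] := orthonormal_perp ipP (fun j : 'I_k => psi' (widen_ord (leqnSn k) j)) one'.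
set f := \sum_(i < k.+1) _ in ff fp.
rewrite -(ler_pM2r ff); apply: le_trans (lea b) _; rewrite -/f.
set g := span_proj ip psi' f.
have fpj j : j != ord_max -> ip f (psi' j) = 0.
  move=> jm; have jk : (j < k)%N.
    by rewrite ltn_neqAle -ltnS ltn_ord andbT; apply: contra jm => /eqP jk; apply/eqP/val_inj.
  by rewrite -(fp (Ordinal jk)); congr (ip _ (psi' _)); exact: val_inj.
have gE : g = ip f (psi' ord_max) *: psi' ord_max.
  by rewrite /g /span_proj (bigD1 ord_max)//= big1 ?addr0// => j jm; rewrite fpj// scale0r.
have [t [h [hp fE]]] : exists t h, (forall j, ip h (psi' j) = 0) /\ f = t *: psi' ord_max + h.
  exists (ip f (psi' ord_max)), (f - g); split; first by move=> j; exact: proj_perp.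
  by rewrite -gE addrC subrK.
have Th : ip (T h) (psi' ord_max) = 0 by exact: (eigen_perp_op ipP TP ev hp).
have TT := semi_inner_op ipP TP.
have Th' : ip (T (psi' ord_max)) h = 0 by rewrite -Th; exact: (ipC TT).
have hp' : ip (psi' ord_max) h = 0 by rewrite (ipC ipP).
rewrite fE (ipDl TT) !(ipDr TT) !(ipZl TT) !(ipZr TT) /= Th Th'.
rewrite (ev ord_max) on eqxx !(ipE ipP) hp hp' on eqxx.
by have := leading_perp ld hp ord_max; move: (lam' _) => l /=; lra.
Qed.

Variable a' : R.
Hypothesis ge_a' : forall f, (forall i, ip f (e i) = 0) -> ip (T f) f <= a' * ip f f.
Hypothesis aa' : a' < a.

(** Suppose the form exceeds [a'] at [h]. It is at least [a > a'] on the span of [psi], so it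
    exceeds [a'] on the span of [psi] and [h]. But a nontrivial combination of these [K.+1] vectors
    is orthogonal to every [e i], where the form is at most [a']. *)
Lemma weyl_le h : (forall i, ip h (psi i) = 0) -> ip (T h) h <= a' * ip h h.
Proof.
move=> hp; have [on ev mono top] := psiP.
rewrite leNgt; apply/negP => hh.
pose e' (i : 'I_K.+1) := if unlift ord_max i is Some j then psi j else h.
have [b [i bi] bg] := comb_perp ipP e' e.
set f := \sum_(i < K.+1) b i *: e' i in bg.
pose p := \sum_(i < K) b (lift ord_max i) *: psi i; pose t := b ord_max.
have fE : f = p + t *: h.
  rewrite /f (bigD1 ord_max)//= addrC /e' unlift_none; congr (_ + _).
  rewrite big_mkcond big_ord_recr/= eqxx addr0; apply: eq_bigr => j _.
  have -> : widen_ord (leqnSn K) j = lift ord_max j.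
    by apply: val_inj; rewrite /= /bump leqNgt ltn_ord.
  by rewrite eq_sym neq_lift liftK.
have ph : ip p h = 0.
  by rewrite (ip_comb ipP) big1// => j _; rewrite (ipC ipP) hp mulr0.
have Tph : ip (T p) h = 0.
  rewrite (op_comb ipP TP) big1// => j _.
  by rewrite ev (ipC ipP) hp !mulr0.
have pp : ip p p = \sum_(i < K) b (lift ord_max i) ^+ 2 by rewrite (ip_comb2 ipP _ _ on).
have Tpp : a * ip p p <= ip (T p) p.
  rewrite pp mulr_sumr (op_comb ipP TP); apply: ler_sum => j _.
  have pj : ip (psi j) p = b (lift ord_max j).
    by rewrite (ipC ipP); exact: (ip_comb_on ipP).
  rewrite ev pj (mulrCA (b _)) -expr2.
  by rewrite ler_wpM2r ?sqr_ge0//; exact: weyl_ge.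
have := ge_a' bg; have TT := semi_inner_op ipP TP.
have Thp : ip (T h) p = 0 by rewrite -Tph; exact: (ipC TT).
have hp0 : ip h p = 0 by rewrite (ipC ipP).
rewrite fE; move: (p) ph Tph Thp hp0 pp Tpp => q qh Tqh Thq hq qq Tqq.
rewrite (ipDl TT) !(ipDr TT) !(ipZl TT) !(ipZr TT) /= Tqh Thq.
rewrite !(ipE ipP) qh hq => le1.
have p0 := ip_ge0 ipP q.
have [t0|t0] := eqVneq t 0.
  have : 0 < ip q q.
    have [j ij] : exists j, i = lift ord_max j.
      case: (unliftP ord_max i) => [j ij|im]; first by exists j.
      by move: bi; rewrite im -/t t0 eqxx.
    rewrite qq; apply: (sum_sqr_gt0 (i := j)); by rewrite -ij.
  move=> q0; have ba : 0 < a - a' by rewrite subr_gt0.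
  by have := mulr_gt0 ba q0; move: le1; rewrite t0; lra.
have t2 : 0 < t ^+ 2 by rewrite lt_neqAle sqr_ge0 andbT eq_sym sqrf_eq0.
have ba : 0 <= a - a' by rewrite subr_ge0 ltW.
have ho : 0 < ip (T h) h - a' * ip h h by rewrite subr_gt0.
by have := mulr_gt0 t2 ho; have := mulr_ge0 ba p0; lra.
Qed.
End Weyl.

(** Indexed by [nat], so that families can be lengthened and shortened. The last clause is the
    maximality that the inductive construction produces; it implies [leading]. *)
Definition strongly_leading K (psi : nat -> V) (lam : nat -> R) :=
  [/\ forall i j, (i < K)%N -> (j < K)%N -> ip (psi i) (psi j) = (i == j)%:R,
      forall i, (i < K)%N -> eigen ip T (lam i) (psi i)
    & forall i, (i < K)%N -> forall f, (forall j, (j < i)%N -> ip f (psi j) = 0) ->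
        ip (T f) f <= lam i * ip f f].

(** Induction on [K]: maximise the form on the complement of the vectors already found. If the form
    vanishes there, any unit vector of the complement has eigenvalue 0, and infinite dimension
    supplies one. *)
Lemma strongly_leading_exists :
  (forall n, exists e : 'I_n -> V, orthonormal_fam ip e) ->
  forall K, exists psi lam, strongly_leading K psi lam.
Proof.
move=> inf; elim=> [|K [psi [lam [on ev top]]]].
  by exists (fun=> 0), (fun=> 0); split.
pose psiK (i : 'I_K) := psi i; pose lamK (i : 'I_K) := lam i.
have onK : orthonormal_fam ip psiK by move=> i j; rewrite on.
have evK i : eigen ip T (lamK i) (psiK i) by exact: ev.
suff [m [h [h1 hev hp hm]]] : exists m h, [/\ ip h h = 1, eigen ip T m h,
    forall i : 'I_K, ip h (psiK i) = 0
    & forall f, (forall i : 'I_K, ip f (psiK i) = 0) -> ip (T f) f <= m * ip f f].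
  pose psi' i := if (i < K)%N then psi i else h.
  pose lam' i := if (i < K)%N then lam i else m.
  have hp' j : (j < K)%N -> ip h (psi j) = 0 by move=> jK; exact: (hp (Ordinal jK)).
  exists psi', lam'; split.
  - move=> i j; rewrite !ltnS /psi'; case: ltngtP => // iK _; case: ltngtP => // jK _.
    + exact: on.
    + by rewrite (ipC ipP) hp'// jK ltn_eqF.
    + by rewrite hp'// iK gtn_eqF.
    + by rewrite h1 iK jK eqxx.
  - move=> i; rewrite ltnS /psi' /lam'; case: ltngtP => // iK _; exact: ev.
  - move=> i; rewrite ltnS /psi' /lam'; case: ltngtP => // iK _ f fp.
      by apply: top => // j ji; have := fp _ ji; rewrite (ltn_trans ji iK).
    by apply: hm => j; have := fp j; rewrite iK ltn_ord => ->.
have [[f [fp f0]]|no] := pselect (exists f, (forall i, ip f (psiK i) = 0) /\ 0 < ip (T f) f).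
  exact: top_eigenvector evK fp f0.
have {}no f : (forall i, ip f (psiK i) = 0) -> ip (T f) f = 0.
  move=> fp; apply/eqP; rewrite eq_le (op_ge0 TP) andbT leNgt; apply/negP => f0.
  by apply: no; exists f.
have [e one] := inf K.+1.
have [b /= [ff fp]] := orthonormal_perp ipP psiK one.
set f := \sum_(i < _) _ in ff fp.
have s0 : Num.sqrt (ip f f) != 0 by rewrite gt_eqF// sqrtr_gt0.
exists 0, ((Num.sqrt (ip f f))^-1 *: f); split.
- rewrite !(ipE ipP) mulrA -expr2 exprVn sqr_sqrtr ?(ltW ff)// mulVf//.
  by rewrite gt_eqF.
- move=> g; have TT := semi_inner_op ipP TP; rewrite (ipZl TT) mul0r.
  suff -> : ip (T f) g = 0 by rewrite mulr0.
  apply/eqP; rewrite -sqrf_eq0 eq_le sqr_ge0 andbT.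
  by apply: le_trans (op_cauchy ipP TP _ _) _; rewrite no// mul0r.
- by move=> i; rewrite (ipZl ipP) fp mulr0.
- by move=> g gp; rewrite no// mul0r.
Qed.

Lemma strongly_leading_leading K psi lam : strongly_leading K psi lam ->
  leading T (fun i : 'I_K => psi i) (fun i => lam i).
Proof.
move=> [on ev top]; split.
- by move=> i j; rewrite on.
- by move=> i; exact: ev.
(* The maximality of [lam i] is evaluated at [psi j], which is orthogonal to every vector before
   index [i]. *)
- move=> i j ij; have := top i (ltn_ord i) (psi j).
  rewrite ev// on// eqxx !mulr1; apply=> k ki.
  by rewrite on// ?(ltn_trans ki)// gtn_eqF// (leq_trans ki).
- move=> nu h h0 hev hp i; have := top i (ltn_ord i) h.
  rewrite hev ler_pM2r ?lt_neqAle ?(eq_sym 0) ?h0 ?ip_ge0//; apply=> j ji.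
  exact: (hp (Ordinal (ltn_trans ji (ltn_ord i)))).
Qed.

Lemma strongly_leading_le K K' psi lam : (K' <= K)%N -> strongly_leading K psi lam ->
  strongly_leading K' psi lam.
Proof.
move=> le [on ev top]; split.
- by move=> i j iK jK; apply: on; apply: leq_trans le.
- by move=> i iK; apply: ev; apply: leq_trans le.
- by move=> i iK; apply: top; apply: leq_trans le.
Qed.

Lemma strongly_leading_minmax K psi lam n (e : 'I_n.+1 -> V) a : strongly_leading K psi lam ->
  (n < K)%N -> orthonormal_fam ip e ->
  (forall b : 'I_n.+1 -> R, let f := \sum_(i < n.+1) b i *: e i in
    a * ip f f <= ip (T f) f) -> a <= lam n.
Proof.
move=> sl nK one lea.
by have /(_ ord_max)/= := weyl_ge (strongly_leading_leading (strongly_leading_le nK sl)) one lea.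
Qed.

End Leading.

(** * The Davis-Kahan sine theorem *)

Section DavisKahan.
Variables (R : realType) (V : lmodType R) (ip : V -> V -> R).
Hypothesis ipP : semi_inner ip.
Implicit Types (f g h : V).

(** Polarisation: 4 t |E f|^2 is the difference of the forms at f + t E f and f - t E f, hence at
    most 2 d (|f|^2 + t^2 |E f|^2). The choice t = 1/d concludes. *)
Lemma sym_norm_le (E : V -> V) d : 0 <= d ->
  (forall f g, ip (E f) g = ip f (E g)) ->
  (forall f, `|ip (E f) f| <= d * ip f f) ->
  forall f, ip (E f) (E f) <= d ^+ 2 * ip f f.
Proof.
move=> d0 Es Ef f.
have ED f1 f2 g : ip (E (f1 + f2)) g = ip (E f1) g + ip (E f2) g.
  by rewrite !Es (ipDl ipP).
have EZ c f1 g : ip (E (c *: f1)) g = c * ip (E f1) g by rewrite !Es (ipZl ipP).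
have key t : 4 * t * ip (E f) (E f) <= 2 * d * (ip f f + t ^+ 2 * ip (E f) (E f)).
  have /ler_normlP [_ h1] := Ef (f + t *: E f).
  have /ler_normlP [h2 _] := Ef (f - t *: E f).
  move: h1 h2; rewrite -!scaleNr !(ED, EZ, ipE ipP) (Es (E f) f).
  by lra.
have f0 := ip_ge0 ipP f; have y0 := ip_ge0 ipP (E f).
have [d00|dn] := eqVneq d 0.
  by have := key 1; rewrite d00; lra.
have dp : 0 < d by rewrite lt_neqAle eq_sym dn.
have := key d^-1; rewrite -(ler_pM2l dp).
have -> : d * (4 * d^-1 * ip (E f) (E f)) = 4 * ip (E f) (E f) by field.
have -> : d * (2 * d * (ip f f + d^-1 ^+ 2 * ip (E f) (E f))) =
  2 * d ^+ 2 * ip f f + 2 * ip (E f) (E f) by field.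
lra.
Qed.

(* If [s] bounds [span_proj psi] on the complement of [phi], then so does *)
(* [(s * b' + d) / a]; iterating, so does its fixed point. *)
Lemma half_davis_kahan (A B : V -> V) K (psi phi : 'I_K -> V) (lam : 'I_K -> R) a b' d :
  positive_op ip A -> positive_op ip B ->
  orthonormal_fam ip psi -> (forall i, eigen ip A (lam i) (psi i)) ->
  (forall i, a <= lam i) ->
  (forall w, (forall i, ip w (phi i) = 0) -> ip (B w) w <= b' * ip w w) ->
  (forall w, (forall i, ip w (phi i) = 0) -> forall i, ip (B w) (phi i) = 0) ->
  (forall w, ip (A w - B w) (A w - B w) <= d ^+ 2 * ip w w) ->
  0 <= b' -> 0 <= d -> b' < a ->
  forall w, (forall i, ip w (phi i) = 0) ->
    (a - b') ^+ 2 * ip (span_proj ip psi w) (span_proj ip psi w) <= d ^+ 2 * ip w w.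
Proof.
move=> AP BP on ev lea leb Bp Ed b0 d0 ab.
pose nrm f := Num.sqrt (ip f f).
have nrm0 f : 0 <= nrm f by exact: sqrtr_ge0.
have nrm2 f : nrm f ^+ 2 = ip f f by rewrite sqr_sqrtr ?ip_ge0.
have nrmle f c : 0 <= c -> ip f f <= c ^+ 2 -> nrm f <= c.
  by move=> c0 h; rewrite -(ler_pXn2r (n := 2)) ?nnegrE ?nrm2.
have a0 : 0 < a by exact: le_lt_trans ab.
have Pd f g : span_proj ip psi (f + g) = span_proj ip psi f + span_proj ip psi g.
  by rewrite /span_proj -big_split; apply: eq_bigr => i _; rewrite (ipDl ipP) scalerDl.
have Ple f : nrm (span_proj ip psi f) <= nrm f.
  by apply: nrmle => //; rewrite nrm2 (pythagoras ipP f on) lerDl ip_ge0.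
have tri f g : nrm (f + g) <= nrm f + nrm g.
  apply: nrmle; first exact: addr_ge0.
  rewrite sqrrD !nrm2 !(ipE ipP) (ipC ipP g f).
  suff : ip f g <= nrm f * nrm g by lra.
  apply: le_trans (ler_norm _) _.
  rewrite -(ler_pXn2r (n := 2)) ?nnegrE ?mulr_ge0// real_normK ?num_real//.
  by rewrite exprMn !nrm2 cauchy_schwarz.
pose H w := forall i, ip w (phi i) = 0.
have step s : 0 <= s -> (forall w, H w -> nrm (span_proj ip psi w) <= s * nrm w) ->
    forall w, H w -> nrm (span_proj ip psi w) <= (s * b' + d) / a * nrm w.
  move=> s0 hs w Hw.
  have h1 : a * nrm (span_proj ip psi w) <= nrm (span_proj ip psi (A w)).
    rewrite -(ler_pXn2r (n := 2)) ?nnegrE ?mulr_ge0// ?(ltW a0)//.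
    rewrite exprMn !nrm2 !(ip_comb2 ipP _ _ on) mulr_sumr; apply: ler_sum => i _.
    rewrite (op_sym AP) (ipC ipP w (A _)) ev (ipC ipP (psi i)) -!expr2 exprMn.
    rewrite ler_wpM2r ?sqr_ge0// ler_pXn2r ?nnegrE// ?(ltW a0)//.
    exact: le_trans (ltW a0) (lea i).
  have h2 : nrm (span_proj ip psi (A w)) <= nrm (span_proj ip psi (B w)) + d * nrm w.
    have -> : A w = B w + (A w - B w) by rewrite addrC subrK.
    rewrite Pd; apply: le_trans (tri _ _) _; rewrite lerD2l.
    apply: le_trans (Ple _) _; apply: nrmle; first by rewrite mulr_ge0.
    by rewrite exprMn nrm2.
  have h3 : nrm (B w) <= b' * nrm w.
    apply: nrmle; first by rewrite mulr_ge0.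
    rewrite exprMn nrm2 expr2 -mulrA.
    apply: le_trans (op_norm_le ipP BP leb Hw (Bp _ Hw)) _.
    by rewrite ler_wpM2l// leb.
  have h4 : nrm (span_proj ip psi (B w)) <= s * (b' * nrm w).
    by apply: le_trans (hs _ (Bp _ Hw)) _; rewrite ler_wpM2l.
  rewrite mulrAC ler_pdivlMr// mulrC; have := nrm0 w; lra.
suff main w : H w -> (a - b') * nrm (span_proj ip psi w) <= d * nrm w.
  move=> w Hw; rewrite -!nrm2 -!exprMn; apply: lerXn2r (main _ Hw); rewrite nnegrE mulr_ge0//.
  by rewrite subr_ge0 ltW.
move=> Hw.
(* The fixed point is reached without iteration: the infimum s of the admissible constants is
   admissible, and [step] gives s <= (s b' + d) / a, that is (a - b') s <= d. *)
pose S := [set s : R | 0 <= s /\ forall w, H w -> nrm (span_proj ip psi w) <= s * nrm w].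
have S1 : S 1 by split => // v _; rewrite mul1r.
have Sl : lbound S 0 by move=> s [].
have Si : has_inf S by split; [exists 1|exists 0].
have Sinf : S (inf S).
  split; first by apply: lb_le_inf => //; exists 1.
  move=> v Hv; have [v0|v0] := eqVneq (nrm v) 0.
    by rewrite v0 mulr0 -v0.
  have {}v0 : 0 < nrm v by rewrite lt_neqAle eq_sym v0 nrm0.
  rewrite -ler_pdivrMr//; apply: lb_le_inf; first by exists 1.
  by move=> s [s0 hs]; rewrite ler_pdivrMr// hs.
have [s0 hs] := Sinf.
have : S ((inf S * b' + d) / a).
  split; last exact: step.
  by rewrite divr_ge0// ?(ltW a0)// addr_ge0// mulr_ge0.
move=> Sn.
have hle : inf S <= (inf S * b' + d) / a by apply: ge_inf => //; exists 0.
have := hs _ Hw; move: hle; rewrite ler_pdivlMr// => hle h5.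
have : (a - b') * inf S <= d by lra.
have := nrm0 w; have : 0 < a - b' by rewrite subr_gt0.
by nra.
Qed.

(** Let P and Q be the projections, u = f - Q f and v = Q f - P Q f. Then P f - Q f = P u - v, a sum
    of orthogonal terms. [half_davis_kahan] bounds the first by |u| and, with the roles exchanged,
    the second by |Q f|. As |u|^2 + |Q f|^2 = |f|^2, no constant is lost. *)
Lemma davis_kahan (A B : V -> V) K (psi phi : 'I_K -> V) (lam be : 'I_K -> R) a a' b b' d eta :
  positive_op ip A -> positive_op ip B ->
  orthonormal_fam ip psi -> (forall i, eigen ip A (lam i) (psi i)) ->
  orthonormal_fam ip phi -> (forall i, eigen ip B (be i) (phi i)) ->
  (forall i, a <= lam i) -> (forall i, b <= be i) ->
  (forall w, (forall i, ip w (psi i) = 0) -> ip (A w) w <= a' * ip w w) ->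
  (forall w, (forall i, ip w (phi i) = 0) -> ip (B w) w <= b' * ip w w) ->
  (forall w, ip (A w - B w) (A w - B w) <= d ^+ 2 * ip w w) ->
  0 <= a' -> 0 <= b' -> 0 <= d -> 0 < eta -> eta <= a - b' -> eta <= b - a' ->
  forall f, let g := span_proj ip psi f - span_proj ip phi f in
    eta ^+ 2 * ip g g <= d ^+ 2 * ip f f.
Proof.
move=> AP BP onA evA onB evB leA leB topA topB Ed a0 b0 d0 e0 ea eb f /=.
set g := span_proj ip psi f - span_proj ip phi f.
have Ed' w : ip (B w - A w) (B w - A w) <= d ^+ 2 * ip w w.
  by rewrite -opprB (ipNl ipP) (ipNr ipP) opprK.
have h1 := half_davis_kahan AP BP onA evA leA topB
  (fun w hw => eigen_perp_op ipP BP evB hw) Ed b0 d0 _.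
have h2 := half_davis_kahan BP AP onB evB leB topA
  (fun w hw => eigen_perp_op ipP AP evA hw) Ed' a0 d0 _.
pose P := span_proj ip psi; pose Q := span_proj ip phi.
pose u := f - Q f; pose v := Q f - P (Q f).
have uQ i : ip u (phi i) = 0 by exact: proj_perp.
have vP i : ip v (psi i) = 0 by exact: proj_perp.
have ab : b' < a by lra.
have ba : a' < b by lra.
have {h1} h1 : eta ^+ 2 * ip (P u) (P u) <= d ^+ 2 * ip u u.
  apply: le_trans (h1 ab _ uQ); rewrite ler_wpM2r ?ip_ge0// ler_pXn2r ?nnegrE//; lra.
have Pd x y : P (x - y) = P x - P y.
  rewrite /P /span_proj -sumrB; apply: eq_bigr => i _.
  by rewrite (ipBl ipP) scalerBl.
have gE : g = P u - v.
  by rewrite /g /u /v Pd -/(P f) -/(Q f) opprB addrA -(addrA (P f)) addNr addr0.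
have Puv : ip (P u) v = 0.
  rewrite /P /span_proj (ip_comb ipP) big1// => i _; by rewrite (ipC ipP _ v) vP mulr0.
have gg : ip g g = ip (P u) (P u) + ip v v.
  have pyth x y : ip x y = 0 -> ip (x - y) (x - y) = ip x x + ip y y.
    by move=> xy; rewrite !(ipE ipP) (ipC ipP y) xy; lra.
  by rewrite gE pyth.
have hv : eta ^+ 2 * ip v v <= d ^+ 2 * ip (Q f) (Q f).
  (* As v is orthogonal to the range of P, |v|^2 = (v, Q f) = (Q v, Q f), and v is a vector to which
     the half theorem applies. *)
  have vv : ip v v = ip (Q v) (Q f).
    have -> : ip v v = ip v (Q f).
      have vPf : ip v (P (Q f)) = 0.
        by rewrite (ipC ipP) (ip_comb ipP) big1// => i _; rewrite (ipC ipP _ v) vP mulr0.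
      by rewrite {2}/v (ipBr ipP) vPf subr0.
    by rewrite (ipC ipP (Q v)) (ip_proj_proj ipP _ _ onB) (ipC ipP).
  have h3 : eta ^+ 2 * ip (Q v) (Q v) <= d ^+ 2 * ip v v.
    apply: le_trans (h2 ba _ vP); rewrite ler_wpM2r ?ip_ge0// ler_pXn2r ?nnegrE//; lra.
  have := cauchy_schwarz ipP (Q v) (Q f); rewrite -vv => cs.
  have [v0|v0] := eqVneq (ip v v) 0.
    by rewrite v0 mulr0 mulr_ge0 ?sqr_ge0 ?ip_ge0.
  have {}v0 : 0 < ip v v by rewrite lt_neqAle eq_sym v0 ip_ge0.
  rewrite -(ler_pM2r v0) -mulrA -expr2.
  apply: le_trans (ler_wpM2l (sqr_ge0 _) cs) _.
  rewrite mulrA; apply: le_trans (ler_wpM2r (ip_ge0 ipP _) h3) _.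
  by rewrite mulrAC.
rewrite gg mulrDr (pythagoras ipP f onB) -/(Q f) -/u mulrDr addrC.
exact: lerD.
Qed.

End DavisKahan.

(** * The space L2(-1, 1) *)

Section MeasureM11.
Variable R : realType.
Notation mu := (@mu11 R).
Notation leb := (@lebesgue_measure R).
Notation I11 := (`](-1 : R), (1 : R)[%classic).

Lemma mu11_setT : mu setT = 2%:E.
Proof.
rewrite /mu11/= /mrestr setTI lebesgue_measure_itv/= lte_fin.
by rewrite ifT; [rewrite -EFinB; congr EFin; lra | lra].
Qed.

Lemma mu11_compl : mu (~` I11) = 0%E.
Proof. by rewrite /mu11/= /mrestr setICl measure0. Qed.

Lemma mu11_ae (P : R -> Prop) : (forall x, -1 < x < 1 -> P x) -> {ae mu, forall x, P x}.
Proof.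
move=> h; exists (~` I11); split; [exact: measurableC | exact: mu11_compl|].
by move=> x /= nP; rewrite in_itv/= => /h.
Qed.

Lemma mu11_fin_num_fun : fin_num_fun mu.
Proof.
move=> A mA; rewrite ge0_fin_numE//; apply: (@le_lt_trans _ _ (mu setT)).
  by apply: le_measure; rewrite ?inE.
by rewrite mu11_setT ltry.
Qed.

HB.instance Definition _ := @isFinite.Build _ _ R mu mu11_fin_num_fun.

Lemma mu11_integral (f : measurableTypeR R -> \bar R) : measurable_fun setT f ->
  (\int[mu]_x f x = \int[leb]_(x in I11) f x)%E.
Proof.
move=> mf.
rewrite -(setUv I11) integral_setU//=; last 3 first.
- exact: measurableC.
- exact: measurable_funTS.
- by apply/disj_setPS => x [].
rewrite [X in (_ + X)%E]null_set_integral ?adde0//.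
- by apply: eq_measure_integral => A mA /setIidPl AI; rewrite /mu11/= /mrestr AI.
- exact: measurableC.
- exact: measurable_funTS.
- exact: mu11_compl.
Qed.

Lemma mu11_Rint (f : measurableTypeR R -> R) : measurable_fun setT f ->
  \int[mu]_x f x = \int[leb]_(x in `[-1, 1]) f x.
Proof.
move=> mf; rewrite /Rintegral; congr fine.
rewrite mu11_integral; last exact/measurable_EFinP.
rewrite integral_itv_bndo_bndc ?integral_itv_obnd_cbnd//.
- by apply/measurable_EFinP; exact: measurable_funTS.
- by apply/measurable_EFinP; exact: measurable_funTS.
Qed.

Lemma mu11_integrable (f : measurableTypeR R -> R) (M : R) : measurable_fun setT f ->
  (forall x, -1 < x < 1 -> `|f x| <= M) -> mu.-integrable setT (EFin \o f).
Proof.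
move=> mf fM; have mE : measurable_fun setT (EFin \o f) by exact/measurable_EFinP.
apply/integrableP; split => //.
rewrite (mu11_integral (f := fun x => `|(EFin \o f) x|%E)); last exact: measurableT_comp.
apply: (@le_lt_trans _ _ (\int[leb]_(x in I11) (`|M|)%:E)%E).
  apply: ge0_le_integral; first exact: measurable_itv.
  - by move=> x _; exact: abse_ge0.
  - by apply: measurable_funTS; exact: measurableT_comp.
  - exact: measurable_cst.
  - move=> x /=; rewrite in_itv/= => xI; rewrite lee_fin.
    by apply: le_trans (fM _ xI) _; exact: ler_norm.
by rewrite integral_cst//= lebesgue_measure_itv/=; case: ifP; rewrite ?mule0 -?EFinB -?EFinM ltry.
Qed.

End MeasureM11.

Section L2space.
Variable R : realType.
Notation mu := (@mu11 R).
Notation leb := (@lebesgue_measure R).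
Notation L2 := (LfunType mu (lee1n 2)).
Implicit Types (f g h : L2).

Definition ip2 f g : R := inner f g.

Lemma L2_mfun f : measurable_fun setT f.
Proof. by have := LfunP f; rewrite inE => /andP[]; rewrite inE. Qed.

Lemma L2_mul_integrable (f g : R -> R) : f \in Lfun mu 2%:E -> g \in Lfun mu 2%:E ->
  mu.-integrable setT (EFin \o (fun x => f x * g x)).
Proof. by move=> hf hg; apply/Lfun1_integrable; exact: Lfun2_mul_Lfun1. Qed.

Lemma ip2_integrable f g : mu.-integrable setT (EFin \o (fun x => f x * g x)).
Proof. by apply: L2_mul_integrable; exact: LfunP. Qed.

Lemma ip2_semi : semi_inner ip2.
Proof.
split=> [f g|f g h|a f h|f].
- by rewrite /ip2 /inner; apply: eq_Rintegral => x _; rewrite mulrC.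
- rewrite /ip2 /inner -RintegralD//; try exact: ip2_integrable.
  by apply: eq_Rintegral => x _; rewrite mulrDl.
- rewrite /ip2 /inner -RintegralZl//; try exact: ip2_integrable.
  by apply: eq_Rintegral => x _; rewrite mulrA.
- by apply: Rintegral_ge0 => x _; rewrite -expr2 sqr_ge0.
Qed.

Lemma norm2_ip f : norm2 f = (Num.sqrt (ip2 f f))%:E.
Proof.
rewrite /norm2 unlock /=.
have -> : (\int[mu]_x (`|(EFin \o f) x| `^ 2) = (ip2 f f)%:E)%E.
  rewrite /ip2 /inner /Rintegral fineK; last exact: (integrable_fin_num measurableT (ip2_integrable f f)).
  apply: eq_integral => x _ /=; congr EFin.
  by rewrite powR_mulrn// real_normK ?num_real// expr2.
by rewrite poweR_EFin powR12_sqrt//; exact: (ip_ge0 ip2_semi).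
Qed.

Lemma bounded_L2 (f : measurableTypeR R -> R) (M : R) : measurable_fun setT f ->
  (forall x, -1 < x < 1 -> `|f x| <= M) -> f \in Lfun mu 2%:E.
Proof.
move=> mf fM; rewrite inE; apply/andP; split; rewrite inE//=.
rewrite /finite_norm unlock /=.
apply: poweR_lty.
have /integrableP[_] : mu.-integrable setT (EFin \o (fun x => f x ^+ 2)).
  apply: (@mu11_integrable _ _ (M ^+ 2)); first exact: measurable_funX.
  move=> x xI; rewrite normrX; apply: lerXn2r (fM _ xI) => //.
  by rewrite nnegrE (le_trans _ (fM _ xI)).
apply: le_lt_trans; apply: ge0_le_integral; first exact: measurableT.
- by move=> x _; rewrite lee_fin powR_ge0.
- apply/measurable_EFinP/(@measurableT_comp _ _ _ _ _ _ (fun x : R => x `^ 2)%R) => //.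
  exact: measurableT_comp.
- do 2 apply: measurableT_comp => //; exact: measurable_funX.
- by move=> x _ /=; rewrite lee_fin powR_mulrn// normrX.
Qed.

Lemma continuous_L2 (f : R -> R) : continuous f -> (f : measurableTypeR R -> R) \in Lfun mu 2%:E.
Proof.
move=> cf; have [M hM] : exists M, forall x, -1 <= x <= 1 -> `|f x| <= M.
  have [c cI hc] := @EVT_max R (fun x => `|f x|) (-1) 1 ltac:(lra) ltac:(
    by apply: continuous_subspaceT => x; apply: continuous_comp; [exact: cf|exact: norm_continuous]).
  by exists `|f c| => x xI; apply: hc; rewrite in_itv.
apply: (bounded_L2 (M := M)); first exact: continuous_measurable_fun.
by move=> x /andP[x1 x2]; apply: hM; rewrite !ltW.
Qed.

Definition toL2 (f : R -> R) (Hf : f \in Lfun mu 2%:E) : L2 := Lfun_Sub (lee1n 2) Hf.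

Lemma toL2E (f : R -> R) (Hf : f \in Lfun mu 2%:E) : toL2 Hf = f :> (R -> R).
Proof. by []. Qed.

Lemma eq_ip2 (f f' g g' : R -> R) : measurable_fun setT f -> measurable_fun setT f' ->
  measurable_fun setT g -> measurable_fun setT g' ->
  {ae mu, forall x, f x = f' x} -> {ae mu, forall x, g x = g' x} ->
  inner f g = inner f' g'.
Proof.
move=> mf mf' mg mg' ff' gg'; rewrite /inner /Rintegral; congr fine.
apply: ae_eq_integral => //.
- by apply/measurable_EFinP; exact: measurable_funM.
- by apply/measurable_EFinP; exact: measurable_funM.
- have FF : Filter (nbhs (almost_everywhere mu)) by exact: ae_filter_ringOfSetsType.
  by apply: filterS2 ff' gg' => x e1 e2 _; rewrite /= e1 e2.
Qed.

Lemma ip2_eq0 f : ip2 f f = 0 -> {ae mu, forall x, f x = 0}.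
Proof.
move=> f0.
have : (\int[mu]_x `|(f x * f x)%:E| = 0)%E.
  under eq_integral => x _ do rewrite gee0_abs ?lee_fin -?expr2 ?sqr_ge0//.
  under eq_integral => x _ do rewrite expr2.
  have h := integrable_fin_num measurableT (ip2_integrable f f).
  by rewrite -[LHS]fineK// -[X in X%:E]/(ip2 f f) f0.
have mff : measurable_fun setT (fun x => (f x * f x)%:E).
  by apply/measurable_EFinP; apply: measurable_funM; exact: L2_mfun.
move=> /(ae_eq_integral_abs _ measurableT mff).
have FF : Filter (nbhs (almost_everywhere mu)) by exact: ae_filter_ringOfSetsType.
apply: filterS.
by move=> x /(_ I) [] /eqP; rewrite mulf_eq0 orbb => /eqP.
Qed.

Lemma ae_ip2_eq0 f : {ae mu, forall x, f x = 0} -> ip2 f f = 0.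
Proof.
move=> f0; have -> : ip2 f f = inner (cst 0) f.
  apply: eq_ip2; try exact: L2_mfun; [exact: f0|exact: aeW].
by rewrite /inner; under eq_Rintegral do rewrite mul0r; rewrite Rintegral_cst// mul0r.
Qed.

End L2space.

(** The limit is the supremum of the numbers lying below [x n] for [U]-almost all [n]. One
    ultrafilter makes all the scalar sequences of the compactness proof converge at once. *)
Lemma ultra_lim (R : realType) (U : set_system nat) (x : nat -> R) M : UltraFilter U ->
  (forall n, `|x n| <= M) ->
  exists l, forall e, 0 < e -> U [set n | `|x n - l| <= e].
Proof.
move=> UF xM.
have M0 : 0 <= M by exact: le_trans (xM 0%N).
pose S := [set a : R | U [set n | a <= x n]].
have S0 : S (- M).
  apply: filterS filterT => n _ /=; have := xM n; rewrite ler_norml => /andP[].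
  by [].
have SM : ubound S M.
  move=> a /filter_ex [n /= h]; apply: le_trans h _; exact: le_trans (ler_norm _) (xM n).
have Ss : has_sup S by split; [exists (- M) | exists M].
exists (sup S) => e e0.
have h1 : U [set n | sup S - e <= x n].
  have [a Sa ha] := sup_adherent e0 Ss.
  by apply: filterS Sa => n /=; apply: le_trans; exact: ltW.
have h2 : U [set n | x n < sup S + e].
  have [//|h] := in_ultra_setVsetC [set n | x n < sup S + e] UF.
  have : S (sup S + e) by apply: filterS h => n /= /negP; rewrite -leNgt.
  by move=> /(ub_le_sup (ex_intro _ M SM)); rewrite gerDl leNgt e0.
apply: filterS2 h1 h2 => n /= h1 h2; rewrite ler_norml; apply/andP; split; lra.
Qed.

Lemma dist_chain3 (R : realFieldType) (a b c y e : R) :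
  `|a - y| <= e -> `|a - b| <= e -> `|b - c| <= e -> `|y - c| <= 3 * e.
Proof. by rewrite !ler_norml; lra. Qed.

Lemma dist_chain5 (R : realFieldType) (a b c y e : R) :
  `|a - b| <= e -> `|b - c| <= e -> `|y - c| <= 3 * e -> `|a - y| <= 5 * e.
Proof. by rewrite !ler_norml; lra. Qed.

(** * Operators with trigonometric kernels *)

Section TrigOperators.
Variable R : realType.
Notation mu := (@mu11 R).
Notation L2 := (LfunType mu (lee1n 2)).
Notation I11 := (`](-1 : R), (1 : R)[%classic).
Notation ip := (@ip2 R).
Implicit Types (f g h : L2).
Let ipP := ip2_semi R.

Lemma cos_mul_L2 (a : R) : (fun x : R => cos (a * x)) \in Lfun mu 2%:E.
Proof.
by apply: continuous_L2 => x; apply: continuous_comp; [exact: mulrl_continuous|exact: continuous_cos].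
Qed.
Lemma sin_mul_L2 (a : R) : (fun x : R => sin (a * x)) \in Lfun mu 2%:E.
Proof.
by apply: continuous_L2 => x; apply: continuous_comp; [exact: mulrl_continuous|exact: continuous_sin].
Qed.

Lemma cst_L2 (M : R) : (cst M : R -> R) \in Lfun mu 2%:E.
Proof. by apply: (bounded_L2 (M := `|M|)) => //. Qed.

Definition cosL2 a : L2 := toL2 (cos_mul_L2 a).
Definition sinL2 a : L2 := toL2 (sin_mul_L2 a).

(** The finite-rank operator whose kernel is [w] times the sum of cos(om j (x - y)), split by the
    addition formula. *)
Definition trig_op n (om : 'I_n -> R) (w : R) f : L2 :=
  w *: \sum_(j < n) (ip f (cosL2 (om j)) *: cosL2 (om j) + ip f (sinL2 (om j)) *: sinL2 (om j)).

Lemma L2_sumE I (r : seq I) (P : pred I) (F : I -> L2) (x : R) :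
  (\sum_(i <- r | P i) F i : L2) x = \sum_(i <- r | P i) F i x.
Proof. by elim/big_rec2 : _ => // i y z _ <-. Qed.

Lemma trig_opE n (om : 'I_n -> R) w f (x : R) : trig_op om w f x =
  w * \sum_(j < n) (ip f (cosL2 (om j)) * cos (om j * x) + ip f (sinL2 (om j)) * sin (om j * x)).
Proof.
rewrite /trig_op.
rewrite -[LHS]/(w * (\sum_(j < n) (ip f (cosL2 (om j)) *: cosL2 (om j) + ip f (sinL2 (om j)) *: sinL2 (om j)) : L2) x).
by rewrite L2_sumE.
Qed.

Lemma trig_op_ip n (om : 'I_n -> R) w f g : ip (trig_op om w f) g =
  w * \sum_(j < n) (ip f (cosL2 (om j)) * ip g (cosL2 (om j))
                    + ip f (sinL2 (om j)) * ip g (sinL2 (om j))).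
Proof.
rewrite /trig_op (ipZl ipP) (ip_suml ipP); congr (_ * _); apply: eq_bigr => j _.
by rewrite !(ipE ipP) !(ipC ipP g).
Qed.

Lemma trig_op_positive n (om : 'I_n -> R) w : 0 <= w -> positive_op ip (trig_op om w).
Proof.
move=> w0; split=> [f g|f].
  rewrite (ipC ipP f) !trig_op_ip; congr (_ * _); apply: eq_bigr => j _.
  by rewrite mulrC; congr (_ + _); rewrite mulrC.
rewrite trig_op_ip mulr_ge0// sumr_ge0// => j _.
by rewrite -!expr2 addr_ge0 ?sqr_ge0.
Qed.

Lemma ip2_mono f g : (forall x, -1 < x < 1 -> `|f x| <= `|g x|) -> ip f f <= ip g g.
Proof.
move=> fg; rewrite /ip2 /inner !mu11_Rint; first last.
- by apply: measurable_funM; exact: L2_mfun.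
- by apply: measurable_funM; exact: L2_mfun.
rewrite -!mu11_Rint; first last.
- by apply: measurable_funM; exact: L2_mfun.
- by apply: measurable_funM; exact: L2_mfun.
apply: fine_le.
- exact: (integrable_fin_num measurableT (ip2_integrable f f)).
- exact: (integrable_fin_num measurableT (ip2_integrable g g)).
rewrite !mu11_integral; first last.
- by apply/measurable_EFinP; apply: measurable_funM; exact: L2_mfun.
- by apply/measurable_EFinP; apply: measurable_funM; exact: L2_mfun.
apply: ge0_le_integral; first exact: measurable_itv.
- by move=> x _; rewrite lee_fin -expr2 sqr_ge0.
- by apply/measurable_EFinP; apply: measurable_funTS; apply: measurable_funM; exact: L2_mfun.
- by apply/measurable_EFinP; apply: measurable_funTS; apply: measurable_funM; exact: L2_mfun.
move=> x /=; rewrite in_itv/= => /fg h; rewrite lee_fin -!expr2.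
by rewrite -(real_normK (num_real (f x))) -(real_normK (num_real (g x))) lerXn2r ?nnegrE.
Qed.

Lemma ip2_cst (M : R) f : (forall x, -1 < x < 1 -> `|f x| <= M) -> ip f f <= 2 * M ^+ 2.
Proof.
move=> fM; have cM : (cst M : R -> R) \in Lfun mu 2%:E by exact: cst_L2.
have M0 : 0 <= M by apply: le_trans (fM 0 _) => //; lra.
apply: le_trans (_ : ip (toL2 cM) (toL2 cM) <= _).
  by apply: ip2_mono => x xI; rewrite [X in _ <= X]ger0_norm//; exact: fM.
rewrite /ip2 /inner /=; under eq_Rintegral do rewrite /cst.
by rewrite Rintegral_cst// mu11_setT/= -expr2 mulrC.
Qed.

(** Inside (-1, 1), [F] is a pointwise limit of L2 functions, hence measurable, and it is dominated
    by |h| + 1 for one of them. *)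
Lemma uniform_limit_L2 (F : R -> R) :
  (forall e, 0 < e -> exists h, forall x, -1 < x < 1 -> `|F x - h x| <= e) ->
  F \_ I11 \in Lfun mu 2%:E.
Proof.
move=> hF.
have /choice [u hu] : forall n : nat, exists h : L2, forall x, -1 < x < 1 ->
    `|F x - h x| <= n.+1%:R^-1 by move=> n; apply: hF; rewrite invr_gt0.
have mF : measurable_fun I11 F.
  apply: (measurable_fun_cvg (h := fun n => u n)).
    by move=> n; apply: measurable_funTS; exact: L2_mfun.
  move=> x; rewrite /= in_itv/= => xI; apply/cvgrPdist_le => e e0.
  near=> n; apply: le_trans (hu n x xI) _.
  by apply: ltW; near: n; exact: (near_infty_natSinv_lt (PosNum e0)).
have mFI : measurable_fun setT (F \_ I11).
  exact: (measurable_restrictT _ (measurable_itv _)).1 mF.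
have [h hh] := hF 1 ltr01.
have hF1 x : `|(F \_ I11) x| <= `|h x| + 1.
  rewrite patchE; case: ifPn; last by rewrite normr0 addr_ge0.
  rewrite inE/= in_itv/= => xI; rewrite -[F x](subrK (h x)).
  by apply: le_trans (ler_normD _ _) _; rewrite addrC lerD2l hh.
have c1 : (cst 1 : R -> R) \in Lfun mu 2%:E by exact: cst_L2.
have habs : (fun x => `|h x|) \in Lfun mu 2%:E.
  rewrite inE; apply/andP; split; rewrite inE/=.
    by apply: measurableT_comp => //; exact: L2_mfun.
  rewrite /finite_norm.
  have := LfunP h; rewrite inE => /andP[_]; rewrite inE/= /finite_norm.
  by rewrite -[in X in X -> _]Lnorm_abse.
pose G : L2 := toL2 habs + toL2 c1.
have := LfunP G; rewrite inE => /andP[_]; rewrite inE/= /finite_norm => Gf.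
rewrite inE; apply/andP; split; rewrite inE//= /finite_norm.
apply: le_lt_trans Gf; rewrite unlock/=.
rewrite gt0_ler_poweR//.
- by rewrite in_itv/= leey integral_ge0// => x _; rewrite lee_fin powR_ge0.
- by rewrite in_itv/= leey integral_ge0// => x _; rewrite lee_fin powR_ge0.
apply: ge0_le_integral; first exact: measurableT.
- by move=> x _; rewrite lee_fin powR_ge0.
- apply/measurable_EFinP/(@measurableT_comp _ _ _ _ _ _ (fun x : R => x `^ 2)%R) => //.
  exact: measurableT_comp.
- apply/measurable_EFinP/(@measurableT_comp _ _ _ _ _ _ (fun x : R => x `^ 2)%R) => //.
  apply: measurableT_comp => //; exact: (L2_mfun G).
move=> x _; rewrite lee_fin !powR_mulrn//; apply: lerXn2r; rewrite ?nnegrE//.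
by apply: le_trans (hF1 x) _; rewrite [leRHS]ger0_norm//= addr_ge0.
Unshelve. all: by end_near. Qed.

(** Symmetry, positivity, boundedness and compactness of both operators are all derived from this
    single property. *)
Definition trig_approx (T : L2 -> L2) := forall e, 0 < e ->
  exists n (om : 'I_n -> R) w, 0 <= w /\ forall f x, -1 < x < 1 ->
    `|T f x - trig_op om w f x| <= e * Num.sqrt (ip f f).

Section Consequences.
Variable T : L2 -> L2.
Hypothesis TA : trig_approx T.

Lemma trig_approx_ip e : 0 < e ->
  exists n (om : 'I_n -> R) w, 0 <= w /\
   forall f, ip (T f - trig_op om w f) (T f - trig_op om w f) <= e * ip f f.
Proof.
move=> e0; have e1 : 0 < Num.sqrt (e / 2) by rewrite sqrtr_gt0 divr_gt0.
have [n [om [w [w0 h]]]] := TA e1; exists n, om, w; split => // f.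
apply: le_trans (ip2_cst (M := Num.sqrt (e / 2) * Num.sqrt (ip f f)) _) _.
  by move=> x xI; exact: h.
rewrite exprMn !sqr_sqrtr ?divr_ge0 ?(ltW e0)//; last exact: (ip_ge0 ipP).
by rewrite mulrA mulrCA divff ?mulr1// pnatr_eq0.
Qed.

(** Both properties hold for [trig_op] and pass to the limit; [sqr_le_eps] turns approximate
    identities into exact ones. *)
Lemma trig_approx_positive : positive_op ip T.
Proof.
split=> [f g|f].
  apply/eqP; rewrite -subr_eq0; apply/eqP.
  apply: (@sqr_le_eps _ _ (4 * (ip f f * ip g g))) => e e0.
  have [n [om [w [w0 h]]]] := trig_approx_ip e0.
  have -> : ip (T f) g - ip f (T g) = ip (T f - trig_op om w f) g - ip f (T g - trig_op om w g).
    by rewrite (ipBl ipP) (ipBr ipP) (op_sym (trig_op_positive om w0) f g) opprB addrA subrK.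
  have c1 := cauchy_schwarz ipP (T f - trig_op om w f) g.
  have c2 := cauchy_schwarz ipP f (T g - trig_op om w g).
  have h1 := ler_wpM2r (ip_ge0 ipP g) (h f).
  have h2 := ler_wpM2l (ip_ge0 ipP f) (h g).
  move: (ip (T f - _) g) (ip f (T g - _)) c1 c2 => p q c1 c2.
  move: (le_trans c1 h1) (le_trans c2 h2) (sqr_ge0 (p + q)); move: (ip f f) (ip g g) => x y.
  by clear; lra.
rewrite leNgt; apply/negP => f0.
suff : ip (T f) f = 0 by move=> h0; move: f0; rewrite h0 ltxx.
apply: (@sqr_le_eps _ _ (ip f f * ip f f)) => e e0.
have [n [om [w [w0 h]]]] := trig_approx_ip e0.
have c1 := cauchy_schwarz ipP (T f - trig_op om w f) f.
have p0 := op_ge0 (trig_op_positive om w0) f.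
have := ler_wpM2r (ip_ge0 ipP f) (h f).
move: c1; rewrite (ipBl ipP).
move: (ip (T f) f) (ip (trig_op _ _ _) f) f0 p0 => x y x0 y0.
move: (ip (T f - _) _ * _) => z; move: (ip f f) => t c1 c2.
by clear -x0 y0 c1 c2; nra.
Qed.

Lemma trig_approx_bounded : bounded_op ip T.
Proof.
have [n [om [w [w0 h]]]] := trig_approx_ip ltr01.
pose M := \sum_(j < n) (ip (cosL2 (om j)) (cosL2 (om j)) + ip (sinL2 (om j)) (sinL2 (om j))).
exists (1 + w * M) => f.
have f0 := ip_ge0 ipP f.
have h1 : ip (trig_op om w f) f <= w * M * ip f f.
  rewrite trig_op_ip -mulrA ler_wpM2l// /M mulr_suml ler_sum// => j _.
  by rewrite -!expr2 mulrDl; apply: lerD; rewrite (mulrC _ (ip f f)); exact: cauchy_schwarz.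
have h2 : ip (T f - trig_op om w f) f <= ip f f.
  apply: le_trans (ler_norm _) _; rewrite -(ler_pXn2r (n := 2)) ?nnegrE//.
  rewrite real_normK ?num_real//; apply: le_trans (cauchy_schwarz ipP _ _) _.
  by rewrite expr2 ler_wpM2r// -[leRHS]mul1r.
move: h2; rewrite (ipBl ipP); move: h1.
by move: (ip (T f) f) (ip _ f) (ip f f) => x y z; clear; lra.
Qed.

(** Along an ultrafilter every scalar product with [u n] converges. A [trig_op] sees only finitely
    many of them, so its values at [u n] converge uniformly, and uniform approximation carries this
    over to [T]. *)
Lemma trig_approx_compact : compact_op ip T.
Proof.
move=> u u1.
have [U [UU sU]] := ultraFilterLemma eventually_filter.
have UF : ProperFilter U by exact: ultra_proper.
have u1' n : Num.sqrt (ip (u n) (u n)) <= 1.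
  by rewrite -[leRHS]sqrtr1 ler_wsqrtr.
have ubd h n : `|ip (u n) h| <= Num.sqrt (ip h h).
  rewrite -(ler_pXn2r (n := 2)) ?nnegrE// real_normK ?num_real//.
  rewrite sqr_sqrtr ?(ip_ge0 ipP)//; apply: le_trans (cauchy_schwarz ipP _ _) _.
  by rewrite -[leRHS]mul1r ler_wpM2r// (ip_ge0 ipP).
have /choice [phi hphi] : forall h : L2, exists l, forall e, 0 < e ->
    U [set n | `|ip (u n) h - l| <= e].
  by move=> h; apply: (ultra_lim UU (M := Num.sqrt (ip h h))).
(* [trig_op om w] applied to the weak limit [phi] of [u] along [U] *)
pose lim_op n (om : 'I_n -> R) w : L2 := w *: \sum_(j < n)
  (phi (cosL2 (om j)) *: cosL2 (om j) + phi (sinL2 (om j)) *: sinL2 (om j)).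
have near_lim n (om : 'I_n -> R) w e : 0 <= w -> 0 < e ->
    U [set k | forall x, `|trig_op om w (u k) x - lim_op n om w x| <= e].
  move=> w0 e0.
  pose d := e / (w * 2 * n%:R + 1).
  have D0 : 0 < w * 2 * n%:R + 1 by rewrite ltr_wpDl// !mulr_ge0.
  have d0 : 0 < d by rewrite divr_gt0.
  have : U [set k | forall j, `|ip (u k) (cosL2 (om j)) - phi (cosL2 (om j))| <= d /\
      `|ip (u k) (sinL2 (om j)) - phi (sinL2 (om j))| <= d].
    by apply: filter_forall => j; apply: filterI; exact: hphi.
  apply: filterS => k hk x.
  rewrite trig_opE -[lim_op n om w x]/(w * (\sum_(j < n)
   (phi (cosL2 (om j)) *: cosL2 (om j) + phi (sinL2 (om j)) *: sinL2 (om j)) : L2) x).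
  rewrite L2_sumE -mulrBr -sumrB normrM (ger0_norm w0).
  apply: le_trans (_ : w * \sum_(j < n) (2 * d) <= _).
    rewrite ler_wpM2l//; apply: le_trans (ler_norm_sum _ _ _) _; apply: ler_sum => j _.
    have [h1 h2] := hk j.
    have -> : ip (u k) (cosL2 (om j)) * cos (om j * x) + ip (u k) (sinL2 (om j)) * sin (om j * x)
        - (phi (cosL2 (om j)) *: cosL2 (om j) + phi (sinL2 (om j)) *: sinL2 (om j)) x =
        (ip (u k) (cosL2 (om j)) - phi (cosL2 (om j))) * cos (om j * x) +
        (ip (u k) (sinL2 (om j)) - phi (sinL2 (om j))) * sin (om j * x).
      rewrite -[(_ + _ : L2) x]/(phi (cosL2 (om j)) * cos (om j * x) + phi (sinL2 (om j)) * sin (om j * x)).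
      by ring.
    apply: le_trans (ler_normD _ _) _; rewrite !normrM mulr_natl mulr2n.
    have c1 : `|cos (om j * x)| <= 1 by rewrite ler_norml cos_geN1 cos_le1.
    have s1 : `|sin (om j * x)| <= 1 by rewrite ler_norml sin_geN1 sin_le1.
    by apply: lerD; rewrite -[leRHS]mulr1 ler_pM.
  rewrite sumr_const card_ord -[_ *+ n]mulr_natr.
  have -> : w * (2 * d * n%:R) = d * (w * 2 * n%:R) by ring.
  have -> : e = d * (w * 2 * n%:R + 1) by rewrite /d divfK// gt_eqF.
  by rewrite ler_wpM2l ?(ltW d0)// lerDl.
have bd x : -1 < x < 1 -> exists M, forall n, `|T (u n) x| <= M.
  move=> xI; have [n [om [w [w0 h]]]] := TA ltr01.
  exists (1 + w * \sum_(j < n) (Num.sqrt (ip (cosL2 (om j)) (cosL2 (om j))) * `|cos (om j * x)|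
     + Num.sqrt (ip (sinL2 (om j)) (sinL2 (om j))) * `|sin (om j * x)|)) => k.
  rewrite -[T (u k) x](subrK (trig_op om w (u k) x)); apply: le_trans (ler_normD _ _) _.
  apply: lerD; first by apply: le_trans (h _ _ xI) _; rewrite mul1r.
  rewrite trig_opE normrM ger0_norm// ler_wpM2l//.
  apply: le_trans (ler_norm_sum _ _ _) _; apply: ler_sum => j _.
  by apply: le_trans (ler_normD _ _) _; rewrite !normrM; apply: lerD; rewrite ler_wpM2r.
have /choice [g0 hg0] : forall x : R, exists l, -1 < x < 1 -> forall e, 0 < e ->
    U [set n | `|T (u n) x - l| <= e].
  move=> x; have [xI|xI] := boolP (-1 < x < 1); last by exists 0.
  have [M hM] := bd x xI; have [l hl] := ultra_lim UU hM; by exists l.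
have g0lim e : 0 < e -> exists n (om : 'I_n -> R) w, [/\ 0 <= w,
    forall f x, -1 < x < 1 -> `|T f x - trig_op om w f x| <= e * Num.sqrt (ip f f) &
    forall x, -1 < x < 1 -> `|g0 x - lim_op n om w x| <= 3 * e].
  move=> e0; have [n [om [w [w0 h]]]] := TA e0; exists n, om, w; split => // x xI.
  have [k [/= h1 h2]] : exists k, [set n | `|T (u n) x - g0 x| <= e] k /\
     [set k | forall x, `|trig_op om w (u k) x - lim_op n om w x| <= e] k.
    by apply: (@filter_ex _ U); apply: filterI; [exact: hg0|exact: near_lim].
  have h3 := h (u k) x xI; have h4 := h2 x.
  have h5 : e * Num.sqrt (ip (u k) (u k)) <= e by rewrite -[leRHS]mulr1 ler_wpM2l ?(ltW e0).
  exact: (dist_chain3 h1 (le_trans h3 h5) h4).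
have gL : g0 \_ I11 \in Lfun mu 2%:E.
  apply: uniform_limit_L2 => e e0.
  have e3 : 0 < e / 3 by rewrite divr_gt0.
  have [n [om [w [w0 _ h]]]] := g0lim _ e3; exists (lim_op n om w) => x xI.
  by apply: le_trans (h x xI) _; rewrite mulrC divfK ?pnatr_eq0.
exists (toL2 gL) => e e0 m.
(* The chain of approximations costs 5 d = sqrt(e / 2) at each point, hence a square norm of at most
   e on an interval of length 2. *)
pose d := Num.sqrt (e / 2) / 5.
have d0 : 0 < d by rewrite divr_gt0// sqrtr_gt0 divr_gt0.
have [n [om [w [w0 h1 h2]]]] := g0lim _ d0.
have [k [/= h3 mk]] : exists k,
   [set k | forall x, `|trig_op om w (u k) x - lim_op n om w x| <= d] k /\ [set k | (m <= k)%N] k.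
  apply: (@filter_ex _ U); apply: filterI; first exact: near_lim.
  by apply: sU; exact: nbhs_infty_ge.
exists k => //; apply: le_trans (ip2_cst (M := Num.sqrt (e / 2)) _) _; last first.
  by rewrite sqr_sqrtr ?divr_ge0 ?(ltW e0)// mulrC divfK ?pnatr_eq0.
move=> x xI; rewrite -[(_ - _ : L2) x]/(T (u k) x - (g0 \_ I11) x).
have -> : (g0 \_ I11) x = g0 x by rewrite patchE ifT// inE/= in_itv.
have h4 := h1 (u k) x xI; have h5 := h2 x xI; have h6 := h3 x.
have h7 : d * Num.sqrt (ip (u k) (u k)) <= d by rewrite -[leRHS]mulr1 ler_wpM2l ?(ltW d0).
have -> : Num.sqrt (e / 2) = 5 * d by rewrite /d mulrCA mulfV ?mulr1// pnatr_eq0.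
exact: (dist_chain5 (le_trans h4 h7) h6 h5).
Qed.

End Consequences.
End TrigOperators.

(** * Taylor bounds for sine, cosine and cosecant *)

Section TrigBounds.
Variable R : realType.
Implicit Types u v x : R.

Lemma derive_ge0_le (h h' : R -> R) : (forall x, is_derive x 1 h (h' x)) ->
  forall x, (forall y, 0 <= y <= x -> 0 <= h' y) -> 0 <= x -> h 0 <= h x.
Proof.
move=> dh x h'0; rewrite le_eqVlt => /orP[/eqP <-//|x0].
have ct : {within `[0, x], continuous h}.
  by apply: derivable_within_continuous => y _; have [] := dh y.
have [c cI] := MVT x0 (fun y _ => dh y) ct.
rewrite subr0 => e; rewrite -subr_ge0 e mulr_ge0 ?(ltW x0)// h'0//.
by move: cI; rewrite in_itv/= => /andP[/ltW -> /ltW ->].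
Qed.

(** First of a chain that starts from cos <= 1: each bound up to [sin_le5] holds because the
    previous one makes the derivative of the difference nonnegative. *)
Lemma sin_le u : 0 <= u -> sin u <= u.
Proof.
move=> u0; pose h x := x - sin x.
suff : h 0 <= h u by rewrite /h sin0 subrr subr_ge0.
have dh x : is_derive x 1 h (1 - cos x).
  by apply: is_derive_eq; rewrite /GRing.scale/=; lra.
by apply: (derive_ge0_le dh) u0 => x /andP[x0 _]; rewrite subr_ge0 cos_le1.
Qed.

Lemma cos_ge u : 0 <= u -> 1 - u ^+ 2 / 2 <= cos u.
Proof.
move=> u0; pose h x := cos x - (1 - x ^+ 2 / 2).
suff : h 0 <= h u by rewrite /h cos0 expr0n/= mul0r subr0 subrr subr_ge0.
have dh x : is_derive x 1 h (x - sin x).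
  by apply: is_derive_eq; rewrite /GRing.scale/=; lra.
by apply: (derive_ge0_le dh) u0 => x /andP[x0 _]; rewrite subr_ge0 sin_le.
Qed.

Lemma sin_ge u : 0 <= u -> u - u ^+ 3 / 6 <= sin u.
Proof.
move=> u0; pose h x := sin x - (x - x ^+ 3 / 6).
suff : h 0 <= h u by rewrite /h sin0 expr0n/= mul0r subr0 subrr subr_ge0.
have dh x : is_derive x 1 h (cos x - (1 - x ^+ 2 / 2)).
  by apply: is_derive_eq; rewrite /GRing.scale/=; lra.
by apply: (derive_ge0_le dh) u0 => x /andP[x0 _]; rewrite subr_ge0 cos_ge.
Qed.

Lemma cos_le u : 0 <= u -> cos u <= 1 - u ^+ 2 / 2 + u ^+ 4 / 24.
Proof.
move=> u0; pose h x := 1 - x ^+ 2 / 2 + x ^+ 4 / 24 - cos x.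
suff : h 0 <= h u by rewrite /h cos0 !expr0n/= !mul0r subr0 addr0 subrr subr_ge0.
have dh x : is_derive x 1 h (sin x - (x - x ^+ 3 / 6)).
  by apply: is_derive_eq; rewrite /GRing.scale/=; lra.
by apply: (derive_ge0_le dh) u0 => x /andP[x0 _]; rewrite subr_ge0 sin_ge.
Qed.

Lemma sin_le5 u : 0 <= u -> sin u <= u - u ^+ 3 / 6 + u ^+ 5 / 120.
Proof.
move=> u0; pose h x := x - x ^+ 3 / 6 + x ^+ 5 / 120 - sin x.
suff : h 0 <= h u by rewrite /h sin0 !expr0n/= !mul0r subr0 addr0 subrr subr_ge0.
have dh x : is_derive x 1 h (1 - x ^+ 2 / 2 + x ^+ 4 / 24 - cos x).
  by apply: is_derive_eq; rewrite /GRing.scale/=; lra.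
by apply: (derive_ge0_le dh) u0 => x /andP[x0 _]; rewrite subr_ge0 cos_le.
Qed.

(** The midpoint sums and the Dirichlet kernel are both sin(c t) divided by a sine, so this
    expansion compares each of them with the sinc kernel. The true coefficient of the cubic term is
    7/360. *)
Lemma csc_approx u : u != 0 -> `|u| <= 1 ->
  `|(sin u)^-1 - u^-1 - u / 6| <= `|u| ^+ 3 / 30.
Proof.
wlog u0 : u / 0 < u.
  move=> h un u1; have [up|un'|e] := ltgtP u 0; last by rewrite e eqxx in un.
    have := h (- u); rewrite oppr_gt0 oppr_eq0 normrN sinN !invrN mulNr => /(_ up un u1).
    suff -> : (sin u)^-1 - u^-1 - u / 6 = - (- (sin u)^-1 - - u^-1 - - (u / 6)) by rewrite normrN.
    by rewrite !opprD !opprK.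
  exact: h.
move=> un; rewrite (gtr0_norm u0) => u1.
have sp := sin_ge (ltW u0); have sm := sin_le5 (ltW u0); have su := sin_le (ltW u0).
have u3 : u ^+ 3 <= u by rewrite exprS ler_piMr ?(ltW u0)// exprn_ile1 ?(ltW u0).
have s0 : 0 < sin u.
  by apply: lt_le_trans sp; lra.
have -> : (sin u)^-1 - u^-1 - u / 6 = (u - sin u - u ^+ 2 * sin u / 6) / (u * sin u).
  by field; rewrite gt_eqF.
rewrite normrM normfV (gtr0_norm (mulr_gt0 u0 s0)) ler_pdivrMr ?mulr_gt0//.
move: (sin u) sp sm su s0 => s sp sm su s0.
have u2 : 0 < u ^+ 2 by rewrite exprn_gt0.
have u21 : u ^+ 2 <= 1 by rewrite exprn_ile1 ?(ltW u0).
have u5 : 0 < u ^+ 5 by rewrite exprn_gt0.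
have h1 : u ^+ 2 * (u - u ^+ 3 / 6) <= u ^+ 2 * s by rewrite ler_wpM2l ?(ltW u2).
have h2 : u ^+ 2 * s <= u ^+ 2 * u by rewrite ler_wpM2l ?(ltW u2).
have h3 : u ^+ 4 * (u - u ^+ 3 / 6) <= u ^+ 4 * s by rewrite ler_wpM2l// exprn_ge0 ?(ltW u0).
have h4 : u ^+ 5 * u ^+ 2 <= u ^+ 5 * 1 by rewrite ler_wpM2l ?(ltW u5).
have -> : u ^+ 3 / 30 * (u * s) = u ^+ 4 * s / 30 by ring.
by rewrite ler_norml; apply/andP; split; lra.
Qed.

(** Telescoping of 2 sin v cos x = sin(x + v) - sin(x - v). The offset [a] will be 1 for the
    midpoint sums and 1 - N for the Dirichlet kernel. *)
Lemma dirichlet_sum n (a v : R) :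
  2 * sin v * (\sum_(j < n) cos ((2 * j%:R + a) * v)) =
  sin ((2 * n%:R + a - 1) * v) - sin ((a - 1) * v).
Proof.
elim: n => [|n IH]; first by rewrite big_ord0 mulr0 mulr0 add0r subrr.
rewrite big_ord_recr/= mulrDr IH.
have -> : (2 * n.+1%:R + a - 1) * v = (2 * n%:R + a) * v + v.
  by rewrite -natr1; ring.
have -> : (2 * n%:R + a - 1) * v = (2 * n%:R + a) * v - v by ring.
rewrite sinB sinD; ring.
Qed.

End TrigBounds.

(** * The sinc and Dirichlet operators as limits of cosine sums *)

Section KernelOperators.
Variable R : realType.
Notation mu := (@mu11 R).
Notation L2 := (LfunType mu (lee1n 2)).
Notation I11 := (`](-1 : R), (1 : R)[%classic).
Notation ip := (@ip2 R).
Implicit Types (f g h : L2).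
Let ipP := ip2_semi R.

Lemma mu11_ae_neq (P : R -> Prop) (a : R) : (forall x, -1 < x < 1 -> x != a -> P x) ->
  {ae mu, forall x, P x}.
Proof.
move=> h; exists (~` I11 `|` [set a]); split.
- by apply: measurableU; [apply: measurableC; exact: measurable_itv|exact: measurable_set1].
- apply/eqP; rewrite -measure_le0 -(lebesgue_measure_set1 a) /mu11/= /mrestr.
  have mI : measurable (~` I11 `|` [set a] : set (measurableTypeR R)).
    by apply: measurableU; [apply: measurableC; exact: measurable_itv|exact: measurable_set1].
  apply: le_measure; rewrite ?inE//; last by move=> x [[nx|->//] xI].
  by apply: measurableI => //; exact: measurable_itv.
- move=> x /= nP; have [->|xa] := eqVneq x a; first by right.
  by left => /=; rewrite in_itv/= => xI; apply: nP; exact: h.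
Qed.

(** The excluded point will be the diagonal y = x, where the quotients defining the kernels are 0
    instead of their limit. *)
Lemma ip2_cst_neq (M a : R) f : (forall x, -1 < x < 1 -> x != a -> `|f x| <= M) ->
  0 <= M -> ip f f <= 2 * M ^+ 2.
Proof.
move=> fM M0; pose b : R -> R := fun x => if x == a then 0 else f x.
have mb : measurable_fun setT (b : measurableTypeR R -> R).
  apply: measurable_fun_ifT.
  - apply: (measurable_fun_bool true); rewrite setTI.
    rewrite (_ : _ @^-1` _ = [set a]); first exact: measurable_set1.
    by apply/seteqP; split=> x /=; [move/eqP | move=> ->; rewrite eqxx].
  - exact: measurable_cst.
  - exact: L2_mfun.
have bM x : -1 < x < 1 -> `|b x| <= M.
  by move=> xI; rewrite /b; have [_|xa] := eqVneq x a; rewrite ?normr0//; exact: fM.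
have bL := bounded_L2 mb bM.
have -> : ip f f = ip (toL2 bL) (toL2 bL).
  have e : {ae mu, forall x, f x = b x}.
    by apply: (@mu11_ae_neq _ a) => x _ xa; rewrite /b (negPf xa).
  by apply: eq_ip2 => //; exact: L2_mfun.
by apply: ip2_cst => x xI; exact: bM.
Qed.

Definition trig_kernel n (om : 'I_n -> R) (w x : R) : L2 :=
  w *: \sum_(j < n) (cos (om j * x) *: cosL2 (om j) + sin (om j * x) *: sinL2 (om j)).

Lemma trig_kernelE n (om : 'I_n -> R) w (x y : R) :
  trig_kernel om w x y = w * \sum_(j < n) cos (om j * (x - y)).
Proof.
rewrite /trig_kernel.
rewrite -[LHS]/(w * (\sum_(j < n) (cos (om j * x) *: cosL2 (om j) + sin (om j * x) *: sinL2 (om j)) : L2) y).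
rewrite L2_sumE; congr (_ * _); apply: eq_bigr => j _.
by rewrite mulrBr cosB.
Qed.

Lemma trig_op_kernel n (om : 'I_n -> R) w f (x : R) :
  trig_op om w f x = ip f (trig_kernel om w x).
Proof.
rewrite trig_opE /trig_kernel (ipZr ipP) (ip_sumr ipP); congr (_ * _).
apply: eq_bigr => j _; rewrite !(ipE ipP).
by rewrite mulrC [X in _ + X]mulrC.
Qed.

Section KernelOp.
Variable k : R -> R -> R.
Hypothesis kL : forall x, -1 < x < 1 -> k x \in Lfun mu 2%:E.
Hypothesis kA : forall e, 0 < e -> exists n (om : 'I_n -> R) w, 0 <= w /\
  forall x y, -1 < x < 1 -> -1 < y < 1 -> y != x ->
    `|k x y - w * \sum_(j < n) cos (om j * (x - y))| <= e.

Lemma kernel_approx e : 0 < e -> exists n (om : 'I_n -> R) w, 0 <= w /\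
  forall f x, -1 < x < 1 -> `|inner (k x) f - trig_op om w f x| <= e * Num.sqrt (ip f f).
Proof.
move=> e0; have e2 : 0 < e / 2 by rewrite divr_gt0.
have [n [om [w [w0 h]]]] := kA e2; exists n, om, w; split => // f x xI.
rewrite trig_op_kernel (ipC ipP) -[inner _ _]/(ip (toL2 (kL xI)) f) -(ipBl ipP).
rewrite -(ler_pXn2r (n := 2)) ?nnegrE ?mulr_ge0 ?sqrtr_ge0 ?(ltW e0)//.
rewrite real_normK ?num_real// exprMn sqr_sqrtr ?(ip_ge0 ipP)//.
apply: le_trans (cauchy_schwarz ipP _ _) _; rewrite ler_wpM2r ?(ip_ge0 ipP)//.
apply: le_trans (@ip2_cst_neq (e / 2) x _ _ (ltW e2)) _.
  move=> y yI yx; rewrite -[X in `|X|]/(k x y - trig_kernel om w x y) trig_kernelE.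
  exact: h.
by rewrite expr_div_n; have := sqr_ge0 e; lra.
Qed.

Lemma kernel_op_L2 f : (fun x => inner (k x) f) \_ I11 \in Lfun mu 2%:E.
Proof.
apply: uniform_limit_L2 => e e0.
pose s := Num.sqrt (ip f f) + 1.
have s0 : 0 < s by rewrite ltr_wpDl// sqrtr_ge0.
have [n [om [w [w0 h]]]] := @kernel_approx (e / s) (divr_gt0 e0 s0).
exists (trig_op om w f) => x xI; apply: le_trans (h f x xI) _.
by rewrite mulrAC ler_pdivrMr// ler_wpM2l ?(ltW e0)// lerDl.
Qed.

(** Cut off outside (-1, 1), because the rows of the kernel are controlled only for [x] inside. *)
Definition kernel_op f : L2 := toL2 (kernel_op_L2 f).

Lemma kernel_opE f x : -1 < x < 1 -> kernel_op f x = inner (k x) f.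
Proof. by move=> xI; rewrite toL2E patchE ifT// inE/= in_itv. Qed.

Lemma kernel_op_approx : trig_approx kernel_op.
Proof.
move=> e e0; have [n [om [w [w0 h]]]] := kernel_approx e0; exists n, om, w; split => // f x xI.
by rewrite kernel_opE//; exact: h.
Qed.

End KernelOp.

Lemma measurable_fun_inv : measurable_fun setT (fun x : measurableTypeR R => (x : R)^-1).
Proof.
have -> : (fun x : R => x^-1) = fun x => if x == 0 then 0 else ((fun z : R => z^-1) \_ (~` [set (0 : R)])) x.
  apply/funext => x; have [->|x0] := eqVneq x 0; first by rewrite invr0.
  by rewrite patchE ifT// inE; exact/eqP.
have m0 : measurable ([set 0] : set (measurableTypeR R)) by exact: measurable_set1.
apply: measurable_fun_ifT.
- apply: (measurable_fun_bool true); rewrite setTI.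
  rewrite (_ : _ @^-1` _ = [set 0]); first exact: m0.
  by apply/seteqP; split=> x /=; [move/eqP | move=> ->; rewrite eqxx].
- exact: measurable_cst.
- apply: (measurable_restrictT _ (measurableC m0)).1.
  apply: open_continuous_measurable_fun.
    by apply: closed_openC; exact: closed_eq.
  by move=> x; rewrite inE/= => /eqP x0; exact: inv_continuous.
Qed.

Lemma measurable_ratio (a b x : R) :
  measurable_fun setT (fun y : measurableTypeR R => sin (a * (x - y)) / sin (b * (x - y))).
Proof.
have cs (d : R) : continuous (fun y : R => sin (d * (x - y))).
  move=> y; apply: (continuous_comp (f := fun y => d * (x - y)) (g := sin)).
    by apply: cvgM; [exact: cvg_cst|apply: cvgB; [exact: cvg_cst|exact: cvg_id]].
  exact: continuous_sin.
apply: measurable_funM; first exact: continuous_measurable_fun.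
apply: (@measurableT_comp _ _ _ _ _ _ (fun x : measurableTypeR R => (x : R)^-1)); first exact: measurable_fun_inv.
exact: continuous_measurable_fun.
Qed.

Lemma measurable_sinc (a b x : R) :
  measurable_fun setT (fun y : measurableTypeR R => sin (a * (x - y)) / (b * (x - y))).
Proof.
have cm (d : R) : continuous (fun y : R => d * (x - y)).
  move=> y.
  by apply: cvgM; [exact: cvg_cst|apply: cvgB; [exact: cvg_cst|exact: cvg_id]].
apply: measurable_funM.
  apply: continuous_measurable_fun => y; apply: continuous_comp; first exact: cm.
  exact: continuous_sin.
apply: (@measurableT_comp _ _ _ _ _ _ (fun x : measurableTypeR R => (x : R)^-1)); first exact: measurable_fun_inv.
exact: continuous_measurable_fun.
Qed.

Section Sinc.
Variable c : R.
Hypothesis c0 : 0 < c.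

(* The midpoint rule, with step [2 * c / (2 * m)], for the integral over [0, c] *)
(* of [cos (xi * t) / pi], whose value is the sinc kernel. *)
Definition sinc_step m : R := c / (2 * pi * m%:R).
Definition sinc_freq m (j : 'I_m) : R := (2 * j%:R + 1) * (pi * sinc_step m).

Lemma sinc_step_gt0 m : (0 < m)%N -> 0 < sinc_step m.
Proof. by move=> m0; rewrite divr_gt0// !mulr_gt0 ?pi_gt0// ltr0n. Qed.

Lemma sinc_stepM m : (0 < m)%N -> 2 * m%:R * (pi * sinc_step m) = c.
Proof.
move=> m0; have p0 : pi != 0 :> R by rewrite gt_eqF// pi_gt0.
have n0 : m%:R != 0 :> R by rewrite pnatr_eq0 -lt0n.
rewrite /sinc_step; move: (pi : R) (m%:R : R) p0 n0 => p k p0 n0.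
by field; rewrite p0 n0.
Qed.

Lemma sinc_trig_sum m t : (0 < m)%N -> sin (pi * sinc_step m * t) != 0 ->
  2 * sinc_step m * \sum_(j < m) cos (@sinc_freq m j * t) =
  sinc_step m * (sin (c * t) / sin (pi * sinc_step m * t)).
Proof.
move=> m0 s0.
have := @dirichlet_sum R m 1 (pi * sinc_step m * t).
have -> : (2 * m%:R + 1 - 1) * (pi * sinc_step m * t) = c * t.
  by rewrite addrK -[in RHS](sinc_stepM m0) !mulrA.
rewrite subrr mul0r sin0 subr0.
move=> e; rewrite -e mulrAC.
have -> : \sum_(j < m) cos (sinc_freq j * t) =
          \sum_(j < m) cos ((2 * j%:R + 1) * (pi * sinc_step m * t)).
  by apply: eq_bigr => j _; rewrite /sinc_freq -mulrA.
move: (sin _) s0 (\sum_(j < m) _) => s s0 S.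
by field.
Qed.

(** With u = pi w t, the midpoint sum equals w sin(c t) / sin u and the sinc kernel equals w sin(c
    t) / u. Then |1/sin u - 1/u| <= |u| by [csc_approx]. *)
Lemma sinc_kernel_approx m t : (0 < m)%N -> t != 0 -> `|pi * sinc_step m * t| <= 1 ->
  `|sin (c * t) / (pi * t) - 2 * sinc_step m * \sum_(j < m) cos (@sinc_freq m j * t)| <=
   2 * pi * sinc_step m ^+ 2 * `|t|.
Proof.
move=> m0 t0 u1; set w := sinc_step m; set u := pi * w * t in u1 *.
have w0 : 0 < w := sinc_step_gt0 m0.
have wn : w != 0 by exact: lt0r_neq0.
have pn : pi != 0 :> R by exact: lt0r_neq0 (pi_gt0 R).
have un0 : u != 0 by exact: mulf_neq0 (mulf_neq0 pn wn) t0.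
have h := csc_approx un0 u1.
have su : sin u != 0.
  have up : 0 < `|u| by rewrite normr_gt0.
  have s1 : 0 < sin `|u|.
    have u3 : `|u| ^+ 3 <= `|u| by rewrite exprS ler_piMr// exprn_ile1.
    by apply: lt_le_trans (sin_ge (normr_ge0 u)); lra.
  apply/eqP => su0; move: s1; case: (ger0P u) => _; by rewrite ?sinN su0 ?oppr0 ltxx.
rewrite sinc_trig_sum//.
have -> : sin (c * t) / (pi * t) - w * (sin (c * t) / sin u) = - (w * sin (c * t) * ((sin u)^-1 - u^-1)).
  have p0 : pi != 0 :> R by rewrite gt_eqF// pi_gt0.
  move: su; rewrite /u; move: (sin (c * t)) (sin _) => a b b0.
  move: (pi : R) p0 => p p0; move: (w) w0 => v v0.
  by field; rewrite b0 t0 p0 gt_eqF.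
rewrite normrN (normrM (w * _)) (normrM w) (gtr0_norm w0).
have hs : `|sin (c * t)| <= 1 by rewrite ler_norml sin_geN1 sin_le1.
have hc : `|(sin u)^-1 - u^-1| <= `|u|.
  rewrite -[X in `|X|](subrK (u / 6)); apply: le_trans (ler_normD _ _) _.
  have u3 : `|u| ^+ 3 <= `|u| by rewrite exprS ler_piMr// exprn_ile1.
  have : `|u / 6| = `|u| / 6 by rewrite normrM normfV (ger0_norm (_ : 0 <= 6)).
  by move=> ->; have := normr_ge0 u; lra.
have uE : `|u| = pi * w * `|t| by rewrite /u normrM gtr0_norm// mulr_gt0// pi_gt0.
have h1 : w * `|sin (c * t)| * `|(sin u)^-1 - u^-1| <= w * 1 * `|u|.
  apply: ler_pM => //; first by rewrite mulr_ge0// ltW.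
  by rewrite ler_wpM2l// ltW.
apply: le_trans h1 _; rewrite uE.
have : 0 <= pi * w ^+ 2 * `|t|.
  by apply: mulr_ge0 => //; apply: mulr_ge0; [exact: pi_ge0|exact: sqr_ge0].
have gen (p v s : R) : 0 <= p * v ^+ 2 * s -> v * 1 * (p * v * s) <= 2 * p * v ^+ 2 * s by lra.
exact: gen.
Qed.

Lemma sinc_step_small e : 0 < e -> exists m, (0 < m)%N /\ sinc_step m <= e.
Proof.
move=> e0; exists (Num.truncn (c / (2 * pi * e))).+1; split => //.
have p0 := @pi_gt0 R.
rewrite /sinc_step ler_pdivrMr ?mulr_gt0 ?ltr0n//.
have := truncnS_gt (c / (2 * pi * e)).
rewrite ltr_pdivrMr ?mulr_gt0// => /ltW; lra.
Qed.

Lemma sinc_L2 (x : R) : (fun y => sin (c * (x - y)) / (pi * (x - y))) \in Lfun mu 2%:E.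
Proof.
have p0 := @pi_gt0 R.
apply: (bounded_L2 (M := c / pi)); first exact: measurable_sinc.
move=> y _; have [->|t0] := eqVneq (x - y) 0.
  by rewrite !mulr0 sin0 mul0r normr0 divr_ge0// ltW.
have tp : 0 < `|x - y| by rewrite normr_gt0.
rewrite normrM normfV normrM (gtr0_norm p0) ler_pdivrMr ?mulr_gt0//.
have -> : c / pi * (pi * `|x - y|) = `|c * (x - y)|.
  by rewrite normrM (gtr0_norm c0) mulrA divfK// lt0r_neq0.
move: (c * (x - y)) => u.
wlog u0 : u / 0 <= u.
  move=> h; have [/h//|u0] := leP 0 u.
  by have := h (- u); rewrite sinN !normrN; apply; rewrite oppr_ge0 ltW.
rewrite (ger0_norm u0) ler_norml sin_le// andbT.
have [u1|u1] := leP u 1.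
  have := sin_ge u0; have : u ^+ 3 <= u by rewrite exprS ler_piMr// exprn_ile1.
  lra.
by have := sin_geN1 u; lra.
Qed.

Lemma sinc_approx e : 0 < e -> exists n (om : 'I_n -> R) w, 0 <= w /\
  forall x y, -1 < x < 1 -> -1 < y < 1 -> y != x ->
    `|sin (c * (x - y)) / (pi * (x - y)) - w * \sum_(j < n) cos (om j * (x - y))| <= e.
Proof.
move=> e0; have p4 : pi <= 4 :> R by have := @pihalf_lt2 R; lra.
have p0 := @pi_gt0 R.
(* With pi <= 4 and |x - y| <= 2, a step of at most 1/8 keeps the argument of the cosecant within
   1. *)
have e1 : 0 < Num.min (1 / 8) (e / 16) by rewrite lt_min; apply/andP; split; lra.
have [m [m0 h]] := sinc_step_small e1.
exists m, (@sinc_freq m), (2 * sinc_step m); split.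
  by rewrite mulr_ge0// ltW// sinc_step_gt0.
have w8 : sinc_step m <= 1 / 8 by rewrite (le_trans h)// ge_min lexx.
have we : sinc_step m <= e / 16 by rewrite (le_trans h)// ge_min lexx orbT.
have w0 := sinc_step_gt0 m0.
move=> x y /andP[x1 x2] /andP[y1 y2] yx.
have t2 : `|x - y| <= 2 by rewrite ler_norml; apply/andP; split; lra.
have pw : pi * sinc_step m <= 4 * (1 / 8) by apply: ler_pM => //; exact: ltW.
have pw0 : 0 < pi * sinc_step m by exact: mulr_gt0.
apply: le_trans (sinc_kernel_approx m0 _ _) _.
- by rewrite subr_eq0 eq_sym.
- rewrite normrM (gtr0_norm pw0).
  have : pi * sinc_step m * `|x - y| <= 4 * (1 / 8) * 2 by apply: ler_pM => //; exact: ltW.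
  lra.
- have : (pi * sinc_step m) * `|x - y| <= 4 * (1 / 8) * 2 by apply: ler_pM => //; exact: ltW.
  have : 0 <= pi * sinc_step m * `|x - y| by rewrite mulr_ge0// ltW.
  move=> h0 h1; have : (pi * sinc_step m * `|x - y|) * sinc_step m <= 1 * (e / 16).
    by apply: ler_pM => //; [exact: ltW|lra].
  lra.
Qed.

Definition sincL2 : L2 -> L2 := kernel_op (fun x _ => sinc_L2 x) sinc_approx.

Lemma sincL2E f x : -1 < x < 1 -> sincL2 f x = sinc_op c f x.
Proof. by move=> xI; rewrite /sincL2 kernel_opE. Qed.

Lemma sincL2_approx : trig_approx sincL2.
Proof. exact: kernel_op_approx. Qed.

End Sinc.

Section Dirichlet.
Variables (W : R) (N : nat).
Hypothesis W0 : 0 < W.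
Hypothesis W1 : W < 1 / 2.

(** The frequencies 1 - N, 3 - N, ..., N - 1 times pi W, symmetric about 0; the Dirichlet kernel is
    exactly their cosine sum. *)
Definition dir_freq (j : 'I_N) : R := (2 * j%:R + (1 - N%:R)) * (pi * W).

(** W < 1/2 and |x - y| < 2 keep pi W |x - y| below pi. *)
Lemma sin_piW_neq0 (x y : R) : -1 < x < 1 -> -1 < y < 1 -> y != x -> sin (pi * W * (x - y)) != 0.
Proof.
move=> /andP[x1 x2] /andP[y1 y2] yx; have p0 := @pi_gt0 R.
wlog xy : x y x1 x2 y1 y2 yx / y < x.
  move=> h; have [/h->//|xy|e] := ltgtP y x; last by rewrite e eqxx in yx.
  by have := h y x; rewrite eq_sym yx -opprB mulrN sinN oppr_eq0; apply.
rewrite gt_eqF// sin_gt0_pi// ?mulr_gt0 ?subr_gt0//.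
rewrite -mulrA gtr_pMr//.
have : W * (x - y) < W * 2 by rewrite ltr_pM2l//; lra.
by move=> h; rewrite andTb; apply: lt_trans h _; rewrite -ltr_pdivlMr.
Qed.

Lemma dir_kernelE (x y : R) : -1 < x < 1 -> -1 < y < 1 -> y != x ->
  sin (pi * N%:R * W * (x - y)) / sin (pi * W * (x - y)) =
  1 * \sum_(j < N) cos (dir_freq j * (x - y)).
Proof.
move=> xI yI yx; have s0 := sin_piW_neq0 xI yI yx.
have := @dirichlet_sum R N (1 - N%:R) (pi * W * (x - y)).
have -> : (2 * N%:R + (1 - N%:R) - 1) * (pi * W * (x - y)) = pi * N%:R * W * (x - y) by ring.
have -> : (1 - N%:R - 1) * (pi * W * (x - y)) = - (pi * N%:R * W * (x - y)) by ring.
rewrite sinN opprK => e.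
have -> : \sum_(j < N) cos (dir_freq j * (x - y)) =
  \sum_(j < N) cos ((2 * j%:R + (1 - N%:R)) * (pi * W * (x - y))).
  by apply: eq_bigr => j _; rewrite /dir_freq -!mulrA.
move: e s0; move: (\sum_(j < N) _) (sin _) (sin _) => S p q e q0.
have -> : p = q * S by lra.
by field.
Qed.

Lemma dir_L2 (x : R) : -1 < x < 1 ->
  (fun y => sin (pi * N%:R * W * (x - y)) / sin (pi * W * (x - y))) \in Lfun mu 2%:E.
Proof.
move=> xI; apply: (bounded_L2 (M := N%:R)); first exact: measurable_ratio.
move=> y yI; have [->|yx] := eqVneq y x.
  by rewrite subrr !mulr0 sin0 mul0r normr0.
rewrite dir_kernelE// mul1r; apply: le_trans (ler_norm_sum _ _ _) _.
rewrite -[leRHS](_ : \sum_(j < N) 1 = _); last by rewrite sumr_const card_ord.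
by apply: ler_sum => j _; rewrite ler_norml cos_geN1 cos_le1.
Qed.

Lemma dir_approx e : 0 < e -> exists n (om : 'I_n -> R) w, 0 <= w /\
  forall x y, -1 < x < 1 -> -1 < y < 1 -> y != x ->
    `|sin (pi * N%:R * W * (x - y)) / sin (pi * W * (x - y))
      - w * \sum_(j < n) cos (om j * (x - y))| <= e.
Proof.
move=> e0; exists N, dir_freq, 1; split => // x y xI yI yx.
by rewrite dir_kernelE// subrr normr0 ltW.
Qed.

Definition dirL2 : L2 -> L2 := kernel_op dir_L2 dir_approx.

Lemma dirL2E f x : -1 < x < 1 -> dirL2 f x = dirichlet_op W N f x.
Proof. by move=> xI; rewrite /dirL2 kernel_opE. Qed.

Lemma dirL2_approx : trig_approx dirL2.
Proof. exact: kernel_op_approx. Qed.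

End Dirichlet.

End KernelOperators.

(** * Eigenfunctions as functions and as elements of L2 *)

Section Bridge.
Variable R : realType.
Notation mu := (@mu11 R).
Notation L2 := (LfunType mu (lee1n 2)).
Notation ip := (@ip2 R).
Implicit Types (f g h : L2).
Let ipP := ip2_semi R.
Variables (A : L2 -> L2) (T : (R -> R) -> (R -> R)).
Hypothesis AT : forall f x, -1 < x < 1 -> A f x = T f x.

Lemma ae_eqT (u v : R -> R) : u = v %[ae mu] <-> {ae mu, forall x, u x = v x}.
Proof.
have FF : Filter (nbhs (almost_everywhere mu)) by exact: ae_filter_ringOfSetsType.
by split; apply: filterS => x; [apply | move=> ? _].
Qed.

(** [A f] and [T f] agree on (-1, 1), a set of full measure, and a vector of norm zero vanishes
    almost everywhere. *)
Lemma eigen_ae f lam : eigen ip A lam f <-> (T f = (fun x => lam * f x) %[ae mu]).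
Proof.
have FF : Filter (nbhs (almost_everywhere mu)) by exact: ae_filter_ringOfSetsType.
have ATae : {ae mu, forall x, A f x = T f x} by apply: mu11_ae => x xI; exact: AT.
rewrite ae_eqT; split=> [ev|ev g].
  have : ip (A f - lam *: f) (A f - lam *: f) = 0.
    by rewrite (ipBl ipP) ev (ipZl ipP) subrr.
  move=> /ip2_eq0 h; apply: filterS2 ATae h => x <- /eqP.
  by rewrite -[X in X == 0]/(A f x - lam * f x) subr_eq0 => /eqP.
rewrite -(ipZl ipP); apply: eq_ip2; try exact: L2_mfun; last exact: aeW.
by apply: filterS2 ATae ev => x -> ->.
Qed.

Lemma leading_of_eigenfunctions K (psi : 'I_K -> R -> R) : leading_eigenfunctions T psi ->
  exists psiL : 'I_K -> L2, (forall i, psiL i = psi i :> (R -> R)) /\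
    exists lam, leading ip A psiL lam.
Proof.
move=> [on [lam [ev mono top]]].
have psiIn i : psi i \in Lfun mu 2%:E by have [] := ev i.
exists (fun i => toL2 (psiIn i)); split => //; exists lam; split => //.
- by move=> i; apply/eigen_ae; have [] := ev i.
- move=> nu h h0 evh hp i; apply: (top nu h) => //; split; first exact: LfunP.
    by move=> hae; move: h0; rewrite (ae_ip2_eq0 ((ae_eqT _ _).1 hae)) eqxx.
  exact/eigen_ae.
Qed.

Lemma eigenfunctions_of_leading K (psi : 'I_K -> L2) lam : leading ip A psi lam ->
  leading_eigenfunctions T (fun i => psi i : R -> R).
Proof.
move=> [on ev mono top]; split; first by move=> i j; exact: on.
exists lam; split => //.
- move=> i; split; [exact: LfunP| | exact/eigen_ae].
  move=> pae; have := on i i; rewrite eqxx /= (ae_ip2_eq0 ((ae_eqT _ _).1 pae)) => /eqP.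
  by rewrite eq_sym oner_eq0.
- move=> nu h [hL hn hev] hp i.
  apply: (top nu (toL2 hL)) => //.
    by apply/eqP => /ip2_eq0 /ae_eqT.
  by apply/eigen_ae.
Qed.

(** [first_eigenfunctions] is picked by [xget], so it meets its specification as soon as one leading
    family exists. *)
Lemma first_eigenfunctions_leading K : (exists psi : 'I_K -> L2, exists lam, leading ip A psi lam) ->
  exists (psi : 'I_K -> L2) lam, (forall i, psi i = first_eigenfunctions T i :> (R -> R)) /\
    leading ip A psi lam.
Proof.
move=> [psi0 [lam0 /eigenfunctions_of_leading h]].
have : leading_eigenfunctions T (@first_eigenfunctions R T K) by exact: (xgetPex _ (ex_intro _ _ h)).
by move=> /leading_of_eigenfunctions [psi [e [lam l]]]; exists psi, lam.
Qed.

(** The candidates in [orth_proj] are literal combinations of the chosen eigenfunctions, and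
    orthogonality forces their coefficients. Hence [xget] has only one possible value, and the
    equality holds at every point. *)
Lemma eigen_projE K (psi : 'I_K -> L2) : orthonormal_fam ip psi ->
  (forall i, psi i = first_eigenfunctions T i :> (R -> R)) ->
  forall f, eigen_proj T K f = span_proj ip psi f :> (R -> R).
Proof.
move=> on e f; rewrite /eigen_proj /orth_proj.
have spanE (a : 'I_K -> R) : (\sum_(i < K) a i *: psi i : L2) =
    (fun x => \sum_(i < K) a i * first_eigenfunctions T i x) :> (R -> R).
  by apply/funext => x; rewrite L2_sumE; apply: eq_bigr => i _; rewrite -e.
apply: xget_unique.
  split; first by exists (fun i => ip f (psi i)); exact: spanE.
  move=> _ [a ->]; rewrite -spanE -[LHS]/(ip (f - span_proj ip psi f) _).
  by rewrite (ip_sumr ipP) big1// => i _; rewrite (ipZr ipP) (proj_perp ipP)// mulr0.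
move=> _ [[a ->] ha]; rewrite -spanE.
have aE i : a i = ip f (psi i).
  have Vi : lin_span (@first_eigenfunctions R T K) (psi i).
    exists (fun j => (j == i)%:R); rewrite -spanE; congr (_ : R -> R).
    by rewrite (bigD1 i)//= eqxx scale1r big1 ?addr0// => j /negPf ->; rewrite scale0r.
  have := ha _ Vi; rewrite -spanE.
  rewrite -[LHS]/(ip (f - \sum_(j < K) a j *: psi j) (psi i)) (ipBl ipP).
  by rewrite (ip_comb_on ipP _ _ on) => /eqP; rewrite subr_eq0 => /eqP.
suff -> : \sum_(i < K) a i *: psi i = span_proj ip psi f by [].
by rewrite /span_proj; apply: eq_bigr => i _; rewrite aE.
Qed.

End Bridge.

Lemma opnorm_le (R : realType) (T : (R -> R) -> (R -> R)) (X : R) : 0 <= X ->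
  (forall f : LfunType (@mu11 R) (lee1n 2), exists g : LfunType (@mu11 R) (lee1n 2),
     T f = g :> (R -> R) /\ ip2 g g <= X ^+ 2 * ip2 f f) ->
  (opnorm T <= X%:E)%E.
Proof.
move=> X0 h; apply: ge_ereal_sup => _ [f [fL f1] <-].
have [g [-> hg]] := h (toL2 fL).
rewrite norm2_ip lee_fin -[leRHS](ger0_norm X0) -sqrtr_sqr ler_wsqrtr//.
apply: le_trans hg _; rewrite -[leRHS]mulr1 ler_wpM2l ?sqr_ge0//.
have := f1; rewrite -[X in norm2 X]/(toL2 fL : R -> R) norm2_ip lee_fin => s1.
rewrite -(sqr_sqrtr (ip_ge0 (ip2_semi R) (toL2 fL))).
by rewrite exprn_ile1// sqrtr_ge0.
Qed.

(** * The trace of the sinc operator *)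

Section FTC.
Variable R : realType.
Notation leb := (@lebesgue_measure R).
Notation mu := (@mu11 R).

Lemma continuous_integrable_itv (F : R -> R) (a b : R) : continuous F ->
  leb.-integrable `[a, b] (EFin \o F).
Proof.
move=> cF; apply: continuous_compact_integrable; first exact: segment_compact.
exact: continuous_subspaceT.
Qed.

Lemma Rint_FTC_on (F G : R -> R) (a b : R) : a <= b ->
  (forall x : R, a <= x <= b -> {for x, continuous F}) ->
  (forall x : R, a <= x <= b -> is_derive x 1 G (F x)) ->
  leb.-integrable `[a, b] (EFin \o F) /\ \int[leb]_(x in `[a, b]) F x = G b - G a.
Proof.
move=> ab cF dG.
have cFw : {within `[a, b], continuous F}.
  by apply: continuous_in_subspaceT => x; rewrite inE/= in_itv/=; exact: cF.
split; first by apply: continuous_compact_integrable => //; exact: segment_compact.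
move: ab; rewrite le_eqVlt => /orP[/eqP <-|ab]; first by rewrite set_itv1 Rintegral_set1 subrr.
have cG x : a <= x <= b -> {for x, continuous G}.
  by move=> /dG dGx; apply: differentiable_continuous; apply/derivable1_diffP; have [] := dGx.
have sub x : x \in `]a, b[ -> a <= x <= b.
  by rewrite in_itv/= => /andP[/ltW -> /ltW ->].
rewrite /Rintegral (@continuous_FTC2 _ F G)//.
- split.
  + by move=> x /sub /dG [].
  + by apply: cvg_at_right_filter; apply: cG; rewrite lexx ltW.
  + by apply: cvg_at_left_filter; apply: cG; rewrite lexx ltW.
- by move=> x /sub /dG dGx; rewrite derive1E derive_val.
Qed.

Lemma Rint_FTC (F G : R -> R) (a b : R) : a <= b -> continuous F ->
  (forall x : R, is_derive x 1 G (F x)) -> \int[leb]_(x in `[a, b]) F x = G b - G a.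
Proof. by move=> ab cF dG; have [] := @Rint_FTC_on F G a b ab (fun x _ => cF x) (fun x _ => dG x). Qed.

Lemma mu11_FTC (F G : R -> R) (a b : R) : -1 <= a -> a <= b -> b <= 1 -> continuous F ->
  (forall x : R, is_derive x 1 G (F x)) -> \int[mu]_x ((F \_ `]a, b[) x) = G b - G a.
Proof.
move=> a1 ab b1 cF dG; rewrite mu11_Rint; last first.
  apply: (measurable_restrictT _ (measurable_itv _)).1; apply: measurable_funTS.
  exact: continuous_measurable_fun.
rewrite -Rintegral_mkcondr -(Rint_FTC ab cF dG) setIidr; last first.
  by apply: subset_itv; rewrite bnd_simp.
rewrite Rintegral_itv_bndo_bndc; last first.
  by apply: integrableS (continuous_integrable_itv a b cF) => //; exact: subset_itv_oo_cc.
rewrite Rintegral_itv_obnd_cbnd//.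
by apply: integrableS (continuous_integrable_itv a b cF) => //; exact: subset_itv_oc_cc.
Qed.

Lemma mu11_FTC1 (F G : R -> R) : continuous F ->
  (forall x : R, is_derive x 1 G (F x)) -> \int[mu]_x F x = G 1 - G (-1).
Proof.
move=> cF dG; rewrite mu11_Rint; last exact: continuous_measurable_fun.
by apply: Rint_FTC => //; lra.
Qed.

End FTC.

Section SincNear.
Variable R : realType.
Notation mu := (@mu11 R).
Notation L2 := (LfunType mu (lee1n 2)).
Notation ip := (@ip2 R).
Implicit Types (f g h : L2).
Let ipP := ip2_semi R.
Variable c : R.
Hypothesis c0 : 0 < c.
Notation A := (sincL2 c0).

Definition sinc_trig m : L2 -> L2 := trig_op (@sinc_freq R c m) (2 * sinc_step c m).

Lemma sinc_trig_near (delta e : R) : 0 < delta -> 0 < e ->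
  exists m, [/\ (0 < m)%N, sinc_step c m <= delta &
    forall f, ip (A f - sinc_trig m f) (A f - sinc_trig m f) <= e ^+ 2 * ip f f].
Proof.
move=> d0 e0; have p4 : pi <= 4 :> R by have := @pihalf_lt2 R; move: (pi : R) => p; lra.
have p0 := @pi_gt0 R.
have e1 : 0 < Num.min delta (Num.min (1 / 8) (e / 4)).
  by rewrite !lt_min d0/=; apply/andP; split; lra.
have [m [m0 h]] := sinc_step_small c e1.
have w1 : sinc_step c m <= delta by rewrite (le_trans h)// ge_min lexx.
have w8 : sinc_step c m <= 1 / 8 by rewrite (le_trans h)// !ge_min lexx orbT.
have we : sinc_step c m <= e / 4 by rewrite (le_trans h)// !ge_min lexx !orbT.
have w0 := sinc_step_gt0 c0 m0.
exists m; split => // f.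
have pw : pi * sinc_step c m <= 4 * (1 / 8) by apply: ler_pM => //; exact: ltW.
have pw0 : 0 < pi * sinc_step c m by exact: mulr_gt0.
have key (x y : R) : -1 < x < 1 -> -1 < y < 1 -> y != x ->
    `|sin (c * (x - y)) / (pi * (x - y)) - 2 * sinc_step c m *
      \sum_(j < m) cos (sinc_freq c j * (x - y))| <= e / 2.
  move=> /andP[x1 x2] /andP[y1 y2] yx.
  have t2 : `|x - y| <= 2 by rewrite ler_norml; apply/andP; split; lra.
  have h1 : pi * sinc_step c m * `|x - y| <= 4 * (1 / 8) * 2.
    by apply: ler_pM => //; exact: ltW.
  apply: le_trans (sinc_kernel_approx c0 m0 _ _) _.
  - by rewrite subr_eq0 eq_sym.
  - by rewrite normrM (gtr0_norm pw0); apply: le_trans h1 _; lra.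
  - have h2 : (pi * sinc_step c m * `|x - y|) * sinc_step c m <= 1 * (e / 4).
      apply: ler_pM => //; [by rewrite mulr_ge0// ltW|exact: ltW|].
      by apply: le_trans h1 _; lra.
    rewrite (_ : 2 * pi * sinc_step c m ^+ 2 * `|x - y| =
      2 * ((pi * sinc_step c m * `|x - y|) * sinc_step c m)); last by ring.
    by move: h2; lra.
apply: le_trans (ip2_cst (M := e / 2 * Num.sqrt 2 * Num.sqrt (ip f f)) _) _; last first.
  rewrite !exprMn exprVn !sqr_sqrtr ?(ip_ge0 ipP)//.
  rewrite le_eqVlt; apply/orP; left; apply/eqP; by field.
move=> x xI.
rewrite -[X in `|X|]/(A f x - sinc_trig m f x) /sinc_trig trig_op_kernel.
rewrite {1}/sincL2 kernel_opE// (ipC ipP f) -[inner _ f]/(ip (toL2 (sinc_L2 c0 x)) f) -(ipBl ipP).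
have e20 : 0 <= e / 2 by rewrite divr_ge0// ltW.
rewrite -(ler_pXn2r (n := 2)) ?nnegrE//; last by apply: mulr_ge0; [apply: mulr_ge0 => //|]; exact: sqrtr_ge0.
rewrite real_normK ?num_real// !exprMn !sqr_sqrtr ?(ip_ge0 ipP)//.
apply: le_trans (cauchy_schwarz ipP _ _) _; rewrite ler_wpM2r ?(ip_ge0 ipP)//.
apply: le_trans (@ip2_cst_neq R (e / 2) x _ _ e20) _; last by rewrite !exprMn mulrC.
move=> y yI yx.
rewrite -[X in `|X|]/(sin (c * (x - y)) / (pi * (x - y)) - trig_kernel _ _ x y) trig_kernelE.
exact: key.
Qed.

(** The device by which inequalities pass from the finite sums to the sinc operator; [delta] leaves
    room for further conditions on the step. *)
Lemma sinc_form_near (delta e : R) : 0 < delta -> 0 < e ->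
  exists m, [/\ (0 < m)%N, sinc_step c m <= delta,
    forall f, ip (A f - sinc_trig m f) (A f - sinc_trig m f) <= e ^+ 2 * ip f f &
    forall f, `|ip (A f) f - ip (sinc_trig m f) f| <= e * ip f f].
Proof.
move=> d0 e0; have [m [m0 md h]] := sinc_trig_near d0 e0; exists m; split => // f.
rewrite -(ipBl ipP) -(ler_pXn2r (n := 2)) ?nnegrE ?mulr_ge0 ?(ip_ge0 ipP) ?(ltW e0)//.
rewrite real_normK ?num_real// exprMn.
apply: le_trans (cauchy_schwarz ipP _ _) _.
by rewrite (expr2 (ip f f)) mulrA ler_wpM2r ?(ip_ge0 ipP).
Qed.

Lemma sinc_trig_form m f : ip (sinc_trig m f) f = 2 * sinc_step c m *
  \sum_(j < m) (ip f (cosL2 (sinc_freq c j)) ^+ 2 + ip f (sinL2 (sinc_freq c j)) ^+ 2).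
Proof. by rewrite trig_op_ip; congr (_ * _); apply: eq_bigr => j _; rewrite -!expr2. Qed.

Lemma ip_cos_sin (a : R) : ip (cosL2 a) (cosL2 a) + ip (sinL2 a) (sinL2 a) = 2.
Proof.
rewrite /ip2 /inner -RintegralD//; try exact: ip2_integrable.
under eq_Rintegral => x _ do rewrite /= -!expr2 cos2Dsin2.
by rewrite Rintegral_cst// mu11_setT/= mul1r.
Qed.

(** For each frequency, Bessel's inequality bounds the sum over the family by |cos|^2 + |sin|^2 = 2.
    The [m] frequencies with weight 2 w give 4 w m = 2 c / pi. *)
Lemma sinc_trace K (psi : 'I_K -> L2) : orthonormal_fam ip psi ->
  \sum_(i < K) ip (A (psi i)) (psi i) <= 2 * c / pi.
Proof.
move=> on; have p0 := @pi_gt0 R.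
apply/ler_addgt0Pr => e e0.
have K0 : 0 < K%:R + 1 :> R by rewrite ltr_wpDl.
have [m [m0 _ _ h]] := sinc_form_near ltr01 (divr_gt0 e0 K0).
apply: le_trans (_ : \sum_(i < K) (ip (sinc_trig m (psi i)) (psi i) + e / (K%:R + 1)) <= _).
  apply: ler_sum => i _; have := h (psi i); rewrite on eqxx mulr1 => /ler_normlP [_].
  lra.
rewrite big_split/=; apply: lerD; last first.
  rewrite sumr_const card_ord -[_ *+ K]mulr_natr mulrAC ler_pdivrMr//.
  by rewrite ler_wpM2l ?(ltW e0)// lerDl.
under eq_bigr do rewrite sinc_trig_form.
rewrite -mulr_sumr exchange_big/=.
have w0 := sinc_step_gt0 c0 m0.
apply: le_trans (_ : 2 * sinc_step c m * \sum_(j < m) 2 <= _).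
  apply: ler_wpM2l; first by rewrite mulr_ge0// ltW.
  apply: ler_sum => j _.
  rewrite big_split/= -(ip_cos_sin (sinc_freq c j)); apply: lerD.
    by apply: le_trans (bessel ipP (cosL2 (sinc_freq c j)) on); apply: ler_sum => i _; rewrite (ipC ipP).
  by apply: le_trans (bessel ipP (sinL2 (sinc_freq c j)) on); apply: ler_sum => i _; rewrite (ipC ipP).
rewrite sumr_const card_ord -[_ *+ m]mulr_natr -(ler_pM2r p0) divfK ?gt_eqF//.
have := sinc_stepM c m0; move: (sinc_step c m) (pi : R) (m%:R : R) => w p k; lra.
Qed.

End SincNear.

(** * The lower bound for the eigenvalue of index [2NW] - 1 *)

Section Landau.
Variable R : realType.
Notation mu := (@mu11 R).
Notation L2 := (LfunType mu (lee1n 2)).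
Notation ip := (@ip2 R).
Implicit Types (f g h : L2).
Let ipP := ip2_semi R.

Lemma le_cos (x y : R) : 0 <= x -> x <= y -> y <= pi -> cos y <= cos x.
Proof.
move=> x0 xy yp.
have xI : x \in `[0, pi] by rewrite in_itv/= x0 (le_trans xy).
have yI : y \in `[0, pi] by rewrite in_itv/= yp (le_trans x0).
by rewrite leNgt (ltr_cos yI xI) -leNgt.
Qed.

Lemma sin_natpi n : sin (n%:R * pi) = 0 :> R.
Proof.
elim: n => [|n IH]; first by rewrite mul0r sin0.
by rewrite -natr1 mulrDl mul1r sinDpi IH oppr0.
Qed.

Lemma sin_small_neq0 (u : R) : u != 0 -> `|u| <= 1 -> sin u != 0.
Proof.
move=> u0 u1; have up : 0 < `|u| by rewrite normr_gt0.
have s1 : 0 < sin `|u|.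
  apply: sin_gt0_pi; rewrite up/= (le_lt_trans u1)//.
  by apply: lt_le_trans (pi_ge2 R); rewrite ltr1n.
by apply/eqP => su0; move: s1; case: (ger0P u) => _; rewrite ?sinN su0 ?oppr0 ltxx.
Qed.

Variable c : R.
Hypothesis c0 : 0 < c.
Let a := pi / (2 * c).
Let a0 : 0 < a. Proof. by rewrite divr_gt0 ?pi_gt0// mulr_gt0. Qed.
Let ca : c * a = pi / 2.
Proof.
rewrite /a; move: (pi : R) c0 => p cp; by field; rewrite gt_eqF.
Qed.

Variable K : nat.
Hypothesis hK : K%:R * (pi / c) <= 2.

(** [a] is half the length of an arch of cos(c x). The arches are adjacent, the first one starts at
    -1, and [hK] makes all [K] of them fit. *)
Definition bump_center (j : 'I_K) : R := -1 + (2 * j%:R + 1) * a.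
Notation xc := bump_center.

Lemma bump_itv j : -1 <= xc j - a /\ xc j + a <= 1.
Proof.
have hKa : K%:R * 2 * a <= 2.
  apply: le_trans hK; rewrite /a le_eqVlt; apply/orP; left; apply/eqP.
  by move: (pi : R) (K%:R : R) c0 => p k cp; field; rewrite gt_eqF.
have j0 : 0 <= j%:R :> R by [].
have jK : j%:R + 1 <= K%:R :> R by rewrite natr1 ler_nat.
rewrite /bump_center; split.
  have : 0 <= j%:R * a by rewrite mulr_ge0// ltW.
  by move: (j%:R : R) => y; move: a => b; lra.
have : (j%:R + 1) * a <= K%:R * a by rewrite ler_wpM2r// ltW.
by move: hKa; move: (j%:R : R) (K%:R : R) => y k; move: a => b; lra.
Qed.

Lemma bump_L2 j : (fun x : R => cos (c * (x - xc j))) \_ (`](xc j - a), (xc j + a)[) \in Lfun mu 2%:E.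
Proof.
apply: (bounded_L2 (M := 1)).
  apply: (measurable_restrictT _ (measurable_itv _)).1; apply: measurable_funTS.
  apply: continuous_measurable_fun => x; apply: continuous_comp; last exact: continuous_cos.
  by apply: cvgM; [exact: cvg_cst|apply: cvgB; [exact: cvg_id|exact: cvg_cst]].
by move=> x _; rewrite patchE; case: ifP => _; rewrite ?normr0// cos_max.
Qed.

Definition bump j : L2 := toL2 (bump_L2 j).

Lemma bump_mul j (F : R -> R) : (fun x => bump j x * F x) =
  (fun x => cos (c * (x - xc j)) * F x) \_ (`](xc j - a), (xc j + a)[).
Proof.
by apply/funext => x; rewrite toL2E !patchE; case: ifP => _; rewrite ?mul0r.
Qed.

Lemma bump_center_le (i j : 'I_K) : (i < j)%N -> xc i + a <= xc j - a.
Proof.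
move=> ij; have : i%:R + 1 <= j%:R :> R by rewrite natr1 ler_nat.
move=> h; have : (i%:R + 1) * a <= j%:R * a by rewrite ler_wpM2r// ltW.
by rewrite /bump_center; move: (i%:R : R) (j%:R : R) => y k; move: a => b; lra.
Qed.

Lemma bump_orth i j : i != j -> ip (bump i) (bump j) = 0.
Proof.
move=> ij; rewrite /ip2 /inner.
under eq_Rintegral => x _.
  have -> : bump i x * bump j x = 0; last over.
  rewrite !toL2E !patchE; case: ifPn => //; last by rewrite mul0r.
  case: ifPn => //; last by rewrite mulr0.
  rewrite !inE/= !in_itv/= => /andP[j1 j2] /andP[i1 i2].
  have [/bump_center_le h|/bump_center_le h|/val_inj e] := ltngtP (i : nat) j.
  - by have := lt_trans (le_lt_trans h j1) i2; rewrite ltxx.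
  - by have := lt_trans (le_lt_trans h i1) j2; rewrite ltxx.
  - by rewrite e eqxx in ij.
by rewrite Rintegral_cst// mul0r.
Qed.

Lemma is_derive_shift_sin (k b x : R) : k != 0 ->
  is_derive x 1 (fun x : R => sin (k * (x - b)) / k) (cos (k * (x - b))).
Proof.
move=> k0; apply: is_derive_eq; rewrite /GRing.scale/= ?subr0 ?mulr1 ?mul0r ?mulr0 ?addr0 ?add0r.
by field.
Qed.

Lemma is_derive_shift_cos (k b x : R) : k != 0 ->
  is_derive x 1 (fun x : R => - cos (k * (x - b)) / k) (sin (k * (x - b))).
Proof.
move=> k0; apply: is_derive_eq; rewrite /GRing.scale/= ?subr0 ?mulr1 ?mul0r ?mulr0 ?addr0 ?add0r.
by field.
Qed.

Let cont_lin (g : R -> R) (k b : R) : continuous g -> continuous (fun x : R => g (k * (x - b))).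
Proof.
move=> cg x; apply: (continuous_comp (f := fun x : R => k * (x - b))); last exact: cg.
by apply: cvgM; [exact: cvg_cst|apply: cvgB; [exact: cvg_id|exact: cvg_cst]].
Qed.

Lemma bump_norm j : ip (bump j) (bump j) = a.
Proof.
have [h1 h2] := bump_itv j.
rewrite /ip2 /inner bump_mul.
pose F x := (1 + cos (2 * c * (x - xc j))) / 2.
have -> : (fun x => cos (c * (x - xc j)) * bump j x) \_ (`](xc j - a), (xc j + a)[) =
   F \_ (`](xc j - a), (xc j + a)[).
  apply/funext => x; rewrite !patchE; case: ifPn => // xi.
  rewrite toL2E patchE xi /F.
  have -> : 2 * c * (x - xc j) = (c * (x - xc j)) + (c * (x - xc j)) by ring.
  rewrite cosD; have := cos2Dsin2 (c * (x - xc j)); move: (cos _) (sin _) => C S e.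
  by move: e; rewrite !expr2; lra.
pose G x := (x + sin (2 * c * (x - xc j)) / (2 * c)) / 2.
have c2 : 2 * c != 0 by rewrite mulf_neq0 ?gt_eqF.
have dG (x : R) : is_derive x 1 G (F x).
  have h := is_derive_shift_sin (xc j) x c2.
  by rewrite /G /F; apply: is_derive_eq; rewrite /GRing.scale/=; lra.
have cF : continuous F.
  move=> x; apply: cvgM; last exact: cvg_cst.
  by apply: cvgD; [exact: cvg_cst|apply: cont_lin; exact: continuous_cos].
rewrite (mu11_FTC h1 _ h2 cF dG); last by move: a a0 => b b0; lra.
rewrite /G.
have -> : 2 * c * (xc j + a - xc j) = pi.
  have -> : 2 * c * (xc j + a - xc j) = 2 * (c * a) by ring.
  by rewrite ca mulrC divfK.
have -> : 2 * c * (xc j - a - xc j) = - pi.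
  have -> : 2 * c * (xc j - a - xc j) = - (2 * (c * a)) by ring.
  by rewrite ca mulrC divfK.
by rewrite sinN sinpi oppr0 mul0r; move: a => b; lra.
Qed.

Section Transform.
Variable om : R.
Hypothesis om0 : 0 < om.
Hypothesis omc : om < c.

(** The Fourier transform at [om] of the arch centred at 0: the integral of cos(c x) cos(om x) over
    [-a, a]. *)
Definition bump_hat : R := sin ((c - om) * a) / (c - om) + sin ((c + om) * a) / (c + om).

Let cm : c - om != 0. Proof. by rewrite gt_eqF// subr_gt0. Qed.
Let cp : c + om != 0. Proof. by rewrite gt_eqF// addr_gt0. Qed.

Let even_part (b x : R) := (sin ((c - om) * (x - b)) / (c - om) + sin ((c + om) * (x - b)) / (c + om)) / 2.
Let odd_part (b x : R) := (- cos ((c + om) * (x - b)) / (c + om) - - cos ((c - om) * (x - b)) / (c - om)) / 2.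

Let d_even b (x : R) : is_derive x 1 (even_part b) (cos (c * (x - b)) * cos (om * (x - b))).
Proof.
have h1 := is_derive_shift_sin b x cm; have h2 := is_derive_shift_sin b x cp.
have eA : (c - om) * (x - b) = c * (x - b) - om * (x - b) by ring.
have eB : (c + om) * (x - b) = c * (x - b) + om * (x - b) by ring.
rewrite /even_part; apply: is_derive_eq; rewrite /GRing.scale/= eA eB cosB cosD.
by move: (cos _) (sin _) (cos _) (sin _) => C S C' S'; lra.
Qed.

Let d_odd b (x : R) : is_derive x 1 (odd_part b) (cos (c * (x - b)) * sin (om * (x - b))).
Proof.
have h1 := is_derive_shift_cos b x cm; have h2 := is_derive_shift_cos b x cp.
have eA : (c - om) * (x - b) = c * (x - b) - om * (x - b) by ring.
have eB : (c + om) * (x - b) = c * (x - b) + om * (x - b) by ring.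
rewrite /odd_part; apply: is_derive_eq; rewrite /GRing.scale/= eA eB sinB sinD.
by move: (cos _) (sin _) (cos _) (sin _) => C S C' S'; lra.
Qed.

Let even_diff b : even_part b (b + a) - even_part b (b - a) = bump_hat.
Proof.
rewrite /even_part /bump_hat.
have -> : b + a - b = a by rewrite addrC addKr.
have -> : b - a - b = - a by rewrite addrC addKr.
by rewrite !mulrN !sinN; lra.
Qed.

Let odd_diff b : odd_part b (b + a) - odd_part b (b - a) = 0.
Proof.
rewrite /odd_part.
have -> : b + a - b = a by rewrite addrC addKr.
have -> : b - a - b = - a by rewrite addrC addKr.
by rewrite !mulrN !cosN subrr.
Qed.

Let bump_int j (F : R -> R) (p q : R) : F = (fun x => cos (c * (x - xc j)) *
    (p * cos (om * (x - xc j)) + q * sin (om * (x - xc j)))) ->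
  \int[mu]_x ((F \_ (`](xc j - a), (xc j + a)[)) x) = p * bump_hat.
Proof.
move=> ->; have [h1 h2] := bump_itv j.
pose G x := p * even_part (xc j) x + q * odd_part (xc j) x.
have ab : xc j - a <= xc j + a by move: a a0 => b b0; lra.
have cF : continuous (fun x => cos (c * (x - xc j)) *
    (p * cos (om * (x - xc j)) + q * sin (om * (x - xc j)))).
  move=> x; apply: cvgM; first by apply: cont_lin; exact: continuous_cos.
  by apply: cvgD; (apply: cvgM; [exact: cvg_cst|apply: cont_lin]); [exact: continuous_cos|exact: continuous_sin].
have dG (x : R) : is_derive x 1 G (cos (c * (x - xc j)) *
    (p * cos (om * (x - xc j)) + q * sin (om * (x - xc j)))).
  have e1 := d_even (xc j) x; have e2 := d_odd (xc j) x.
  by rewrite /G; apply: is_derive_eq; rewrite /GRing.scale/=; lra.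
rewrite (mu11_FTC h1 ab h2 cF dG).
have := even_diff (xc j); have := odd_diff (xc j); rewrite /G.
move: (even_part _ (_ + _)) (even_part _ (_ - _)) (odd_part _ (_ + _)) (odd_part _ (_ - _)) => A B C D e1 e2.
have -> : A = bump_hat + B by lra.
have -> : C = D by lra.
by ring.
Qed.

Lemma bump_cos j : ip (bump j) (cosL2 om) = cos (om * xc j) * bump_hat.
Proof.
rewrite /ip2 /inner bump_mul; apply: (@bump_int _ _ _ (- sin (om * xc j))).
apply/funext => x; congr (_ * _); rewrite toL2E.
by rewrite -{1}(subrK (xc j) x) mulrDr cosD; lra.
Qed.

Lemma bump_sin j : ip (bump j) (sinL2 om) = sin (om * xc j) * bump_hat.
Proof.
rewrite /ip2 /inner bump_mul; apply: (@bump_int _ _ _ (cos (om * xc j))).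
apply/funext => x; congr (_ * _); rewrite toL2E.
by rewrite -{1}(subrK (xc j) x) mulrDr sinD; lra.
Qed.

(** On [0, a], c x stays within pi / 2 and om < c, so cos(om x) >= cos(c x) >= 0. The transform is
    therefore at least the integral of cos(c x)^2 over [-a, a], which is [a]. *)
Lemma bump_hat_ge : a <= bump_hat.
Proof.
pose h x := even_part 0 x - (x + sin (2 * c * (x - 0)) / (2 * c)) / 2.
have c2 : 2 * c != 0 by rewrite mulf_neq0 ?gt_eqF.
have dh (x : R) : is_derive x 1 h (cos (c * (x - 0)) * cos (om * (x - 0)) - (1 + cos (2 * c * (x - 0))) / 2).
  have h1 := is_derive_shift_sin 0 x c2; have h2 := d_even 0 x.
  by rewrite /h; apply: is_derive_eq; rewrite /GRing.scale/=; lra.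
have : h 0 <= h a.
  apply: (derive_ge0_le dh) (ltW a0) => y /andP[y0 ya]; rewrite subr0.
  have -> : 2 * c * y = c * y + c * y by ring.
  have cy : 0 <= c * y by rewrite mulr_ge0// ltW.
  have cya : c * y <= pi / 2 by rewrite -ca ler_pM2l.
  have p2 : pi / 2 <= pi :> R by have := pi_gt0 R; move: (pi : R) => p; lra.
  have C0 : 0 <= cos (c * y).
    by apply: cos_ge0_pihalf; rewrite cya andbT (le_trans _ cy)// oppr_le0 divr_ge0// pi_ge0.
  have Cle : cos (c * y) <= cos (om * y).
    apply: le_cos; [by rewrite mulr_ge0// ltW|by rewrite ler_wpM2r// ltW|exact: le_trans cya p2].
  rewrite cosD; have := cos2Dsin2 (c * y); move: (cos _) (sin _) (cos (om * y)) C0 Cle => C S D C0 Cle e.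
  have : C * C <= C * D by rewrite ler_wpM2l.
  by move: e; rewrite !expr2; lra.
rewrite /h /even_part !subr0 !mulr0 sin0 !mul0r !addr0 mul0r subr0 -/bump_hat.
rewrite (_ : 2 * c * a = pi); last by rewrite -mulrA ca mulrC divfK.
rewrite sinpi mul0r addr0 /bump_hat.
by move: (sin ((c - om) * a) / _) (sin ((c + om) * a) / _) => p q; lra.
Qed.

End Transform.

Definition bump1 j : L2 := (Num.sqrt a)^-1 *: bump j.

Let sa : (Num.sqrt a)^-1 * (Num.sqrt a)^-1 = a^-1.
Proof. by rewrite -expr2 exprVn sqr_sqrtr// ltW. Qed.

Lemma bump1_orthonormal : orthonormal_fam ip bump1.
Proof.
move=> i j; rewrite /bump1 (ipZl ipP) (ipZr ipP) mulrA sa.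
have [->|ij] := eqVneq i j; first by rewrite bump_norm mulVf// gt_eqF.
by rewrite bump_orth// mulr0.
Qed.

Let sum_sq n (u : 'I_n -> R) : (\sum_(i < n) u i) ^+ 2 = \sum_(i < n) \sum_(j < n) u i * u j.
Proof. by rewrite expr2 mulr_suml; apply: eq_bigr => i _; rewrite mulr_sumr. Qed.

Lemma freq_itv m (j : 'I_m) : (0 < m)%N -> 0 < sinc_freq c j < c.
Proof.
move=> m0; have w0 := sinc_step_gt0 c0 m0; have pw : 0 < pi * sinc_step c m by rewrite mulr_gt0// pi_gt0.
rewrite /sinc_freq mulr_gt0/= ?ltr_wpDl ?mulr_ge0//.
rewrite -[ltRHS](sinc_stepM c m0) ltr_pM2r//.
have : j%:R + 1 <= m%:R :> R by rewrite natr1 ler_nat.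
by move: (j%:R : R) (m%:R : R) => x y; lra.
Qed.

(** Centres differ by multiples of 2 a = pi / c, so off the diagonal the numerator sin(c t) of the
    kernel is the sine of a multiple of pi. The smallness of the step keeps the denominator
    nonzero. *)
Lemma bump_kernel m i j : (0 < m)%N -> sinc_step c m <= 1 / 8 ->
  2 * sinc_step c m * \sum_(l < m) cos (sinc_freq c l * (xc i - xc j)) = (c / pi) * (i == j)%:R.
Proof.
move=> m0 w8; have w0 := sinc_step_gt0 c0 m0; have p0 := pi_gt0 R.
have pn : pi != 0 :> R by rewrite gt_eqF.
have [->|ij] := eqVneq i j.
  rewrite subrr mulr1; under eq_bigr do rewrite mulr0 cos0.
  rewrite sumr_const card_ord -[1 *+ m]/(m%:R).
  by apply: (mulIf pn); rewrite divfK// -[RHS](sinc_stepM c m0); move: (pi : R) (sinc_step c m) => p w; ring.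
have te : xc i - xc j = (i%:R - j%:R) * (2 * a) by rewrite /bump_center; ring.
have t0 : xc i - xc j != 0.
  rewrite te; apply: mulf_neq0; last by apply: mulf_neq0; [rewrite pnatr_eq0|rewrite gt_eqF].
  rewrite subr_eq0 eqr_nat.
  by apply: contra ij => /eqP e; apply/eqP/val_inj.
have t2 : `|xc i - xc j| <= 2.
  have [i1 i2] := bump_itv i; have [j1 j2] := bump_itv j.
  by rewrite ler_norml; move: (xc i) (xc j) a a0 i1 i2 j1 j2 => x y b *; apply/andP; split; lra.
have p4 : pi <= 4 :> R by have := @pihalf_lt2 R; move: (pi : R) => p; lra.
rewrite sinc_trig_sum//; last first.
  apply: sin_small_neq0.
    by apply: mulf_neq0 => //; apply: mulf_neq0 => //; rewrite gt_eqF.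
  have pw0 : 0 < pi * sinc_step c m by exact: mulr_gt0.
  rewrite normrM (gtr0_norm pw0).
  apply: le_trans (_ : 4 * (1 / 8) * 2 <= _); last by lra.
  apply: ler_pM => //; first exact: ltW.
  by apply: ler_pM => //; exact: ltW.
have -> : c * (xc i - xc j) = i%:R * pi - j%:R * pi.
  have -> : c * (xc i - xc j) = (i%:R - j%:R) * (2 * (c * a)) by rewrite te; ring.
  by rewrite ca (mulrC 2) divfK// mulrBl.
by rewrite sinB !sin_natpi !mul0r mulr0 subrr mul0r !mulr0.
Qed.

(* Landau's test functions: [K] cosine arches of length [pi / c] with disjoint supports. *)
Lemma landau_lower_bound (b : 'I_K -> R) : let f := \sum_(i < K) b i *: bump1 i in
  1 / 2 * ip f f <= ip (sincL2 c0 f) f.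
Proof.
move=> /=; set f := \sum_(i < K) _; rewrite {1 2}/f (ip_comb2 ipP _ _ bump1_orthonormal) -/f.
have ffE : ip f f = \sum_(i < K) b i * b i by rewrite /f (ip_comb2 ipP _ _ bump1_orthonormal).
apply/ler_addgt0Pr => e e0.
have E0 : 0 < ip f f + 1 by rewrite ltr_wpDl// (ip_ge0 ipP).
have d8 : 0 < 1 / 8 :> R by lra.
have [m [m0 md _ /(_ f) h]] := sinc_form_near c0 d8 (divr_gt0 e0 E0).
have hh : e / (ip f f + 1) * ip f f <= e.
  by rewrite mulrAC ler_pdivrMr// ler_wpM2l ?(ltW e0)// lerDl.
suff : 1 / 2 * \sum_(i < K) b i * b i <= ip (sinc_trig c m f) f.
  move: h => /ler_normlP[h _]; lra.
rewrite sinc_trig_form.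
have w0 := sinc_step_gt0 c0 m0.
pose Sc (l : 'I_m) : R := \sum_(i < K) b i * cos (sinc_freq c l * xc i).
pose Ss (l : 'I_m) : R := \sum_(i < K) b i * sin (sinc_freq c l * xc i).
(* The coefficients of [f] at a frequency are [bump_hat] times a trigonometric sum over the centres.
   The lower bound [a] for [bump_hat] and the normalisation 1/sqrt a leave the factor a^2 / a =
   a. *)
have key (l : 'I_m) : a * (Sc l ^+ 2 + Ss l ^+ 2) <=
    ip f (cosL2 (sinc_freq c l)) ^+ 2 + ip f (sinL2 (sinc_freq c l)) ^+ 2.
  have /andP[l0 lc] := freq_itv l m0.
  have hq := bump_hat_ge l0 lc; set q := bump_hat _ in hq.
  have -> : ip f (cosL2 (sinc_freq c l)) = (Num.sqrt a)^-1 * q * Sc l.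
    rewrite /f (ip_comb ipP) mulr_sumr; apply: eq_bigr => i _.
    rewrite /bump1 (ipZl ipP) bump_cos// -/q.
    by move: (cos _) => C; ring.
  have -> : ip f (sinL2 (sinc_freq c l)) = (Num.sqrt a)^-1 * q * Ss l.
    rewrite /f (ip_comb ipP) mulr_sumr; apply: eq_bigr => i _.
    rewrite /bump1 (ipZl ipP) bump_sin// -/q.
    by move: (sin _) => C; ring.
  rewrite !(exprMn _ (_ * q)) -mulrDr ler_wpM2r ?addr_ge0 ?sqr_ge0//.
  rewrite exprMn expr2 sa mulrC ler_pdivlMr//.
  by rewrite expr2; apply: ler_pM => //; exact: ltW.
apply: le_trans (_ : 2 * sinc_step c m * \sum_(l < m) a * (Sc l ^+ 2 + Ss l ^+ 2) <= _); last first.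
  by apply: ler_wpM2l; [rewrite mulr_ge0// ltW|apply: ler_sum => l _].
have -> : \sum_(l < m) a * (Sc l ^+ 2 + Ss l ^+ 2) =
   a * \sum_(i < K) \sum_(j < K) b i * b j * \sum_(l < m) cos (sinc_freq c l * (xc i - xc j)).
  rewrite -mulr_sumr; congr (_ * _).
  under [RHS]eq_bigr => i _ do (under eq_bigr => j _ do rewrite mulr_sumr; rewrite exchange_big).
  rewrite exchange_big/=; apply: eq_bigr => l _.
  rewrite /Sc /Ss !sum_sq -big_split/=; apply: eq_bigr => i _.
  rewrite -big_split/=; apply: eq_bigr => j _.
  rewrite mulrBr cosB; move: (cos _) (sin _) (cos _) (sin _) => C S C' S'; ring.
rewrite mulrCA.
have -> : 2 * sinc_step c m * (\sum_(i < K) \sum_(j < K) b i * b j *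
      \sum_(l < m) cos (sinc_freq c l * (xc i - xc j))) = c / pi * \sum_(i < K) b i * b i.
  rewrite [LHS]mulr_sumr [RHS]mulr_sumr; apply: eq_bigr => i _.
  rewrite mulr_sumr (bigD1 i)//= mulrCA bump_kernel// eqxx mulr1 big1.
    by rewrite addr0 mulrC.
  move=> j ji; by rewrite mulrCA bump_kernel// eq_sym (negPf ji) !mulr0.
(* By [bump_kernel] only the diagonal has survived; the constant a c / pi in front of it is exactly
   1/2. *)
rewrite mulrA ler_wpM2r//; first by apply: sumr_ge0 => i _; rewrite -expr2 sqr_ge0.
rewrite /a; have p0 := pi_gt0 R; move: (pi : R) c0 p0 => p cp p0.
by rewrite le_eqVlt; apply/orP; left; apply/eqP; field; rewrite !gt_eqF.
Qed.

End Landau.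

(** Landau's arches for c = pi (n + 1): each has length 1 / (n + 1), so [n] of them fit in (-1,
    1). *)
Lemma L2_infinite_dim (R : realType) n : exists e : 'I_n -> LfunType (@mu11 R) (lee1n 2),
  orthonormal_fam (@ip2 R) e.
Proof.
have p0 := pi_gt0 R.
have c0 : 0 < pi * (n%:R + 1) :> R by rewrite mulr_gt0// ltr_wpDl.
have hK : n%:R * (pi / (pi * (n%:R + 1))) <= 2 :> R.
  have n0 : 0 <= n%:R :> R by [].
  move: (n%:R : R) (pi : R) p0 n0 => x p p0 x0.
  have -> : p / (p * (x + 1)) = (x + 1)^-1 by field; apply/andP; split; rewrite gt_eqF//; lra.
  by rewrite ler_pdivrMr; lra.
by exists (@bump1 R (pi * (n%:R + 1)) n); exact: (bump1_orthonormal c0 hK).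
Qed.

(** * The sum of lam (1 - lam) *)

Section Intervals.
Variable R : realType.
Notation leb := (@lebesgue_measure R).

Lemma continuous_sum_ord n (F : 'I_n -> R -> R) : (forall i, continuous (F i)) ->
  continuous (fun x : R => \sum_(i < n) F i x).
Proof.
elim: n F => [|n IH] F cF.
  have -> : (fun x : R => \sum_(i < 0) F i x) = cst 0 by apply/funext => x; rewrite big_ord0.
  by move=> x; exact: cvg_cst.
have -> : (fun x : R => \sum_(i < n.+1) F i x) =
    (fun x => \sum_(i < n) F (widen_ord (leqnSn n) i) x + F ord_max x).
  by apply/funext => x; rewrite big_ord_recr.
by move=> x; apply: cvgD; [exact: (IH (fun i => F (widen_ord _ i)))|exact: cF].
Qed.

Lemma Rint_sum n (F : 'I_n -> R -> R) (a b : R) : (forall i, continuous (F i)) ->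
  \int[leb]_(x in `[a, b]) (\sum_(i < n) F i x) = \sum_(i < n) \int[leb]_(x in `[a, b]) F i x.
Proof.
elim: n F => [|n IH] F cF.
  rewrite big_ord0; under eq_Rintegral do rewrite big_ord0.
  by rewrite Rintegral_cst ?mul0r.
rewrite big_ord_recr/= -IH// -RintegralD//.
- by apply: eq_Rintegral => x _; rewrite big_ord_recr.
- apply: continuous_integrable_itv; apply: continuous_sum_ord => i; exact: cF.
- exact: continuous_integrable_itv.
Qed.

Lemma Rint_split (F : R -> R) (a b d : R) : continuous F -> a <= b -> b <= d ->
  \int[leb]_(x in `[a, d]) F x = \int[leb]_(x in `[a, b]) F x + \int[leb]_(x in `[b, d]) F x.
Proof.
move=> cF ab bd; rewrite -[X in _ + X]Rintegral_itv_obnd_cbnd; last first.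
  by apply: integrableS (continuous_integrable_itv b d cF) => //; exact: subset_itv_oc_cc.
have h := @Rintegral_itvB _ F (BLeft a) (BRight d) b (continuous_integrable_itv a d cF).
by rewrite -h ?bnd_simp// addrC subrK.
Qed.

Lemma Rint_le_FTC (D F G : R -> R) (a b : R) : a <= b -> continuous D ->
  (forall x : R, a <= x <= b -> D x <= F x) ->
  (forall x : R, a <= x <= b -> {for x, continuous F}) ->
  (forall x : R, a <= x <= b -> is_derive x 1 G (F x)) ->
  \int[leb]_(x in `[a, b]) D x <= G b - G a.
Proof.
move=> ab cD DF cF dG; have [iF <-] := Rint_FTC_on ab cF dG.
apply: le_Rintegral => //; exact: continuous_integrable_itv.
Qed.

Lemma Rint_ge0_le (F : R -> R) (a b a' b' : R) : continuous F -> (forall x, 0 <= F x) ->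
  a' <= a -> a <= b -> b <= b' ->
  \int[leb]_(x in `[a, b]) F x <= \int[leb]_(x in `[a', b']) F x.
Proof.
move=> cF F0 aa ab bb.
rewrite (Rint_split cF aa (le_trans ab bb)) (Rint_split cF ab bb).
by rewrite addrCA lerDl; apply: addr_ge0; exact: Rintegral_ge0.
Qed.

End Intervals.

(** * Orthogonality of odd frequencies over a period *)

Section Parseval.
Variable R : realType.
Notation leb := (@lebesgue_measure R).
Variables (m : nat) (v : R).
Hypothesis v0 : 0 < v.
Let ell := pi / (2 * v).
Let ell0 : 0 < ell. Proof. by rewrite divr_gt0 ?pi_gt0// mulr_gt0. Qed.
Let om (j : 'I_m) : R := (2 * j%:R + 1) * v.

Definition trig_poly (be ga : 'I_m -> R) (z : R) : R :=
  \sum_(j < m) (be j * cos (om j * z) + ga j * sin (om j * z)).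

Let cterm (p q k : R) : continuous (fun z : R => p * cos (k * z) + q * sin (k * z)).
Proof.
have cl : continuous (fun z : R => k * z) by move=> z; apply: cvgM; [exact: cvg_cst|exact: cvg_id].
move=> z; apply: cvgD; (apply: cvgM; first exact: cvg_cst); apply: continuous_comp.
- exact: cl.
- exact: continuous_cos.
- exact: cl.
- exact: continuous_sin.
Qed.

Lemma trig_poly_continuous be ga : continuous (trig_poly be ga).
Proof. by apply: continuous_sum_ord => j; exact: cterm. Qed.

(* The frequencies [k] below are even multiples of [v], so that [sin (k * ell) = 0]. *)
Let harmonic_int (p q : R) k : k != 0 -> sin (k * ell) = 0 ->
  \int[leb]_(z in `[- ell, ell]) (p * cos (k * z) + q * sin (k * z)) = 0.
Proof.
move=> k0 sk; pose G z := p * (sin (k * (z - 0)) / k) + q * (- cos (k * (z - 0)) / k).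
have ll : - ell <= ell by move: ell ell0 => l l0; lra.
have dG (x : R) : is_derive x 1 G (p * cos (k * x) + q * sin (k * x)).
  have h1 := is_derive_shift_sin 0 x k0; have h2 := is_derive_shift_cos 0 x k0.
  by rewrite /G; apply: is_derive_eq; rewrite /GRing.scale/= subr0; lra.
by rewrite (Rint_FTC ll (@cterm p q k) dG) /G !subr0 mulrN sinN cosN sk; ring.
Qed.

Let sin_even n : sin (2 * n%:R * v * ell) = 0.
Proof.
have -> : 2 * n%:R * v * ell = n%:R * pi.
  by rewrite /ell; move: (pi : R) (n%:R : R) v0 => p k vp; field; rewrite gt_eqF.
exact: sin_natpi.
Qed.

Let term_int j l (b g b' g' : R) :
  \int[leb]_(z in `[- ell, ell]) ((b * cos (om j * z) + g * sin (om j * z)) *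
     (b' * cos (om l * z) + g' * sin (om l * z))) = ell * (b * b' + g * g') * (j == l)%:R.
Proof.
pose S1 z := (b * b' - g * g') / 2 * cos ((om j + om l) * z) + (b * g' + g * b') / 2 * sin ((om j + om l) * z).
pose S2 z := (b * b' + g * g') / 2 * cos ((om j - om l) * z) + (g * b' - b * g') / 2 * sin ((om j - om l) * z).
have -> : \int[leb]_(z in `[- ell, ell]) ((b * cos (om j * z) + g * sin (om j * z)) *
     (b' * cos (om l * z) + g' * sin (om l * z))) = \int[leb]_(z in `[- ell, ell]) (S1 z + S2 z).
  apply: eq_Rintegral => z _; rewrite /S1 /S2 (mulrDl (om j)) (mulrBl _ (om j)).
  rewrite cosD cosB sinD sinB.
  by move: (cos _) (sin _) (cos _) (sin _) => C S C' S'; lra.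
rewrite RintegralD//; try by apply: continuous_integrable_itv; exact: cterm.
have omE : om j + om l = 2 * (j + l + 1)%:R * v by rewrite /om !natrD; ring.
rewrite [X in X + _]harmonic_int ?add0r; last 2 first.
- by rewrite omE !mulf_neq0 ?gt_eqF//; rewrite pnatr_eq0 addn1.
- by rewrite omE sin_even.
have [jl|jl] := eqVneq j l.
  have S2E z : S2 z = (b * b' + g * g') / 2.
    by rewrite /S2 jl subrr mul0r cos0 sin0 mulr0 addr0 mulr1.
  under eq_Rintegral do rewrite S2E.
  rewrite Rintegral_cst//= lebesgue_measure_itv/= lte_fin.
  by rewrite ifT /=; [move: ell ell0 => L L0; lra|move: ell ell0 => L L0; lra].
rewrite mulr0; apply: harmonic_int.
  rewrite subr_eq0; apply: contra jl => /eqP; rewrite /om => /(mulIf (lt0r_neq0 v0)) /addIr.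
  by move=> /mulfI; rewrite pnatr_eq0 => /(_ isT) /eqP; rewrite eqr_nat => /eqP /val_inj ->.
have [jl'|lj|/val_inj e] := ltngtP (j : nat) l; last by rewrite e eqxx in jl.
- have -> : (om j - om l) * ell = - (2 * (l - j)%:R * v * ell).
    by rewrite /om natrB ?(ltnW jl')//; ring.
  by rewrite sinN sin_even oppr0.
- have -> : (om j - om l) * ell = 2 * (j - l)%:R * v * ell.
    by rewrite /om natrB ?(ltnW lj)//; ring.
  exact: sin_even.
Qed.

Lemma trig_parseval be ga : \int[leb]_(z in `[- ell, ell]) trig_poly be ga z ^+ 2 =
  ell * \sum_(j < m) (be j ^+ 2 + ga j ^+ 2).
Proof.
under eq_Rintegral => z _.
  rewrite expr2 {1}/trig_poly mulr_suml.
  under eq_bigr => j _ do rewrite /trig_poly mulr_sumr.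
  over.
rewrite Rint_sum; last first.
  move=> j; apply: continuous_sum_ord => l.
  by move=> z; apply: cvgM; exact: cterm.
rewrite mulr_sumr; apply: eq_bigr => j _.
rewrite Rint_sum; last by move=> l z; apply: cvgM; exact: cterm.
rewrite (bigD1 j)//= term_int eqxx mulr1 -!expr2 big1 ?addr0// => l lj.
by rewrite term_int eq_sym (negPf lj) mulr0.
Qed.

End Parseval.

(** * Energy of the midpoint sums outside [-1, 1] *)

Section Plunge.
Variable R : realType.
Notation leb := (@lebesgue_measure R).
Notation mu := (@mu11 R).
Notation L2 := (LfunType mu (lee1n 2)).
Notation ip := (@ip2 R).
Implicit Types (f g h : L2).
Let ipP := ip2_semi R.

Lemma csc_le (u eta : R) : 0 < u -> u <= 1 -> u ^+ 2 / 5 <= eta -> `|(sin u)^-1| <= (1 + eta) / u.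
Proof.
move=> u0 u1 ue; have := @csc_approx R u (lt0r_neq0 u0); rewrite gtr0_norm// => /(_ u1).
move=> /ler_normlP[h1 h2]; have s0 : 0 < sin u.
  by apply: sin_gt0_pi; rewrite u0 (le_lt_trans u1)// (lt_le_trans _ (pi_ge2 R))// ltr1n.
rewrite gtr0_norm ?invr_gt0//.
have h3 : (sin u)^-1 <= u^-1 + u / 5.
  have : u ^+ 3 <= u by rewrite exprS ler_piMr ?(ltW u0)// exprn_ile1 ?(ltW u0).
  by move: h1 h2; move: (u^-1) ((sin u)^-1) => a b; lra.
apply: le_trans h3 _; rewrite mulrDl mul1r lerD2l ler_pdivlMr//.
by apply: le_trans ue; rewrite expr2 mulrAC.
Qed.

Lemma csc_le3 (u : R) : 0 < u -> u <= 2 -> `|(sin u)^-1| <= 3 / u.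
Proof.
move=> u0 u2; have h := sin_ge (ltW u0).
have h2 : u * u ^+ 2 <= u * 2 ^+ 2 by rewrite ler_wpM2l ?(ltW u0)// lerXn2r ?nnegrE ?(ltW u0).
have h3 : u / 3 <= sin u by move: h h2; rewrite (exprS u 2); lra.
have s0 : 0 < sin u by apply: lt_le_trans h3; rewrite divr_gt0.
rewrite gtr0_norm ?invr_gt0// -(invf_div u 3) lef_pV2 ?posrE// divr_gt0//.
Qed.

Variables (c : R) (m : nat).
Hypothesis c0 : 0 < c.
Hypothesis m0 : (0 < m)%N.
Let w := sinc_step c m.
Let w0 : 0 < w. Proof. exact: sinc_step_gt0. Qed.
Let ell := pi / (2 * (pi * w)).
Notation T := (sinc_trig c m).
Let om := @sinc_freq R c m.
Let v0 : 0 < pi * w. Proof. by rewrite mulr_gt0// pi_gt0. Qed.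

Let wl : 2 * w * ell = 1.
Proof.
rewrite /ell; have p0 := pi_gt0 R; move: (pi : R) w w0 p0 => p x x0 p0.
by field; rewrite !gt_eqF.
Qed.

Let poly f : R -> R := trig_poly (pi * w)
  (fun j => ip f (cosL2 (om j))) (fun j => ip f (sinL2 (om j))).

Lemma sinc_trigE f z : T f z = 2 * w * poly f z.
Proof. by rewrite /sinc_trig trig_opE. Qed.

Lemma sinc_trig_continuous f : continuous (T f : R -> R).
Proof.
have -> : (T f : R -> R) = (fun z => 2 * w * poly f z) by apply/funext => z; exact: sinc_trigE.
by move=> z; apply: cvgM; [exact: cvg_cst|exact: trig_poly_continuous].
Qed.

Let sq_continuous (F : R -> R) : continuous F -> continuous (fun z => F z ^+ 2).
Proof.
move=> cF; have -> : (fun z => F z ^+ 2) = (fun z => F z * F z) by apply/funext => z; rewrite expr2.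
by move=> z; apply: cvgM; exact: cF.
Qed.

Let Rint_scale (k : R) (F : R -> R) (a b : R) : continuous F ->
  \int[leb]_(z in `[a, b]) (k * F z) = k * \int[leb]_(z in `[a, b]) F z.
Proof. by move=> cF; rewrite RintegralZl//; exact: continuous_integrable_itv. Qed.

(** Parseval on [-ell, ell], where the identity 2 w ell = 1 removes one factor 2 w. *)
Lemma form_period f : ip (T f) f = \int[leb]_(z in `[- ell, ell]) T f z ^+ 2.
Proof.
under eq_Rintegral => z _ do rewrite sinc_trigE exprMn.
rewrite Rint_scale; last by apply: sq_continuous; exact: trig_poly_continuous.
rewrite trig_parseval// sinc_trig_form -/w -/ell.
by rewrite mulrA; congr (_ * _); rewrite expr2 -mulrA wl mulr1.
Qed.

Lemma norm_core f : ip (T f) (T f) = \int[leb]_(z in `[-1, 1]) T f z ^+ 2.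
Proof.
rewrite /ip2 /inner mu11_Rint; first by apply: eq_Rintegral => z _; rewrite expr2.
by apply: measurable_funM; exact: L2_mfun.
Qed.

Hypothesis ell2 : 2 <= ell.

(** For a unit eigenvector of eigenvalue lam the left-hand side is lam (1 - lam), which thus becomes
    an energy that can be estimated pointwise. *)
Lemma form_outside f : ip (T f) f - ip (T f) (T f) =
  \int[leb]_(z in `[1, ell]) T f z ^+ 2 + \int[leb]_(z in `[1, ell]) T f (- z) ^+ 2.
Proof.
have cT := sq_continuous (@sinc_trig_continuous f).
have l4 : 1 <= ell by apply: le_trans ell2; rewrite ler1n.
rewrite form_period norm_core.
have -> : \int[leb]_(z in `[1, ell]) T f (- z) ^+ 2 = \int[leb]_(z in `[- ell, -1]) T f z ^+ 2.
  rewrite /Rintegral [in RHS]integration_by_substitution_oppr//.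
  exact: continuous_subspaceT.
have l1 : - ell <= -1 by rewrite lerN2.
have l3 : (-1 : R) <= 1 by lra.
have l2 : -1 <= ell by exact: le_trans l4.
rewrite (Rint_split cT l1 l2) (Rint_split cT l3 l4).
by rewrite addrCA [X in X - _]addrC addrK addrC.
Qed.

Lemma norm_le_form f : ip (T f) (T f) <= ip (T f) f.
Proof.
rewrite -subr_ge0 form_outside.
by apply: addr_ge0; apply: Rintegral_ge0 => z _; exact: sqr_ge0.
Qed.

(** (T f, f)^2 <= |T f|^2 |f|^2 <= (T f, f) |f|^2, by Cauchy-Schwarz and [norm_le_form]. *)
Lemma form_le1 f : ip (T f) f <= ip f f.
Proof.
have h := norm_le_form f; have := cauchy_schwarz ipP (T f) f; have f0 := ip_ge0 ipP f.
have TP := trig_op_positive om (_ : 0 <= 2 * w); have t0 : 0 <= ip (T f) f.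
  by apply: (op_ge0 (TP _)); rewrite mulr_ge0// ltW.
move=> cs; have := le_trans cs (ler_wpM2r f0 h).
have [->|tn] := eqVneq (ip (T f) f) 0; first by [].
by rewrite expr2 ler_pM2l// lt_neqAle eq_sym tn.
Qed.

Let Kz z : L2 := trig_kernel om (2 * w) z.
(** By Bessel's inequality this dominates the sum of the squares of T psi(z) over any orthonormal
    family. Its integral over 1 <= |z| <= ell has to be of size log c. *)
Definition energy z : R := ip (Kz z) (Kz z).

Lemma energy_bessel K (psi : 'I_K -> L2) z : orthonormal_fam ip psi ->
  \sum_(k < K) T (psi k) z ^+ 2 <= energy z.
Proof.
move=> on; apply: le_trans (bessel ipP (Kz z) on); apply: ler_sum => k _.
by rewrite /sinc_trig trig_op_kernel (ipC ipP).
Qed.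

Lemma energyE z : energy z =
  2 * w * \sum_(j < m) (T (cosL2 (om j)) z * cos (om j * z) + T (sinL2 (om j)) z * sin (om j * z)).
Proof.
rewrite /energy -trig_op_kernel trig_opE; congr (_ * _); apply: eq_bigr => j _.
by rewrite ![ip (Kz z) _](ipC ipP) -!trig_op_kernel.
Qed.

Let lin_continuous (k : R) : continuous (fun z : R => k * z).
Proof. by move=> z; apply: cvgM; [exact: cvg_cst|exact: cvg_id]. Qed.

Lemma energy_continuous : continuous energy.
Proof.
have -> : energy = (fun z => 2 * w * \sum_(j < m) (T (cosL2 (om j)) z * cos (om j * z)
    + T (sinL2 (om j)) z * sin (om j * z))) by apply/funext => z; exact: energyE.
move=> z; apply: cvgM; first exact: cvg_cst.
apply: (@continuous_sum_ord R m (fun j z => T (cosL2 (om j)) z * cos (om j * z)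
    + T (sinL2 (om j)) z * sin (om j * z))) => j {}z.
apply: cvgD; apply: cvgM.
- exact: sinc_trig_continuous.
- by apply: continuous_comp; [exact: lin_continuous|exact: continuous_cos].
- exact: sinc_trig_continuous.
- by apply: continuous_comp; [exact: lin_continuous|exact: continuous_sin].
Qed.

(** Enlarging the domain from [-1, 1] to [-ell, ell], Parseval gives (2 w)^2 ell m = 2 w m = c /
    pi. *)
Lemma energy_le z : energy z <= c / pi.
Proof.
pose q : R -> R := trig_poly (pi * w) (fun j => cos (om j * z)) (fun j => sin (om j * z)).
have KE x : Kz z x = 2 * w * q x.
  rewrite /Kz /trig_kernel.
  rewrite -[LHS]/(2 * w * (\sum_(j < m) (cos (om j * z) *: cosL2 (om j) + sin (om j * z) *: sinL2 (om j)) : L2) x).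
  by rewrite L2_sumE.
have cq : continuous (fun x => q x ^+ 2) by apply: sq_continuous; exact: trig_poly_continuous.
have -> : energy z = (2 * w) ^+ 2 * \int[leb]_(x in `[-1, 1]) q x ^+ 2.
  rewrite /energy /ip2 /inner mu11_Rint; last by apply: measurable_funM; exact: L2_mfun.
  by rewrite -Rint_scale//; apply: eq_Rintegral => x _; rewrite KE -exprMn expr2.
have q0 x : 0 <= q x ^+ 2 by exact: sqr_ge0.
apply: le_trans (_ : (2 * w) ^+ 2 * \int[leb]_(x in `[- ell, ell]) q x ^+ 2 <= _).
  have l4 : 1 <= ell by apply: le_trans ell2; rewrite ler1n.
  have l1 : - ell <= -1 by rewrite lerN2.
  have l3 : (-1 : R) <= 1 by lra.
  by rewrite ler_wpM2l ?sqr_ge0//; exact: (Rint_ge0_le cq q0 l1 l3 l4).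
rewrite trig_parseval// -/ell mulrA expr2 -(mulrA (2 * w)) wl mulr1.
under eq_bigr do rewrite cos2Dsin2.
rewrite sumr_const card_ord -[1 *+ m]/(m%:R).
have pn : pi != 0 :> R by rewrite gt_eqF// pi_gt0.
rewrite le_eqVlt; apply/orP; left; apply/eqP; apply: (mulIf pn); rewrite divfK//.
by rewrite -[RHS](sinc_stepM c m0) -/w; move: (pi : R) w => p x; ring.
Qed.

(* [s * y], with [s] a sign, is the point outside [-1, 1]; then [t = y - s * x] is |s y - x|. *)
Lemma kernel_value (s y x : R) : s = 1 \/ s = -1 -> sin (pi * w * (y - s * x)) != 0 ->
  Kz (s * y) x = w * (sin (c * (y - s * x)) / sin (pi * w * (y - s * x))).
Proof.
move=> s1 sn; rewrite /Kz trig_kernelE.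
have -> : \sum_(j < m) cos (om j * (s * y - x)) = \sum_(j < m) cos (om j * (y - s * x)).
  apply: eq_bigr => j _; case: s1 => ->; first by rewrite !mul1r.
  by rewrite !mulN1r opprK -opprD mulrN cosN.
exact: sinc_trig_sum.
Qed.

Section Bounds.
Variable eta : R.
Hypothesis eta0 : 0 < eta.
Hypothesis w_small : 3 * (pi * w) <= 1.
Hypothesis w_eta : (3 * (pi * w)) ^+ 2 / 5 <= eta.
Hypothesis w_far : pi * w * (ell + 1) <= 2.

(** For t <= 3 the argument pi w t is at most 1, so the cosecant costs only a factor 1 + eta over
    the sinc kernel. *)
Lemma kernel_near (s y x : R) : s = 1 \/ s = -1 -> 0 < y - s * x -> y - s * x <= 3 ->
  Kz (s * y) x ^+ 2 <= ((1 + eta) / pi) ^+ 2 * (sin (c * (y - s * x)) ^+ 2 / (y - s * x) ^+ 2).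
Proof.
move=> s1; move: (kernel_value (y := y) (x := x) s1); set t := y - s * x => kv t0 t3.
have u0 : 0 < pi * w * t by rewrite mulr_gt0.
have u1 : pi * w * t <= 3 * (pi * w) by rewrite mulrC ler_wpM2r// ltW.
have p0 := pi_gt0 R.
have s0 : 0 < sin (pi * w * t).
  apply: sin_gt0_pi; rewrite u0 (le_lt_trans (le_trans u1 w_small))//.
  by rewrite (lt_le_trans _ (pi_ge2 R))// ltr1n.
rewrite kv ?lt0r_neq0// mulrCA exprMn -[X in _ <= _ * X]expr_div_n.
have h : `|(sin (pi * w * t))^-1| <= (1 + eta) / (pi * w * t).
  apply: csc_le => //; first exact: le_trans w_small.
  apply: le_trans w_eta; rewrite ler_wpM2r ?invr_ge0//.
  apply: lerXn2r u1; rewrite nnegrE; first exact: ltW.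
  by apply: mulr_ge0 => //; exact: ltW.
have h2 : (w * (sin (pi * w * t))^-1) ^+ 2 <= ((1 + eta) / (pi * t)) ^+ 2.
  rewrite -(ger0_norm (sqr_ge0 (w * _))) normrX; apply: lerXn2r; rewrite ?nnegrE//.
    by rewrite divr_ge0 ?addr_ge0 ?(ltW eta0)// mulr_ge0// ltW.
  rewrite normrM (gtr0_norm w0); apply: le_trans (ler_wpM2l (ltW w0) h) _.
  rewrite le_eqVlt; apply/orP; left; apply/eqP.
  by move: (pi : R) p0 => p p0; field; rewrite !gt_eqF.
apply: le_trans (ler_wpM2l (sqr_ge0 _) h2) _.
rewrite le_eqVlt; apply/orP; left; apply/eqP.
by move: (pi : R) p0 (sin _) => p p0 S; field; rewrite !gt_eqF.
Qed.

(** Even at t = ell + 1 the argument pi w t is at most 2, safely below pi, so the cruder cosecant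
    bound [csc_le3] applies. *)
Lemma kernel_far (s y x : R) : s = 1 \/ s = -1 -> -1 < x < 1 -> 2 <= y -> y <= ell ->
  `|Kz (s * y) x| <= 3 / pi / (y - 1).
Proof.
move=> s1 /andP[x1 x2] y2 yl; move: (kernel_value (y := y) (x := x) s1).
have : y - 1 <= y - s * x <= ell + 1 by case: s1 => ->; apply/andP; split; lra.
set t := y - s * x => /andP[t1 tl] kv.
have t0 : 0 < t by apply: lt_le_trans t1; lra.
have u0 : 0 < pi * w * t by rewrite mulr_gt0.
have u2 : pi * w * t <= 2 by apply: le_trans w_far; rewrite ler_wpM2l// ltW.
have p0 := pi_gt0 R.
have h := csc_le3 u0 u2.
have sn : sin (pi * w * t) != 0.
  by apply/eqP => e; move: (sin_ge (ltW u0)); rewrite e; have : (pi * w * t) * (pi * w * t) ^+ 2 <= (pi * w * t) * 2 ^+ 2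
    by [rewrite ler_wpM2l ?(ltW u0)// lerXn2r ?nnegrE ?(ltW u0)]; move: (pi * w * t) u0 => u u0; rewrite -exprS; lra.
rewrite kv// mulrCA normrM normrM (gtr0_norm w0).
apply: le_trans (_ : 1 * (w * (3 / (pi * w * t))) <= _).
  apply: ler_pM => //; [by rewrite mulr_ge0// ltW|by rewrite ler_norml sin_geN1 sin_le1|].
  by rewrite ler_wpM2l// ltW.
have -> : 1 * (w * (3 / (pi * w * t))) = 3 / pi / t.
  by move: (pi : R) p0 => p p0; field; rewrite !gt_eqF.
have p3 : 0 <= 3 / pi :> R by rewrite divr_ge0// ltW.
rewrite ler_wpM2l// lef_pV2 ?posrE//; lra.
Qed.

Lemma energy_far (s y : R) : s = 1 \/ s = -1 -> 2 <= y -> y <= ell ->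
  energy (s * y) <= 18 / pi ^+ 2 / (y - 1) ^+ 2.
Proof.
move=> s1 y2 yl; apply: le_trans (ip2_cst (M := 3 / pi / (y - 1)) _) _.
  by move=> x xI; exact: kernel_far.
rewrite le_eqVlt; apply/orP; left; apply/eqP.
have y1 : y - 1 != 0 by rewrite gt_eqF//; lra.
have p0 : pi != 0 :> R by rewrite gt_eqF// pi_gt0.
by move: (pi : R) p0 => p p0; field; rewrite p0 y1.
Qed.

(** [phi] exceeds sin(c t)^2 / t^2 by a nonnegative term chosen so that it has the elementary
    antiderivative [Phi]. *)
Let Phi (t : R) : R := - (1 / (2 * t)) - (sin (2 * c * t) + 1) / (4 * c * t ^+ 2).
Let phi (t : R) : R := sin (c * t) ^+ 2 / t ^+ 2 + (1 + sin (2 * c * t)) / (2 * c * t ^+ 3).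

Let cos2 x : cos (2 * c * x) = 1 - 2 * sin (c * x) ^+ 2.
Proof.
have -> : 2 * c * x = c * x + c * x by ring.
rewrite cosD; have := cos2Dsin2 (c * x); move: (cos _) (sin _) => C S; rewrite !expr2; lra.
Qed.

Let d_Phi (s y x : R) : s = 1 \/ s = -1 -> 0 < y - s * x ->
  is_derive x 1 (fun x => - s * Phi (y - s * x)) (phi (y - s * x)).
Proof.
move=> s1; set t := y - s * x => t0.
have t2 : 2 * (y - s * x) != 0 by rewrite mulf_neq0 ?gt_eqF.
have t4 : 4 * c * (y - s * x) ^+ 2 != 0 by rewrite !mulf_neq0 ?expf_neq0 ?gt_eqF.
rewrite /Phi; apply: is_derive_eq; rewrite /GRing.scale/= -/t /phi cos2.
have cn : c != 0 by rewrite gt_eqF.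
have tn : t != 0 by rewrite gt_eqF.
move: (sin (c * t)) (sin (2 * c * t)) => S S2.
by case: s1 => ->; field; rewrite cn tn.
Qed.

Let phi_continuous (s y x : R) : 0 < y - s * x -> {for x, continuous (fun x => phi (y - s * x))}.
Proof.
move=> t0; apply: (continuous_comp (f := fun x => y - s * x) (g := phi)).
  by apply: cvgB; [exact: cvg_cst|exact: lin_continuous].
move: (y - s * x) t0 => t t0; have tn : t != 0 by rewrite gt_eqF.
have cs k : {for t, continuous (fun t : R => sin (k * t))}.
  by apply: continuous_comp; [exact: lin_continuous|exact: continuous_sin].
have cX n : {for t, continuous (fun t : R => t ^+ n)} by exact: exprn_continuous.
apply: cvgD; apply: cvgM.
- by apply: (continuous_comp (f := fun t : R => sin (c * t)) (g := fun z : R => z ^+ 2));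
    [exact: cs|exact: exprn_continuous].
- by apply: cvgV; [rewrite expf_neq0|exact: cX].
- by apply: cvgD; [exact: cvg_cst|exact: cs].
- apply: cvgV; first by rewrite !mulf_neq0 ?expf_neq0// gt_eqF.
  by apply: cvgM; [exact: cvg_cst|exact: cX].
Qed.

Let Kz_continuous z : continuous (Kz z : R -> R).
Proof.
have -> : (Kz z : R -> R) = (fun x => 2 * w * trig_poly (pi * w) (fun j => cos (om j * z))
    (fun j => sin (om j * z)) x).
  apply/funext => x; rewrite /Kz /trig_kernel.
  rewrite -[LHS]/(2 * w * (\sum_(j < m) (cos (om j * z) *: cosL2 (om j) + sin (om j * z) *: sinL2 (om j)) : L2) x).
  by rewrite L2_sumE.
by move=> x; apply: cvgM; [exact: cvg_cst|exact: trig_poly_continuous].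
Qed.

(** [kernel_near] is integrated through [Phi]. Since Phi(y + 1) <= 0, only the endpoint at distance
    y - 1 contributes, and there sin + 1 <= 2. *)
Lemma energy_near (s y : R) : s = 1 \/ s = -1 -> 1 < y -> y <= 2 ->
  energy (s * y) <= ((1 + eta) / pi) ^+ 2 * (1 / (2 * (y - 1)) + 1 / (2 * c * (y - 1) ^+ 2)).
Proof.
move=> s1 y1 y2; set kap := ((1 + eta) / pi) ^+ 2.
have kap0 : 0 <= kap by exact: sqr_ge0.
have tp (x : R) : -1 <= x <= 1 -> 0 < y - s * x /\ y - s * x <= 3.
  by move=> /andP[x1 x2]; case: s1 => ->; split; lra.
rewrite /energy /ip2 /inner mu11_Rint; last by apply: measurable_funM; exact: L2_mfun.
have -> : \int[leb]_(x in `[-1, 1]) (Kz (s * y) x * Kz (s * y) x) =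
    \int[leb]_(x in `[-1, 1]) Kz (s * y) x ^+ 2.
  by apply: eq_Rintegral => x _; rewrite expr2.
have l3 : (-1 : R) <= 1 by lra.
have dF (x : R) : -1 <= x <= 1 ->
    is_derive x 1 (fun x => kap * (- s * Phi (y - s * x))) (kap * phi (y - s * x)).
  by move=> /tp [t0 _]; have h := d_Phi s1 t0; apply: is_derive_eq; rewrite /GRing.scale/=; lra.
apply: le_trans (Rint_le_FTC (F := fun x => kap * phi (y - s * x)) l3
  (sq_continuous (@Kz_continuous (s * y))) _ _ dF) _.
- move=> x /tp [t0 t3]; apply: le_trans (kernel_near s1 t0 t3) _; rewrite ler_wpM2l//.
  rewrite /phi lerDl; apply: divr_ge0; first by rewrite -lerBlDl sub0r sin_geN1.
  by apply: mulr_ge0; [rewrite mulr_ge0// ltW|rewrite exprn_ge0// ltW].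
- by move=> x /tp [t0 _]; apply: cvgM; [exact: cvg_cst|exact: phi_continuous].
rewrite -mulrBr ler_wpM2l//.
have -> : - s * Phi (y - s * 1) - - s * Phi (y - s * -1) = Phi (y + 1) - Phi (y - 1).
  case: s1 => ->.
    by rewrite !mul1r !mulN1r !opprK addrC.
  by rewrite opprK !mul1r !mulN1r !opprK.
have q0 : 0 < y - 1 by lra.
have h1 : Phi (y + 1) <= 0.
  have yp : 0 <= y + 1 by lra.
  have s0 : 0 <= sin (2 * c * (y + 1)) + 1 by rewrite -lerBlDr sub0r sin_geN1.
  rewrite /Phi -opprD oppr_le0; apply: addr_ge0; apply: divr_ge0 => //.
    by rewrite mulr_ge0.
  by apply: mulr_ge0; [rewrite mulr_ge0// ltW|rewrite exprn_ge0].
have h2 : - Phi (y - 1) <= 1 / (2 * (y - 1)) + 1 / (2 * c * (y - 1) ^+ 2).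
  rewrite /Phi opprD !opprK lerD2l.
  have -> : 1 / (2 * c * (y - 1) ^+ 2) = 2 / (4 * c * (y - 1) ^+ 2).
    by move: (y - 1) q0 => q q0; field; rewrite !gt_eqF.
  rewrite ler_wpM2r//.
    rewrite invr_ge0; apply: mulr_ge0; [by rewrite mulr_ge0// ltW|by rewrite exprn_ge0// ltW].
  by have := sin_le1 (2 * c * (y - 1)); lra.
lra.
Qed.

Hypothesis c1 : 1 <= c.

(** Three ranges: on [1, 1 + 1/c] the uniform bound contributes 1 / pi; on [1 + 1/c, 2] the term 1 /
    (2 (y - 1)) produces half of ln c; beyond 2 the quadratic decay contributes a constant. *)
Lemma energy_side (s : R) : s = 1 \/ s = -1 ->
  \int[leb]_(y in `[1, ell]) energy (s * y) <=
  1 / pi + ((1 + eta) / pi) ^+ 2 * ((ln c + 1) / 2) + 18 / pi ^+ 2.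
Proof.
move=> s1; set kap := ((1 + eta) / pi) ^+ 2.
have kap0 : 0 <= kap by exact: sqr_ge0.
have p0 := pi_gt0 R.
have cE : continuous (fun y => energy (s * y)).
  by move=> y; apply: continuous_comp; [exact: lin_continuous|exact: energy_continuous].
have ci0 : 0 < c^-1 by rewrite invr_gt0.
have ci1 : c^-1 <= 1 by rewrite invf_le1.
have l1 : 1 <= 1 + c^-1 by lra.
have l2 : 1 + c^-1 <= 2 by lra.
rewrite (Rint_split cE (le_trans l1 l2) ell2) (Rint_split cE l1 l2).
apply: lerD; first apply: lerD.
- apply: le_trans (Rint_le_FTC (F := fun=> c / pi) (G := fun y => c / pi * y) l1 cE _ _ _) _.
  + by move=> y _; exact: energy_le.
  + by move=> y _; exact: cvg_cst.
  + by move=> y _; apply: is_derive_eq; rewrite /GRing.scale/=; lra.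
  rewrite le_eqVlt; apply/orP; left; apply/eqP.
  by move: (pi : R) p0 => p p0; field; rewrite !gt_eqF.
- have yp (y : R) : 1 + c^-1 <= y <= 2 -> 0 < y - 1 /\ y <= 2 by move=> /andP[? ?]; split; lra.
  have dG (y : R) : 1 + c^-1 <= y <= 2 -> is_derive y 1
      (fun y => kap * (ln (y - 1) / 2 - (1 / (2 * c)) * (y - 1)^-1))
      (kap * (1 / (2 * (y - 1)) + 1 / (2 * c * (y - 1) ^+ 2))).
    move=> /yp [q0 _].
    have h1 : is_derive (y - 1) 1 (@ln R) (y - 1)^-1 by exact: is_derive1_ln.
    have qn : y - 1 != 0 by rewrite gt_eqF.
    have h2 : is_derive y 1 (fun y : R => ln (y - 1)) ((y - 1)^-1).
      have h : is_derive y 1 (fun y : R => y - 1) 1 by apply: is_derive_eq; rewrite ?subr0.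
      by have := @is_derive1_comp R _ (fun y : R => y - 1) y _ _ h1 h; rewrite mulr1.
    apply: is_derive_eq; rewrite /GRing.scale/=.
    by move: (y - 1) qn c0 => q qn cc; field; rewrite qn gt_eqF.
  apply: le_trans (Rint_le_FTC (F := fun y => kap * (1 / (2 * (y - 1)) + 1 / (2 * c * (y - 1) ^+ 2)))
    l2 cE _ _ dG) _.
  + by move=> y /yp [q0 q2]; apply: energy_near => //; lra.
  + move=> y /yp [q0 _]; have qn : y - 1 != 0 by rewrite gt_eqF.
    have cq : {for y, continuous (fun y : R => y - 1)} by apply: cvgB; [exact: cvg_id|exact: cvg_cst].
    apply: cvgM; first exact: cvg_cst.
    apply: cvgD; apply: cvgM; try exact: cvg_cst.
      by apply: cvgV; [rewrite mulf_neq0|apply: cvgM; [exact: cvg_cst|exact: cq]].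
    apply: cvgV; first by rewrite !mulf_neq0 ?expf_neq0// gt_eqF.
    apply: cvgM; first exact: cvg_cst.
    by apply: (continuous_comp (f := fun y : R => y - 1) (g := fun z : R => z ^+ 2)); [exact: cq|exact: exprn_continuous].
  rewrite -mulrBr ler_wpM2l//.
  have -> : (2 : R) - 1 = 1 by lra.
  have -> : 1 + c^-1 - 1 = c^-1 by rewrite addrC addKr.
  rewrite ln1 lnV ?posrE// invrK invr1.
  have -> : 1 / (2 * c) * c = 1 / 2 by field; rewrite gt_eqF.
  have : 0 <= 1 / (2 * c) by rewrite divr_ge0// mulr_ge0// ltW.
  move: (1 / (2 * c)) (ln c) => a b; lra.
- have yp (y : R) : 2 <= y <= ell -> 0 < y - 1 /\ 2 <= y by move=> /andP[? ?]; split; lra.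
  pose k18 : R := 18 / pi ^+ 2.
  have k180 : 0 <= k18 by rewrite divr_ge0// exprn_ge0// ltW.
  have dG (y : R) : 2 <= y <= ell -> is_derive y 1 (fun y => - k18 * (y - 1)^-1) (k18 / (y - 1) ^+ 2).
    move=> /yp [q0 _]; have qn : y - 1 != 0 by rewrite gt_eqF.
    apply: is_derive_eq; rewrite /GRing.scale/=.
    by move: (y - 1) qn => q qn; field.
  apply: le_trans (Rint_le_FTC (F := fun y => k18 / (y - 1) ^+ 2) ell2 cE _ _ dG) _.
  + by move=> y /andP[q1 q2]; exact: energy_far.
  + move=> y /yp [q0 _]; have qn : y - 1 != 0 by rewrite gt_eqF.
    have cq : {for y, continuous (fun y : R => y - 1)} by apply: cvgB; [exact: cvg_id|exact: cvg_cst].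
    apply: cvgM; first exact: cvg_cst.
    apply: cvgV; first by rewrite expf_neq0.
    by apply: (continuous_comp (f := fun y : R => y - 1) (g := fun z : R => z ^+ 2)); [exact: cq|exact: exprn_continuous].
  have l1' : 0 < ell - 1 by move: ell ell2 => l; lra.
  have : 0 <= k18 * (ell - 1)^-1 by rewrite mulr_ge0// invr_ge0 ltW.
  have -> : (2 : R) - 1 = 1 by lra.
  rewrite invr1 -/k18; move: (k18 * (ell - 1)^-1) (mulNr k18 (ell - 1)^-1) => z ->; lra.
Qed.

Lemma plunge_trig K (psi : 'I_K -> L2) : orthonormal_fam ip psi ->
  \sum_(k < K) (ip (T (psi k)) (psi k) - ip (T (psi k)) (T (psi k))) <=
  2 / pi + ((1 + eta) / pi) ^+ 2 * (ln c + 1) + 36 / pi ^+ 2.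
Proof.
move=> on; under eq_bigr do rewrite form_outside.
have cT f := sq_continuous (@sinc_trig_continuous f).
have cTN f : continuous (fun z => T f (- z) ^+ 2).
  by move=> z; apply: (@continuous_comp _ _ _ (fun z : R => - z) (fun z : R => T f z ^+ 2));
    [exact: opp_continuous|exact: cT].
have e1 := @Rint_sum R K (fun k z => T (psi k) z ^+ 2) 1 ell (fun k => cT (psi k)).
have e2 := @Rint_sum R K (fun k z => T (psi k) (- z) ^+ 2) 1 ell (fun k => cTN (psi k)).
rewrite big_split/= -e1 -e2.
have h1 := @energy_side 1 (or_introl erefl).
have h2 := @energy_side (-1) (or_intror erefl).
have cS (F : 'I_K -> R -> R) : (forall k, continuous (F k)) ->
  leb.-integrable `[1, ell] (EFin \o (fun z => \sum_(k < K) F k z)).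
  by move=> cF; apply: continuous_integrable_itv; exact: continuous_sum_ord.
have cE (s : R) : leb.-integrable `[1, ell] (EFin \o (fun y => energy (s * y))).
  apply: continuous_integrable_itv => y.
  by apply: continuous_comp; [exact: lin_continuous|exact: energy_continuous].
apply: le_trans (lerD (_ : _ <= \int[leb]_(y in `[1, ell]) energy (1 * y))
                      (_ : _ <= \int[leb]_(y in `[1, ell]) energy (-1 * y))) _.
- apply: le_Rintegral => //; first by apply: cS => k; exact: cT.
  by move=> z _; rewrite mul1r; exact: energy_bessel.
- apply: le_Rintegral => //; first by apply: cS => k; exact: cTN.
  by move=> z _; rewrite mulN1r; exact: energy_bessel.
apply: le_trans (lerD h1 h2) _.
by rewrite le_eqVlt; apply/orP; left; apply/eqP; move: (pi : R) (lt0r_neq0 (pi_gt0 R)) (ln c) => p pn L; field.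
Qed.

End Bounds.
End Plunge.

Section PlungeSinc.
Variable R : realType.
Notation mu := (@mu11 R).
Notation L2 := (LfunType mu (lee1n 2)).
Notation ip := (@ip2 R).
Implicit Types (f g h : L2).
Let ipP := ip2_semi R.
Variable c : R.
Hypothesis c0 : 0 < c.
Notation A := (sincL2 c0).
Notation T := (sinc_trig c).

Lemma sinc_period (w : R) : 0 < w -> pi / (2 * (pi * w)) = (2 * w)^-1.
Proof.
move=> w0; have p0 := pi_gt0 R; move: (pi : R) p0 => p p0.
by field; rewrite !gt_eqF.
Qed.

(** The last condition reads pi / 2 + pi w <= 2, which small steps satisfy because pi < 4. *)
Lemma sinc_step_params (eta : R) : 0 < eta -> exists delta, 0 < delta /\
  forall m, (0 < m)%N -> sinc_step c m <= delta ->
    [/\ 2 <= pi / (2 * (pi * sinc_step c m)), 3 * (pi * sinc_step c m) <= 1,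
        (3 * (pi * sinc_step c m)) ^+ 2 / 5 <= eta
      & pi * sinc_step c m * (pi / (2 * (pi * sinc_step c m)) + 1) <= 2].
Proof.
move=> eta0; have p0 := pi_gt0 R; have p2 := @pihalf_lt2 R.
pose d3 : R := (2 - pi / 2) / 4.
have d30 : 0 < d3 by rewrite divr_gt0// subr_gt0.
exists (Num.min (1 / 12) (Num.min (eta / 3) d3)); split.
  by rewrite !lt_min d30 andbT; apply/andP; split; lra.
move=> m m0; have w0 := sinc_step_gt0 c0 m0; rewrite !sinc_period//.
rewrite !le_min => /andP[w1 /andP[w2 w3]].
move: (sinc_step c m) w0 w1 w2 w3 => w w0 w1 w2.
rewrite /d3; move: (pi : R) p0 p2 => p p0 p2 w3.
have pw : p * w <= 4 * w by rewrite ler_wpM2r ?(ltW w0)//; lra.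
have pw0 : 0 < p * w by rewrite mulr_gt0.
split.
- by rewrite -[leLHS]invrK lef_pV2 ?posrE ?invr_gt0 ?mulr_gt0//; lra.
- lra.
- have h : (3 * (p * w)) ^+ 2 <= (12 * w) ^+ 2.
    by apply: lerXn2r; rewrite ?nnegrE; [rewrite mulr_ge0// ltW|rewrite mulr_ge0// ltW|lra].
  have h2 : w * w <= w * (1 / 12) by rewrite ler_wpM2l// ltW.
  by move: h; rewrite [(12 * w) ^+ 2]expr2; lra.
- have -> : p * w * ((2 * w)^-1 + 1) = p / 2 + p * w by field; rewrite gt_eqF.
  lra.
Qed.

Lemma sinc_le1 f : ip (A f) f <= ip f f.
Proof.
apply/ler_addgt0Pr => e e0.
have [delta [d0 hd]] := sinc_step_params ltr01.
have E0 : 0 < ip f f + 1 by rewrite ltr_wpDl// (ip_ge0 ipP).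
have [m [m0 md _ /(_ f) h]] := sinc_form_near c0 d0 (divr_gt0 e0 E0).
have [l2 _ _ _] := hd m m0 md.
have := form_le1 c0 m0 l2 f.
have hh : e / (ip f f + 1) * ip f f <= e.
  by rewrite mulrAC ler_pdivrMr// ler_wpM2l ?(ltW e0)// lerDl.
move: h => /ler_normlP[_]; move: hh.
move: (ip (A f) f) (ip (T m f) f) (ip f f) (e / _ * _) => x y z q; lra.
Qed.

Lemma sinc_eigen_le1 lam f : ip f f = 1 -> eigen ip A lam f -> lam <= 1.
Proof. by move=> f1 ev; have := sinc_le1 f; rewrite ev f1 mulr1. Qed.

(** [plunge_trig] for a midpoint sum close to the operator. Since 2 / pi <= 8 / pi^2, the constants
    add up to 8 + 2 + 36 + 1 <= 50. *)
Lemma sinc_plunge K (psi : 'I_K -> L2) (lam : 'I_K -> R) : 1 <= c ->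
  orthonormal_fam ip psi -> (forall i, eigen ip A (lam i) (psi i)) ->
  \sum_(i < K) lam i * (1 - lam i) <= (ln c + 50) / pi ^+ 2.
Proof.
move=> c1 on ev; have p0 := pi_gt0 R.
have L0 : 0 <= ln c by exact: ln_ge0.
have L1 : 0 < 3 * (ln c + 1) by rewrite mulr_gt0// ltr_wpDl.
(* This makes (1 + eta)^2 (ln c + 1) <= (1 + 3 eta) (ln c + 1) = ln c + 2. *)
pose eta := (3 * (ln c + 1))^-1.
have eta0 : 0 < eta by rewrite invr_gt0.
have eta1 : eta <= 1 by rewrite /eta invf_le1//; move: (ln c) L0 => L; lra.
have etaL : eta * (3 * (ln c + 1)) = 1 by rewrite mulVf// gt_eqF.
have [delta [d0 hd]] := sinc_step_params eta0.
(* Each of the [K] terms will cost an error 4 e, in total at most 1 / pi^2. *)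
pose e := (pi ^+ 2 * (4 * (K%:R + 1)))^-1 : R.
have K0 : 0 <= K%:R :> R by [].
have p2 : 0 < pi ^+ 2 :> R by rewrite exprn_gt0.
have e0 : 0 < e by rewrite invr_gt0 !mulr_gt0// ltr_wpDl.
have e1 : e <= 1.
  have p4 : 1 <= pi ^+ 2 :> R by rewrite exprn_ege1// (le_trans _ (pi_ge2 R))// ler1n.
  have k4 : 1 <= 4 * (K%:R + 1) :> R by move: (K%:R : R) K0 => k; lra.
  rewrite /e invf_le1; last by rewrite mulr_gt0// (lt_le_trans ltr01).
  by rewrite -[leLHS]mulr1; apply: ler_pM.
have eK : e * (4 * (K%:R + 1)) = 1 / pi ^+ 2.
  rewrite /e; have k0 : K%:R + 1 != 0 :> R by rewrite gt_eqF// ltr_wpDl.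
  by move: (pi : R) (lt0r_neq0 p0) (K%:R : R) k0 => p pn k k0; field; rewrite pn k0.
have [m [m0 md h1 h2]] := sinc_form_near c0 d0 e0.
have [l2 w1 w2 w3] := hd m m0 md.
have main := plunge_trig c0 m0 l2 eta0 w1 w2 w3 c1 on.
have term i : lam i * (1 - lam i) <= ip (T m (psi i)) (psi i) - ip (T m (psi i)) (T m (psi i)) + 4 * e.
  have f1 : ip (psi i) (psi i) = 1 by rewrite on eqxx.
  have lam1 := sinc_eigen_le1 f1 (ev i).
  have lam0 : 0 <= lam i.
    by have := op_ge0 (trig_approx_positive (@sincL2_approx R c c0)) (psi i); rewrite ev f1 mulr1.
  have := h1 (psi i); have := h2 (psi i); rewrite f1 !mulr1 (ev i) f1 mulr1 => a1 a2.
  set g := A (psi i) - T m (psi i) in a2.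
  have Tg : T m (psi i) = A (psi i) - g by rewrite /g opprB addrC subrK.
  have cs := cauchy_schwarz ipP (psi i) g; rewrite f1 mul1r in cs.
  have TT : ip (T m (psi i)) (T m (psi i)) = lam i ^+ 2 - 2 * lam i * ip (psi i) g + ip g g.
    have e3 : ip (psi i) (A (psi i)) = lam i by rewrite (ipC ipP) ev f1 mulr1.
    have e4 : ip g (A (psi i)) = lam i * ip (psi i) g by rewrite (ipC ipP) ev.
    rewrite Tg; move: g e4 {Tg cs a2} => g e4.
    rewrite (ipBl ipP) !(ipBr ipP) e4 !ev e3.
    by move: (ip (psi i) g) (ip g g) (lam i) => x y l; ring.
  have gle : `|ip (psi i) g| <= e.
    rewrite -(ler_pXn2r (n := 2)) ?nnegrE ?(ltW e0)// real_normK ?num_real//.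
    exact: le_trans cs a2.
  rewrite TT; move: a1 gle a2; move: (ip (T m (psi i)) (psi i)) (ip (psi i) g) (ip g g) => x y z a1 a2 a3.
  have z1 : z <= e by apply: le_trans a3 _; rewrite expr2 ler_piMl// ltW.
  have yl : `|lam i * y| <= e.
    by rewrite normrM (ger0_norm lam0) -[leRHS]mul1r ler_pM.
  move: a1 yl; rewrite !ler_norml => /andP[a11 a12] /andP[y1 y2].
  by rewrite mulrBr mulr1 -expr2; move: (lam i ^+ 2) (lam i * y) (mulrA 2 (lam i) y) y1 y2 => q r <- y1 y2; lra.
apply: le_trans (_ : \sum_(i < K) (ip (T m (psi i)) (psi i) - ip (T m (psi i)) (T m (psi i)) + 4 * e) <= _).
  by apply: ler_sum => i _.
rewrite big_split/= sumr_const card_ord -[_ *+ K]mulr_natr.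
have s2 : 4 * e * K%:R <= 1 / pi ^+ 2.
  rewrite -eK [4 * e]mulrC -mulrA ler_wpM2l ?(ltW e0)//.
  by rewrite ler_pM2l// lerDl.
apply: le_trans (lerD main s2) _.
have kE : ((1 + eta) / pi) ^+ 2 * (ln c + 1) <= (ln c + 2) / pi ^+ 2.
  rewrite expr_div_n mulrAC ler_wpM2r ?invr_ge0 ?(ltW p2)//.
  have : eta ^+ 2 * (ln c + 1) <= eta * (ln c + 1).
    by rewrite expr2 -mulrA ler_piMl ?mulr_ge0 ?(ltW eta0)//; lra.
  by move: etaL; move: (eta) (ln c) => h L etaL'; lra.
apply: le_trans (_ : 2 / pi + (ln c + 2) / pi ^+ 2 + 36 / pi ^+ 2 + 1 / pi ^+ 2 <= _).
  by rewrite !lerD2r lerD2l.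
have p4 : pi <= 4 :> R by have := @pihalf_lt2 R; move: (pi : R) => p; lra.
have -> : 2 / pi = 2 * pi / pi ^+ 2 :> R by move: (pi : R) (lt0r_neq0 p0) => p pn; field.
rewrite -!mulrDl ler_wpM2r ?invr_ge0 ?(ltW p2)//.
by move: (pi : R) p4 (ln c) => p p4 L; lra.
Qed.

End PlungeSinc.

(** [i] stands for 1 / (2 c). Each of the five oscillating terms is at most 6 T i, so together they
    stay below 30 T / 2000, less than T / 50. *)
Lemma quadratic_cos_numeric (R : realDomainType) (p1 p2 q1 q2 C S i T : R) :
  -1 <= C -> C <= 1 -> -1 <= S -> S <= 1 -> 0 <= i -> 2000 * i <= 1 ->
  T = p1 ^+ 2 + p2 ^+ 2 + 3 * q1 ^+ 2 + 3 * q2 ^+ 2 ->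
  50 * (T + (p1 ^+ 2 + 9 * q1 ^+ 2 - p2 ^+ 2 - 9 * q2 ^+ 2) * (S * i)
  + 18 * (q1 ^+ 2 - q2 ^+ 2) * (C * i ^+ 2) - 18 * (q1 ^+ 2 - q2 ^+ 2) * (S * i ^+ 3)
  - 6 * (p1 * q2 + q1 * p2) * (C * i) + 6 * (q1 * p2 + q2 * p1) * (S * i ^+ 2)) <= 51 * T.
Proof.
move=> C1 C2 S1 S2 i0 i2000 TE.
have T0 : 0 <= T by have := (sqr_ge0 p1, sqr_ge0 p2, (sqr_ge0 q1, sqr_ge0 q2)) => -[[? ?] [? ?]]; rewrite TE; lra.
have i1 : i <= 1 by move: i0 i2000; clear; lra.
have i2 : i ^+ 2 <= i by rewrite expr2 ler_piMl.
have i3 : i ^+ 3 <= i by rewrite exprSr ler_piMl// exprn_ile1.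
have cs x y : -1 <= x -> x <= 1 -> 0 <= y -> y <= i -> `|x * y| <= i.
  by move=> x1 x2 y0 y1; rewrite normrM (ger0_norm y0) (le_trans _ y1)// ler_piMl// ler_norml x1.
have bd a x y : `|a| <= 6 * T -> -1 <= x -> x <= 1 -> 0 <= y -> y <= i -> a * (x * y) <= 6 * T * i.
  move=> h x1 x2 y0 y1; apply: le_trans (ler_norm _) _; rewrite normrM.
  by apply: ler_pM => //; exact: cs.
have sq := sqr_ge0; have aM (a : R) := sqr_ge0 a.
have n1 : `|p1 ^+ 2 + 9 * q1 ^+ 2 - p2 ^+ 2 - 9 * q2 ^+ 2| <= 6 * T.
  by rewrite ler_norml TE; have := (aM p1, aM p2, (aM q1, aM q2)) => -[[? ?] [? ?]]; apply/andP; split; lra.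
have n2 : `|18 * (q1 ^+ 2 - q2 ^+ 2)| <= 6 * T.
  by rewrite ler_norml TE; have := (aM p1, aM p2, (aM q1, aM q2)) => -[[? ?] [? ?]]; apply/andP; split; lra.
have n2' : `|- (18 * (q1 ^+ 2 - q2 ^+ 2))| <= 6 * T by rewrite normrN.
have n3 : `|6 * (q1 * p2 + q2 * p1)| <= 6 * T.
  rewrite ler_norml TE.
  have := (aM p1, aM p2, (aM q1, aM q2), (aM (q1 - p2), aM (q1 + p2)), (aM (q2 - p1), aM (q2 + p1))).
  by move=> -[[[[? ?] [? ?]] [? ?]] [? ?]]; apply/andP; split; lra.
have n3' : `|- (6 * (p1 * q2 + q1 * p2))| <= 6 * T by rewrite normrN addrC (mulrC p1).
have i20 := sqr_ge0 i; have i30 : 0 <= i ^+ 3 by exact: exprn_ge0.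
have := bd _ _ _ n1 S1 S2 i0 (lexx _).
have := bd _ _ _ n2 C1 C2 i20 i2; have := bd _ _ _ n2' S1 S2 i30 i3.
have := bd _ _ _ n3 S1 S2 i20 i2; have := bd _ _ _ n3' C1 C2 i0 (lexx _).
have Ti : T * (2000 * i) <= T by exact: ler_piMr.
clear -Ti T0.
lra.
Qed.

(** * The distance between the operators *)

Section Closeness.
Variable R : realType.
Notation mu := (@mu11 R).
Notation L2 := (LfunType mu (lee1n 2)).
Notation ip := (@ip2 R).
Implicit Types (f g h : L2).
Let ipP := ip2_semi R.

Let lin_continuous (k : R) : continuous (fun z : R => k * z).
Proof. by move=> z; apply: cvgM; [exact: cvg_cst|exact: cvg_id]. Qed.

Let cos_continuous (k : R) : continuous (fun z : R => cos (k * z)).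
Proof. by move=> z; apply: continuous_comp; [exact: lin_continuous|exact: continuous_cos]. Qed.

Let sin_continuous (k : R) : continuous (fun z : R => sin (k * z)).
Proof. by move=> z; apply: continuous_comp; [exact: lin_continuous|exact: continuous_sin]. Qed.

Lemma xcos_L2 (a : R) : (fun x : R => x * cos (a * x)) \in Lfun mu 2%:E.
Proof. by apply: continuous_L2 => x; apply: cvgM; [exact: cvg_id|exact: cos_continuous]. Qed.
Lemma xsin_L2 (a : R) : (fun x : R => x * sin (a * x)) \in Lfun mu 2%:E.
Proof. by apply: continuous_L2 => x; apply: cvgM; [exact: cvg_id|exact: sin_continuous]. Qed.

Variable c : R.
Hypothesis c1000 : 1000 <= c.
Hypothesis c0 : 0 < c.
Let C := cosL2 c.
Let S := sinL2 c.
Let XC : L2 := toL2 (xcos_L2 c).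
Let XS : L2 := toL2 (xsin_L2 c).

(** For large c the four functions are nearly orthogonal with square norms near 1, 1, 1/3, 1/3. The
    rest consists of boundary terms of order 1 / c, within 2 percent of the total. *)
Lemma quadratic_cos_integral (p1 p2 q1 q2 : R) :
  let g := p1 *: C + p2 *: S + (3 * q1) *: XC + (3 * q2) *: XS in
  ip g g <= 51 / 50 * (p1 ^+ 2 + p2 ^+ 2 + 3 * q1 ^+ 2 + 3 * q2 ^+ 2).
Proof.
move=> /=; set g := _ + _.
pose P x := p1 + 3 * q1 * x; pose Q x := p2 + 3 * q2 * x.
have gE x : g x = P x * cos (c * x) + Q x * sin (c * x).
  rewrite /g -[LHS]/(p1 * cos (c * x) + p2 * sin (c * x) + 3 * q1 * (x * cos (c * x)) + 3 * q2 * (x * sin (c * x))).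
  by rewrite /P /Q; ring.
pose k := 2 * c.
have k0 : k != 0 by rewrite mulf_neq0// gt_eqF.
have k2000 : 2000 <= k by rewrite /k; move: c1000; lra.
pose U x := (P x ^+ 2 - Q x ^+ 2) / 2; pose V x := P x * Q x.
pose U1 x := 3 * q1 * P x - 3 * q2 * Q x; pose V1 x := 3 * q1 * Q x + 3 * q2 * P x.
pose U2 := 9 * (q1 ^+ 2 - q2 ^+ 2); pose V2 := 18 * q1 * q2.
pose F x := (P x ^+ 2 + Q x ^+ 2) / 2 + U x * cos (k * x) + V x * sin (k * x).
(* Repeated integration by parts: [U1], [U2] and [V1], [V2] are the successive derivatives of the
   quadratics [U] and [V]. *)
pose G x := ((p1 ^+ 2 + p2 ^+ 2) * x + 3 * (p1 * q1 + p2 * q2) * x ^+ 2 + 3 * (q1 ^+ 2 + q2 ^+ 2) * x ^+ 3) / 2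
  + (U x * sin (k * x) / k + U1 x * cos (k * x) / k ^+ 2 - U2 * sin (k * x) / k ^+ 3)
  + (- (V x * cos (k * x)) / k + V1 x * sin (k * x) / k ^+ 2 + V2 * cos (k * x) / k ^+ 3).
have ggE : (fun x => g x * g x) = F.
  apply/funext => x; rewrite gE /F /U /V.
  have -> : k * x = c * x + c * x by rewrite /k; ring.
  rewrite cosD sinD; have := cos2Dsin2 (c * x); move: (P x) (Q x) (cos _) (sin _) => p q CC SS e.
  have -> : (p ^+ 2 + q ^+ 2) / 2 = (p ^+ 2 + q ^+ 2) / 2 * (CC ^+ 2 + SS ^+ 2) by rewrite e mulr1.
  by field.
have cP : continuous P by move=> x; apply: cvgD; [exact: cvg_cst|exact: lin_continuous].
have cQ : continuous Q by move=> x; apply: cvgD; [exact: cvg_cst|exact: lin_continuous].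
have csq (H : R -> R) : continuous H -> continuous (fun x => H x ^+ 2).
  by move=> cH x; apply: (continuous_comp (f := H) (g := fun z : R => z ^+ 2)); [exact: cH|exact: exprn_continuous].
have cF : continuous F.
  move=> x; apply: cvgD; first (apply: cvgD).
  - by apply: cvgM; [apply: cvgD; exact: csq|exact: cvg_cst].
  - apply: cvgM; last exact: cos_continuous.
    by apply: cvgM; [apply: cvgB; exact: csq|exact: cvg_cst].
  - by apply: cvgM; [apply: cvgM; [exact: cP|exact: cQ]|exact: sin_continuous].
have dG (x : R) : is_derive x 1 G (F x).
  rewrite /G /F /U /V /U1 /V1 /P /Q; apply: is_derive_eq; rewrite /GRing.scale/= /U2 /V2 /P /Q.
  by move: (cos (k * x)) (sin (k * x)) => CC SS; field.
rewrite /ip2 /inner ggE (mu11_FTC1 cF dG).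
rewrite /G /U /V /U1 /V1 /U2 /V2 /P /Q !mulr1 !mulrN1 !cosN !sinN.
have kC := cos_max k; have kS : `|sin k| <= 1 by rewrite ler_norml sin_geN1 sin_le1.
move: (cos k) (sin k) kC kS => CC SS; rewrite !ler_norml => /andP[C1 C2] /andP[S1 S2].
pose i := k^-1.
have kp : 0 < k by rewrite mulr_gt0.
have i0 : 0 < i by rewrite invr_gt0.
have ki : k * i = 1 by rewrite /i divff.
have i1 : 2000 * i <= 1 by rewrite -[leRHS]ki; exact: (ler_wpM2r (ltW i0)).
have := quadratic_cos_numeric C1 C2 S1 S2 (ltW i0) i1 (erefl (p1 ^+ 2 + p2 ^+ 2 + 3 * q1 ^+ 2 + 3 * q2 ^+ 2)).
move=> hq; rewrite -(ler_pM2l (_ : 0 < 50 :> R))//.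
have e5 T : 50 * (51 / 50 * T) = 51 * T :> R by field.
rewrite e5; apply: le_trans hq; rewrite le_eqVlt; apply/orP; left; apply/eqP; congr (50 * _); rewrite /i.
by field.
Qed.

(** Duality: for the combination [g] built from these coefficients, (f, g) is the left-hand side s
    and |g|^2 <= (51/50) s, so Cauchy-Schwarz gives s^2 <= (51/50) s |f|^2. *)
Lemma quadratic_bessel f :
  ip f C ^+ 2 + ip f S ^+ 2 + 3 * ip f XC ^+ 2 + 3 * ip f XS ^+ 2 <= 51 / 50 * ip f f.
Proof.
set p1 := ip f C; set p2 := ip f S; set q1 := ip f XC; set q2 := ip f XS.
have := quadratic_cos_integral p1 p2 q1 q2; set g := _ + _ => /= gg.
have fg : ip f g = p1 ^+ 2 + p2 ^+ 2 + 3 * q1 ^+ 2 + 3 * q2 ^+ 2.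
  rewrite /g !(ipE ipP) -/p1 -/p2 -/q1 -/q2.
  by move: p1 p2 q1 q2 {g gg} => p1 p2 q1 q2; ring.
have := cauchy_schwarz ipP f g; rewrite fg.
have := ip_ge0 ipP f; move: gg.
have := (sqr_ge0 p1, sqr_ge0 p2, (sqr_ge0 q1, sqr_ge0 q2)) => -[[P1 P2] [Q1 Q2]].
have s0 : 0 <= p1 ^+ 2 + p2 ^+ 2 + 3 * q1 ^+ 2 + 3 * q2 ^+ 2 by move: P1 P2 Q1 Q2; clear; lra.
move: (_ + _) s0 (ip f f) (ip g g) => s s0 F G Gs F0 cs.
have [->|sn] := eqVneq s 0; first by apply: mulr_ge0 => //; apply: divr_ge0.
have sp : 0 < s by rewrite lt_neqAle eq_sym sn.
rewrite -(ler_pM2r sp) -expr2; apply: le_trans cs _.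
apply: le_trans (_ : F * (51 / 50 * s) <= _); first exact: ler_wpM2l.
by rewrite mulrCA mulrA.
Qed.

(** The operator with kernel t sin(c t), t = x - y. Multiplied by - pi W^2 / 6 it is the main term
    of Q - W L. *)
Definition tsin_op f : L2 := ip f C *: XS - ip f S *: XC - ip f XC *: S + ip f XS *: C.

(** The form is 2 p1 q2 - 2 p2 q1, and 58/100 is slightly above 1/sqrt 3, the best constant in 2 a b
    <= k (a^2 + 3 b^2). *)
Lemma tsin_op_form f : `|ip (tsin_op f) f| <= 58 / 100 * (51 / 50) * ip f f.
Proof.
have := quadratic_bessel f; rewrite /tsin_op !(ipE ipP).
rewrite (ipC ipP XS) (ipC ipP XC) (ipC ipP S) (ipC ipP C); move: (ip f C) (ip f S) (ip f XC) (ip f XS) (ip f f) => p1 p2 q1 q2 F h.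
have sq (a b : R) : - (2 * a * b) <= 58 / 100 * (a ^+ 2 + 3 * b ^+ 2) /\ 2 * a * b <= 58 / 100 * (a ^+ 2 + 3 * b ^+ 2).
  have := (sqr_ge0 (29 * a - 50 * b), sqr_ge0 (29 * a + 50 * b), sqr_ge0 b) => -[[? ?] ?]; split; lra.
have := (sq p1 q2, sq p2 q1) => -[[? ?] [? ?]].
by rewrite ler_norml; apply/andP; split; lra.
Qed.

Variables (W : R) (N : nat).
Hypothesis W0 : 0 < W.
Hypothesis W1 : W < 1 / 2.
Hypothesis cE : c = pi * N%:R * W.
Hypothesis Wsmall : W <= 1 / 100.
Local Notation A := (sincL2 c0).
Local Notation B := (@dirL2 R W N W0 W1).

Let tsin_kernel (x : R) : L2 :=
  (x * sin (c * x)) *: C - (x * cos (c * x)) *: S - sin (c * x) *: XC + cos (c * x) *: XS.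

Let tsin_kernelE (x y : R) : tsin_kernel x y = (x - y) * sin (c * (x - y)).
Proof.
rewrite -[LHS]/(x * sin (c * x) * cos (c * y) - x * cos (c * x) * sin (c * y)
  - sin (c * x) * (y * cos (c * y)) + cos (c * x) * (y * sin (c * y))).
by rewrite mulrBr sinB; ring.
Qed.

Let tsin_op_kernel f (x : R) : tsin_op f x = ip (tsin_kernel x) f.
Proof.
rewrite /tsin_kernel !(ipE ipP) (ipC ipP XS) (ipC ipP XC) (ipC ipP S) (ipC ipP C).
rewrite -[LHS]/(ip f C * (x * sin (c * x)) - ip f S * (x * cos (c * x))
  - ip f XC * sin (c * x) + ip f XS * cos (c * x)).
by ring.
Qed.

(** Bounds the cosecant remainder W |u|^3 / 30 when |u| <= 2 pi W and pi W <= 4/100. *)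
Let rho : R := pi * W ^+ 2 / 2000.

Let kernel_bound (x y : R) : -1 < x < 1 -> -1 < y < 1 -> y != x ->
  `|sin (c * (x - y)) / (pi * (x - y))
    - W * (sin (pi * N%:R * W * (x - y)) / sin (pi * W * (x - y)))
    + pi * W ^+ 2 / 6 * ((x - y) * sin (c * (x - y)))| <= rho.
Proof.
move=> xI yI yx; have su := sin_piW_neq0 W0 W1 xI yI yx.
rewrite -cE; set t := x - y in su *.
have p0 := @pi_gt0 R; have p4 : pi <= 4 :> R by have := @pihalf_lt2 R; lra.
have t0 : t != 0 by rewrite subr_eq0 eq_sym.
have t2 : `|t| <= 2.
  by rewrite ler_norml /t; move: xI yI => /andP[? ?] /andP[? ?]; apply/andP; split; lra.
set u := pi * W * t in su *.
have uE : `|u| = pi * W * `|t| by rewrite /u normrM gtr0_norm// mulr_gt0.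
have pw : pi * W <= 4 / 100.
  rewrite (_ : 4 / 100 = 4 * (1 / 100)); last by field.
  by apply: ler_pM => //; exact: ltW.
have u2 : `|u| <= 2 * (pi * W).
  by rewrite uE mulrC; apply: ler_wpM2r => //; rewrite mulr_ge0// ltW.
have u1 : `|u| <= 1 by move: u2 pw; move: (pi * W) (`|u|) => a d; lra.
have un0 : u != 0 by rewrite !mulf_neq0// gt_eqF.
have -> : sin (c * t) / (pi * t) - W * (sin (c * t) / sin u) + pi * W ^+ 2 / 6 * (t * sin (c * t))
  = - (W * sin (c * t) * ((sin u)^-1 - u^-1 - u / 6)).
  move: su; rewrite /u; move: (sin (c * t)) (sin _) => a b b0.
  move: (pi : R) (lt0r_neq0 p0) => p pn; move: (lt0r_neq0 W0) => Wn.
  by field; rewrite b0 t0 pn Wn.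
rewrite normrN !normrM (gtr0_norm W0).
have hs : `|sin (c * t)| <= 1 by rewrite ler_norml sin_geN1 sin_le1.
have hc := csc_approx un0 u1.
have h1 : W * `|sin (c * t)| * `|(sin u)^-1 - u^-1 - u / 6| <= W * 1 * (`|u| ^+ 3 / 30).
  by apply: ler_pM => //; [rewrite mulr_ge0// ltW|apply: ler_wpM2l => //; exact: ltW].
apply: le_trans h1 _; rewrite mulr1 /rho.
have u3 : `|u| ^+ 3 <= (2 * (pi * W)) ^+ 3 by rewrite lerXn2r ?nnegrE// mulr_ge0// mulr_ge0// ltW.
have z : (pi * W) ^+ 2 <= (4 / 100) ^+ 2 by rewrite lerXn2r ?nnegrE// ltW// mulr_gt0.
have gen (p w U : R) : 0 <= p * w ^+ 2 -> p * w ^+ 2 * (p * w) ^+ 2 <= p * w ^+ 2 * (4 / 100) ^+ 2 ->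
    w * U <= w * (2 * (p * w)) ^+ 3 -> w * (U / 30) <= p * w ^+ 2 / 2000.
  rewrite (_ : w * (2 * (p * w)) ^+ 3 = 8 * (p * w ^+ 2 * (p * w) ^+ 2)); last by ring.
  by move: (p * w ^+ 2 * (p * w) ^+ 2) (p * w ^+ 2) => z1 z2; lra.
have pWW : 0 <= pi * W ^+ 2 by apply: mulr_ge0; [exact: ltW|exact: sqr_ge0].
exact: gen pWW (ler_wpM2l pWW z) (ler_wpM2l (ltW W0) u3).
Qed.

(** In units of pi W^2 |f|^2, the main term costs 0.58 * 1.02 / 6 < 0.0987 and the remainder
    1/1000. *)
Lemma sinc_dirichlet_form f :
  `|ip (A f - W *: B f) f| <= pi * W ^+ 2 / 10 * ip f f.
Proof.
have q0 : 0 <= pi * W ^+ 2 by apply: mulr_ge0; [exact: pi_ge0|exact: sqr_ge0].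
have r0 : 0 <= rho by apply: divr_ge0 q0 (ler0n _ _).
pose h : L2 := A f - W *: B f + (pi * W ^+ 2 / 6) *: tsin_op f.
have hE x : -1 < x < 1 -> `|h x| <= Num.sqrt (2 * rho ^+ 2 * ip f f).
  move=> xI.
  pose kx : L2 := toL2 (sinc_L2 c0 x) - W *: toL2 (dir_L2 N W0 W1 xI) + (pi * W ^+ 2 / 6) *: tsin_kernel x.
  have -> : h x = ip kx f.
    rewrite -[LHS]/(A f x - W * B f x + pi * W ^+ 2 / 6 * tsin_op f x) tsin_op_kernel.
    by rewrite !kernel_opE// /kx !(ipE ipP).
  rewrite -sqrtr_sqr; apply: ler_wsqrtr.
  apply: le_trans (cauchy_schwarz ipP _ _) _; rewrite ler_wpM2r ?(ip_ge0 ipP)//.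
  apply: (ip2_cst_neq (a := x)) => // y yI yx.
  rewrite -[X in `|X|]/(sin (c * (x - y)) / (pi * (x - y))
    - W * (sin (pi * N%:R * W * (x - y)) / sin (pi * W * (x - y))) + pi * W ^+ 2 / 6 * tsin_kernel x y).
  by rewrite tsin_kernelE; exact: kernel_bound.
have hf : `|ip h f| <= 2 * rho * ip f f.
  have F0 := ip_ge0 ipP f; move: rho r0 hE => r r0 hE.
  have b0 : 0 <= 2 * r * ip f f by apply: mulr_ge0 => //; exact: mulr_ge0.
  rewrite -(ler_pXn2r (n := 2) _ (normr_ge0 _) b0)// real_normK ?num_real//.
  apply: le_trans (cauchy_schwarz ipP _ _) _.
  rewrite [leRHS](_ : _ = 2 * (2 * r ^+ 2 * ip f f) * ip f f); last by ring.
  apply: ler_wpM2r => //; apply: le_trans (ip2_cst hE) _.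
  rewrite sqr_sqrtr//; apply: mulr_ge0 => //; apply: mulr_ge0 => //; exact: sqr_ge0.
have -> : ip (A f - W *: B f) f = ip h f - pi * W ^+ 2 / 6 * ip (tsin_op f) f.
  by rewrite /h [ip (_ + _ *: tsin_op f) f](ipDl ipP) (ipZl ipP) addrK.
apply: le_trans (ler_normB _ _) _.
have tf : `|pi * W ^+ 2 / 6 * ip (tsin_op f) f| <= pi * W ^+ 2 / 6 * (58 / 100 * (51 / 50) * ip f f).
  rewrite normrM ger0_norm ?divr_ge0//; apply: ler_wpM2l; first exact: divr_ge0.
  exact: tsin_op_form.
apply: le_trans (lerD hf tf) _; rewrite /rho.
have := mulr_ge0 q0 (ip_ge0 ipP f); move: (ip f f) => F.
move: (pi * W ^+ 2) => q; rewrite (_ : 2 * (q / 2000) * F = q * F / 1000); last by field.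
rewrite (_ : q / 6 * (58 / 100 * (51 / 50) * F) = q * F * (986 / 10000)); last by field.
rewrite (_ : q / 10 * F = q * F / 10); last by field.
by move: (q * F) => z z0; lra.
Qed.

End Closeness.

(** * The spectral gap and the constants *)

(* [mu k] truncates [lam k] at [1 / 2]; integrating [t * (1 - t)] from [mu N] to *)
(* [1 / 2] in steps shorter than [delta] compares the integral with the sum.    *)
Lemma gap_exists (R : realFieldType) (lam : nat -> R) (K N : nat) (delta b P : R) :
  (0 < K <= N)%N -> 0 < delta -> 0 <= b ->
  (forall i j, (i <= j <= N)%N -> lam j <= lam i) ->
  (forall k, (k <= N)%N -> 0 <= lam k <= 1) ->
  1 / 2 <= lam K.-1 -> lam N <= b ->
  \sum_(k < N.+1) lam k * (1 - lam k) <= P ->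
  delta * (P + 1 / 2) < 1 / 12 - b ^+ 2 / 2 ->
  exists2 n, (K <= n <= N)%N & delta <= lam n.-1 - lam n.
Proof.
move=> /andP[K0 KN] d0 b0 mono lam01 lamK lamN lamP dP.
apply: contrapT => no.
have gap n : (K <= n <= N)%N -> lam n.-1 - lam n < delta.
  by move=> nKN; rewrite ltNge; apply/negP => h; apply: no; exists n.
(* Antiderivative of t (1 - t), with F(1/2) = 1/12. *)
pose F (t : R) := t ^+ 2 / 2 - t ^+ 3 / 3.
pose mu k := Num.min (lam k) (1 / 2).
have f0 k : (k <= N)%N -> 0 <= lam k * (1 - lam k).
  by move=> /lam01 /andP[h0 h1]; rewrite mulr_ge0// subr_ge0.
have mu0 k : (k <= N)%N -> 0 <= mu k.
  by move=> /lam01 /andP[h0 _]; rewrite le_min h0 divr_ge0.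
have muK : mu K.-1 = 1 / 2 by rewrite /mu min_r.
have main j : (K.-1 + j <= N)%N ->
    F (mu K.-1) - F (mu (K.-1 + j)%N) <= delta * (\sum_(k < (K.-1 + j)%N.+1) lam k * (1 - lam k))
      + delta * (mu K.-1 - mu (K.-1 + j)%N).
  elim: j => [|j IH] jN.
    rewrite addn0 !subrr mulr0 addr0 mulr_ge0 ?(ltW d0)// sumr_ge0// => k _; apply: f0.
    by rewrite -ltnS (leq_trans (ltn_ord k))// ltnS (leq_trans (leq_pred _)).
  rewrite addnS in jN *; rewrite big_ord_recr/=.
  have := IH (ltnW jN); have mK : (K <= (K.-1 + j).+1)%N by rewrite -{1}(prednK K0) ltnS leq_addr.
  move: (K.-1 + j)%N jN mK {IH} => m mN mK.
  have : F (mu m) - F (mu m.+1) <=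
      delta * (lam m.+1 * (1 - lam m.+1)) + delta * (mu m - mu m.+1).
    have := gap m.+1; rewrite mK mN /= => /(_ isT).
    have := mono m m.+1; rewrite leqnSn mN => /(_ isT).
    have := f0 _ mN; have := lam01 _ mN.
    rewrite /mu; move: (lam _) (lam _) => t s /andP[t0 t1] ft st gp.
    (* On [u, v] the integrand exceeds its value at [u] by at most v - u. The surplus delta (v - u)
       telescopes to at most delta / 2. *)
    have poly (u v : R) : 0 <= u -> u <= v -> v <= 1 / 2 -> v - u <= delta ->
        F v - F u <= delta * (u * (1 - u)) + delta * (v - u).
      move=> u0 uv v2 vu; apply: le_trans (_ : (v - u) * (u * (1 - u) + (v - u)) <= _).
        have -> : F v - F u = (v - u) * ((v + u) / 2 - (v ^+ 2 + v * u + u ^+ 2) / 3).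
          by rewrite /F; field.
        by apply: ler_wpM2l; nra.
      by rewrite -mulrDr; apply: ler_wpM2r => //; nra.
    have [s2|s2] := leP s (1 / 2); have [t2|t2] := leP t (1 / 2).
    - by apply: poly => //; exact: ltW.
    - by apply: poly => //; lra.
    - lra.
    - by rewrite !subrr mulr0 addr0 mulr_ge0// ltW.
  have gen (x y z p q r S f : R) : x - y <= delta * f + delta * (q - r) ->
      z - x <= delta * S + delta * (p - q) -> z - y <= delta * (S + f) + delta * (p - r) by lra.
  exact: gen.
have := main (N - K.-1)%N; rewrite subnKC ?(leq_trans (leq_pred _) KN)// => /(_ (leqnn _)).
have -> : F (mu K.-1) = 1 / 12 by rewrite muK /F; field.
rewrite muK => h.
have muN : mu N <= b by rewrite ge_min lamN.
have muN0 := mu0 _ (leqnn N).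
have FN : F (mu N) <= b ^+ 2 / 2 by rewrite /F; nra.
have dS : delta * \sum_(k < N.+1) lam k * (1 - lam k) <= delta * P by rewrite ler_wpM2l// ltW.
have dm : 0 <= delta * mu N by rewrite mulr_ge0// ltW.
lra.
Qed.

(** For s = pi b this says that 1 - 3 / (1 + e^s) <= (2/5) s. The case at stake is s < 5/2, where x
    <= e^(x - 1) gives (5/2 - s) e^s <= e^(3/2) <= 23/4 <= 5 + s. *)
Lemma exp_ratio_bound (R : realType) (s : R) : ln 3 < s ->
  5 / 2 * (expR s - 2) <= s * (1 + expR s).
Proof.
move=> s3; have q : expR (1 / 4) <= 4 / 3 :> R.
  have := expR_ge1Dx (- (1 / 4) : R); rewrite expRN; have := expR_gt0 (1 / 4 : R).
  move: (expR _) => e e0 h; rewrite -(ler_pM2r (_ : 0 < e^-1)) ?invr_gt0// divff ?gt_eqF//.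
  by move: h; move: (e^-1) => i; lra.
have q0 : 0 <= expR (1 / 4) :> R by exact: ltW (expR_gt0 _).
have s34 : 3 / 4 <= s.
  apply/ltW/(le_lt_trans _ s3); rewrite -ler_expR lnK ?posrE//.
  have -> : 3 / 4 = 3%:R * (1 / 4) :> R by field.
  rewrite expRM_natl; apply: le_trans (_ : (4 / 3) ^+ 3 <= _); last by lra.
  by apply: lerXn2r => //; rewrite nnegrE divr_ge0.
have t0 := expR_gt0 s.
have [s2|s2] := leP (5 / 2) s; first by nra.
have h : (5 / 2 - s) * expR s <= expR (3 / 2).
  have -> : 3 / 2 = (5 / 2 - s - 1) + s by field.
  rewrite expRD; apply: ler_wpM2r; first exact: ltW.
  by have := expR_ge1Dx (5 / 2 - s - 1); lra.
have h2 : expR (3 / 2) <= 23 / 4 :> R.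
  have -> : 3 / 2 = 6%:R * (1 / 4) :> R by field.
  rewrite expRM_natl; apply: le_trans (_ : (4 / 3) ^+ 6 <= _); last by lra.
  by apply: lerXn2r => //; rewrite nnegrE divr_ge0.
by move: (expR s) (expR (3 / 2)) h h2 => e e' h h2; lra.
Qed.

(** * Bounds on the right-hand side and on W *)

Section Numerics.
Variables (R : realType) (b : R).
Hypothesis hb : ln 3 / pi < b.

Let p0 : 0 < pi :> R. Proof. exact: pi_gt0. Qed.

Let s3 : ln 3 < pi * b.
Proof. by move: hb; rewrite ltr_pdivrMr// mulrC. Qed.

Let b0 : 0 < b.
Proof. by apply: le_lt_trans hb; apply: divr_ge0; [apply: ln_ge0; rewrite ler1n|exact: ltW]. Qed.

Let exp3 : 3 < expR (pi * b).
Proof. by rewrite -(@lnK _ (3 : R)) ?posrE// ltr_expR. Qed.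

Let q : R := 1 - 3 / (1 + expR (pi * b)).

Let qE : q = (expR (pi * b) - 2) / (1 + expR (pi * b)).
Proof. by rewrite /q; move: exp3; move: (expR _) => e e3; field; lra. Qed.

Let q0 : 0 < q.
Proof. by rewrite qE; apply: divr_gt0; move: exp3; lra. Qed.

Lemma alpha_gt0 : 0 < alpha b.
Proof. by apply: mulr_gt0 q0; apply: divr_gt0 => //; rewrite !mulr_gt0. Qed.

Variables W L : R.
Hypothesis W0 : 0 < W.
Hypothesis W1 : W < 1 / 2.
Hypothesis L0 : 0 <= L.
Hypothesis hL : L <= alpha b * (sin (2 * pi * W) / W ^+ 3) - 2 * ln 2 - pi / b.

Let rhs : R := W ^+ 3 * (4 * b * pi / (3 * sin (2 * pi * W)))
  * ((L + 2 * ln 2 + pi / b) / (1 - 3 / (1 + expR (pi * b)))).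

Let sn : R := sin (2 * pi * W).

Let sn0 : 0 < sn.
Proof.
apply: sin_gt0_pi; rewrite !mulr_gt0//=.
have := mulr_gt0 p0 (_ : 0 < 1 - 2 * W); rewrite subr_gt0 -ltr_pdivlMl//.
by rewrite mulrC W1 => /(_ isT); move: (pi : R) => p; lra.
Qed.

Let snW : sn <= 2 * pi * W.
Proof. by apply: sin_le; rewrite !mulr_ge0// ltW. Qed.

Let r : R := L + 2 * ln 2 + pi / b.

Let rL : L <= r.
Proof.
have l2 : 0 <= ln 2 :> R by apply: ln_ge0; rewrite ler1n.
by rewrite /r -addrA lerDl; apply: addr_ge0; [exact: mulr_ge0|apply: divr_ge0; exact: ltW].
Qed.

Let r_le : r <= alpha b * (sn / W ^+ 3).
Proof. by move: hL; rewrite -/sn /r; move: (alpha b * _) (ln 2) (pi / b) => x y z; lra. Qed.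

Let rhsE : rhs = W ^+ 3 * (4 * b * pi) / (3 * sn) / q * r.
Proof. by rewrite /rhs -/sn -/r -/q !mulrA [RHS]mulrAC. Qed.

Let coef0 : 0 < W ^+ 3 * (4 * b * pi) / (3 * sn) / q.
Proof.
apply: divr_gt0 => //; apply: divr_gt0; last exact: mulr_gt0.
by apply: mulr_gt0; [exact: exprn_gt0|rewrite !mulr_gt0].
Qed.

(** [alpha b] is the constant for which the hypothesis on ln c makes every other factor cancel and
    leaves 1/8. *)
Lemma rhs_le : rhs <= 1 / 8.
Proof.
rewrite rhsE; apply: le_trans (ler_wpM2l (ltW coef0) r_le) _.
rewrite le_eqVlt; apply/orP; left; apply/eqP; rewrite /alpha -/q.
move: (lt0r_neq0 p0) (lt0r_neq0 b0) (lt0r_neq0 q0) (lt0r_neq0 sn0) (lt0r_neq0 W0).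
by move: (pi : R) q sn => p q' s pn bn qn sn' Wn; field; rewrite pn bn qn sn' Wn.
Qed.

(** sin(2 pi W) <= 2 pi W and [exp_ratio_bound] eliminate the sine and [b]. *)
Lemma rhs_ge : 5 / (3 * pi) * (W ^+ 2 * L) <= rhs.
Proof.
have qs : 5 / 2 * q <= pi * b.
  rewrite qE mulrA ler_pdivrMr; last by move: exp3; lra.
  exact: exp_ratio_bound.
have w3 : 0 < W ^+ 3 by exact: exprn_gt0.
rewrite rhsE (mulrA (5 / (3 * pi))); apply: ler_pM => //.
  by apply: mulr_ge0 (sqr_ge0 _); apply: divr_ge0 => //; apply: mulr_ge0 => //; exact: ltW.
rewrite ler_pdivlMr// ler_pdivlMr ?mulr_gt0//.
apply: le_trans (_ : 10 * W ^+ 3 * q <= _).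
  have k0 : 0 <= 5 / pi * W ^+ 2 * q.
    by apply: mulr_ge0 (ltW q0); apply: mulr_ge0 (sqr_ge0 _); apply: divr_ge0 => //; exact: ltW.
  have := ler_wpM2l k0 snW.
  move: (lt0r_neq0 p0); move: (pi : R) q sn => p q' s pn.
  have -> : 5 / p * W ^+ 2 * q' * (2 * p * W) = 10 * W ^+ 3 * q' by field.
  by have -> : 5 / (3 * p) * W ^+ 2 * q' * (3 * s) = 5 / p * W ^+ 2 * q' * s by field.
have := ler_wpM2l (ltW w3) qs.
by move: (W ^+ 3) (pi : R) q => w p q'; lra.
Qed.

(** Again from sin(2 pi W) <= 2 pi W: a large ln c forces W to be small. *)
Lemma W_small : W ^+ 2 * L <= 2 * pi * alpha b.
Proof.
have a0 := alpha_gt0.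
have h : W ^+ 3 * L <= W * (2 * pi * alpha b).
  have := ler_wpM2l (ltW (exprn_gt0 3 W0)) (le_trans rL r_le).
  have -> : W ^+ 3 * (alpha b * (sn / W ^+ 3)) = alpha b * sn.
    by move: (lt0r_neq0 W0) => Wn; move: sn (alpha b) => s a; field.
  move=> h; apply: le_trans h _; apply: le_trans (ler_wpM2l (ltW a0) snW) _.
  by rewrite le_eqVlt; apply/orP; left; apply/eqP; ring.
by rewrite -(ler_pM2l W0) mulrA -exprS.
Qed.

End Numerics.

(** X delta >= (2/15) p W^2 L / (L + 58) >= (9/80) p W^2. With d = p W^2 / 10 and X <= 1/8, what is
    needed is d + X d <= (9/8) d, which is this same amount. *)
Lemma gap_numerics (R : realFieldType) (p W L X : R) : 0 < p -> 0 < W -> 1000 <= L ->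
  X <= 1 / 8 -> 5 / (3 * p) * (W ^+ 2 * L) <= X ->
  let delta := 2 / 25 * p ^+ 2 / (L + 58) in
  p * W ^+ 2 / 10 <= X * (delta - p * W ^+ 2 / 10).
Proof.
move=> p0 W0 L1 X8 Xge /=; set delta := _ / (L + 58).
have L58 : 0 < L + 58 by lra.
have pW : 0 < p * W ^+ 2 by rewrite mulr_gt0// exprn_gt0.
have d0 : 0 < delta by rewrite divr_gt0// mulr_gt0// exprn_gt0.
have h : p * W ^+ 2 * (9 / 80) <= X * delta.
  apply: le_trans (ler_wpM2r (ltW d0) Xge).
  have -> : 5 / (3 * p) * (W ^+ 2 * L) * delta = p * W ^+ 2 * (2 / 15 * L / (L + 58)).
    by rewrite /delta; field; rewrite !gt_eqF.
  by rewrite ler_pM2l// ler_pdivlMr//; lra.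
have := ler_wpM2l (ltW pW) X8; lra.
Qed.

(** The family [chi] locates the gap. Weyl's inequalities, tested on its span and complement, give
    the gap to whichever leading families [psi] and [phi] are chosen, with loss [d] for W B.
    Davis-Kahan then applies with separation delta - d. *)
Lemma spectral_projection_close (R : realType) (V : lmodType R) (ip : V -> V -> R)
    (A B : V -> V) (W d delta X : R) K (chi : nat -> V) (nu : nat -> R)
    (psi phi : 'I_K.+1 -> V) (lam be : 'I_K.+1 -> R) :
  semi_inner ip -> positive_op ip A -> compact_op ip A -> bounded_op ip A ->
  positive_op ip B -> compact_op ip B -> bounded_op ip B ->
  0 < W -> 0 <= d -> 0 <= X -> 2 * d < delta -> d <= X * (delta - d) ->
  (forall f, `|ip (A f - W *: B f) f| <= d * ip f f) ->
  strongly_leading ip A K.+2 chi nu -> delta <= nu K - nu K.+1 ->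
  leading ip A psi lam -> leading ip B phi be ->
  forall f, let g := span_proj ip psi f - span_proj ip phi f in ip g g <= X ^+ 2 * ip f f.
Proof.
move=> ipP AP Ac Ab BP Bc Bb W0 d0 X0 d2 dX AB sl gap psiP phiP f /=.
set a := nu K in gap; set a' := nu K.+1 in gap.
have [on ev top] := sl.
pose e (i : 'I_K.+1) := chi i.
have eon : orthonormal_fam ip e by move=> i j; rewrite /e on// ltnS ltnW.
have nu_mono (i : 'I_K.+1) : a <= nu i.
  have [_ _ mono _] := strongly_leading_leading ipP sl.
  have := mono (Ordinal (leqW (ltn_ord i))) (Ordinal (ltnW (ltnSn K.+1))).
  by apply; rewrite /= -ltnS.
have Age (b : 'I_K.+1 -> R) : let f := \sum_(i < K.+1) b i *: e i in a * ip f f <= ip (A f) f.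
  move=> /=; set h := \sum_(i < _) _.
  have hh : ip h h = \sum_(i < K.+1) b i * b i by rewrite /h (ip_comb2 ipP _ _ eon).
  rewrite hh mulr_sumr {1}/h (op_comb ipP AP); apply: ler_sum => j _.
  have ej : ip (e j) h = b j by rewrite (ipC ipP) (ip_comb_on ipP _ _ eon).
  rewrite ev ?(leqW (ltn_ord j))// ej (mulrCA (b j)) -expr2.
  by rewrite ler_wpM2r ?sqr_ge0.
have Ale h : (forall i, ip h (e i) = 0) -> ip (A h) h <= a' * ip h h.
  by move=> hp; apply: top => // j jK; exact: (hp (Ordinal jK)).
have a'0 : 0 <= a'.
  have := op_ge0 AP (chi K.+1); rewrite (ev _ (ltnSn _)) on// eqxx mulr1.
  exact.
have Bform h : `|ip (A h) h - W * ip (B h) h| <= d * ip h h.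
  by have := AB h; rewrite (ipBl ipP) (ipZl ipP).
have aa' : a' < a by lra.
have bb' : (a' + d) / W < (a - d) / W by rewrite ltr_pM2r ?invr_gt0//; lra.
have Bge (b : 'I_K.+1 -> R) : let f := \sum_(i < K.+1) b i *: e i in (a - d) / W * ip f f <= ip (B f) f.
  move=> /=; set h := \sum_(i < _) _; rewrite mulrAC ler_pdivrMr//.
  by have := Age b => /=; rewrite -/h; have := Bform h; rewrite ler_norml => /andP[]; lra.
have Ble h : (forall i, ip h (e i) = 0) -> ip (B h) h <= (a' + d) / W * ip h h.
  move=> /Ale; rewrite mulrAC ler_pdivlMr//.
  by have := Bform h; rewrite ler_norml => /andP[]; lra.
have BP' : positive_op ip (fun h => W *: B h).
  split=> [h k|h]; first by rewrite (ipZl ipP) (ipZr ipP) (op_sym BP).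
  by rewrite (ipZl ipP) mulr_ge0 ?(op_ge0 BP) ?(ltW W0).
have [onA evA _ _] := psiP; have [onB evB _ _] := phiP.
have Ed := sym_norm_le ipP d0 _ AB.
have := @davis_kahan _ _ _ ipP A (fun h => W *: B h) _ psi phi lam (fun i => W * be i) a a' (a - d) (a' + d) d (delta - d)
  AP BP' onA evA onB _ _ _ _ _ _ a'0 _ d0 _ _ _ f.
set g := span_proj _ _ _ - _ => /= dk.
have e0 : 0 < delta - d by lra.
have {}dk : (delta - d) ^+ 2 * ip g g <= d ^+ 2 * ip f f.
  apply: dk.
  - by move=> i h; rewrite (ipZl ipP) evB mulrA.
  - by move=> i; exact: (weyl_ge ipP AP Ac Ab psiP eon Age).
  - by move=> i; rewrite mulrC -ler_pdivrMr//; exact: (weyl_ge ipP BP Bc Bb phiP eon Bge).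
  - by move=> h hp; exact: (weyl_le ipP AP Ac Ab psiP eon Age Ale aa' hp).
  - move=> h hp; rewrite (ipZl ipP); have := weyl_le ipP BP Bc Bb phiP eon Bge Ble bb' hp.
    by rewrite mulrAC ler_pdivlMr// mulrC.
  - apply: Ed => h k; rewrite (ipBl ipP) (ipBr ipP) (op_sym AP) (op_sym BP').
    by [].
  - exact: addr_ge0.
  - by [].
  - lra.
  - lra.
have e2 : 0 < (delta - d) ^+ 2 by exact: exprn_gt0.
rewrite -(ler_pM2l e2); apply: le_trans dk _.
rewrite mulrA; apply: ler_wpM2r; first exact: ip_ge0.
rewrite -exprMn; apply: lerXn2r; rewrite ?nnegrE//.
  by apply: mulr_ge0 => //; exact: ltW.
by rewrite mulrC.
Qed.

Section SpectralGap.
Variable R : realType.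
Notation mu := (@mu11 R).
Notation L2 := (LfunType mu (lee1n 2)).
Notation ip := (@ip2 R).
Implicit Types (f g h : L2).
Let ipP := ip2_semi R.

(** [gap_exists] with b = 2 W and P = (ln c + 50) / pi^2. As pi^2 / 2 <= 8, the constant 58 gives
    delta (P + 1/2) <= 2/25, below 1/12 - 2 W^2 for W <= 1/100. *)
Lemma sinc_spectral_gap (W c : R) (N : nat) (K : nat) :
  0 < W -> W <= 1 / 100 -> c = pi * N%:R * W -> forall c0 : 0 < c, 1 <= c ->
  (0 < K <= N)%N -> K%:R <= 2 * N%:R * W ->
  exists n (chi : nat -> L2) (nu : nat -> R), [/\ (K <= n.+1 <= N)%N,
    strongly_leading ip (sincL2 c0) n.+2 chi nu
    & 2 / 25 * pi ^+ 2 / (ln c + 58) <= nu n - nu n.+1].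
Proof.
move=> W0 W1 cE c0 c1 /andP[K0 KN] KW.
have p0 := pi_gt0 R.
have L0 : 0 <= ln c by exact: ln_ge0.
have L58 : 0 < ln c + 58 by rewrite ltr_wpDl.
have AP := trig_approx_positive (sincL2_approx c0).
have Ac := trig_approx_compact (sincL2_approx c0).
have Ab := trig_approx_bounded (sincL2_approx c0).
have [chi [nu sl]] := strongly_leading_exists ipP AP Ac Ab (@L2_infinite_dim R) N.+1.
have [on ev mono _] := strongly_leading_leading ipP sl.
have d0 : 0 < 2 / 25 * pi ^+ 2 / (ln c + 58) by rewrite divr_gt0// mulr_gt0// exprn_gt0.
have nu_mono i j : (i <= j <= N)%N -> nu j <= nu i.
  move=> /andP[ij jN].
  exact: (mono (Ordinal (leq_ltn_trans ij (_ : j < N.+1)%N)) (Ordinal (_ : j < N.+1)%N)).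
have nu01 k : (k <= N)%N -> 0 <= nu k <= 1.
  move=> kN; have kN' : (k < N.+1)%N by [].
  have chi1 : ip (chi k) (chi k) = 1 by have := on (Ordinal kN') (Ordinal kN'); rewrite eqxx.
  have evk := ev (Ordinal kN').
  apply/andP; split; last exact: sinc_eigen_le1 chi1 evk.
  by have := op_ge0 AP (chi k); rewrite evk chi1 mulr1.
have Kc : K%:R * (pi / c) <= 2.
  by rewrite mulrA ler_pdivrMr// cE; have := ler_wpM2r (ltW p0) KW; lra.
have nuK : 1 / 2 <= nu K.-1.
  have Kc' : K.-1.+1%:R * (pi / c) <= 2 by rewrite prednK.
  apply: (strongly_leading_minmax ipP AP Ac Ab sl _ (bump1_orthonormal c0 Kc')).
    by rewrite ltnS (leq_trans (leq_pred _)).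
  exact: landau_lower_bound.
(* The N + 1 eigenvalues down to [nu N] add up to at most 2 c / pi = 2 N W. *)
have nuN : nu N <= 2 * W.
  have tr := sinc_trace c0 on.
  have : N.+1%:R * nu N <= 2 * c / pi.
    apply: le_trans tr; rewrite mulr_natl -[N.+1 in X in X <= _]card_ord -sumr_const.
    apply: ler_sum => i _; rewrite ev on eqxx mulr1.
    by apply: nu_mono; rewrite leqnn andbT -ltnS.
  have -> : 2 * c / pi = 2 * W * N%:R.
    by rewrite cE; move: (lt0r_neq0 p0); move: (pi : R) => p pn; field.
  move=> h; rewrite -(ler_pM2l (_ : 0 < N.+1%:R)) ?ltr0n//; apply: le_trans h _.
  by rewrite mulrC; apply: ler_wpM2r; [rewrite mulr_ge0// ltW|rewrite ler_nat].
have pl := sinc_plunge c1 on ev.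
have [n nKN gap] : exists2 n, (K <= n <= N)%N & 2 / 25 * pi ^+ 2 / (ln c + 58) <= nu n.-1 - nu n.
  apply: (@gap_exists R nu K N _ (2 * W) ((ln c + 50) / pi ^+ 2)) => //; first by rewrite K0.
    by rewrite mulr_ge0// ltW.
  have pp : pi ^+ 2 <= 16 :> R.
    rewrite (_ : 16 = 4 ^+ 2); last by ring.
    by rewrite ler_pXn2r ?nnegrE ?(ltW p0)//; have := @pihalf_lt2 R; lra.
  have W2 : W ^+ 2 <= (1 / 100) ^+ 2 by rewrite ler_pXn2r ?nnegrE ?divr_ge0// ltW.
  apply: le_lt_trans (_ : 2 / 25 < _); last by lra.
  have p2 : 0 < pi ^+ 2 :> R by exact: exprn_gt0.
  move: pp p2 L58; move: (pi ^+ 2 : R) (ln c) => q L q16 q0 L58.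
  have -> : 2 / 25 * q / (L + 58) * ((L + 50) / q + 1 / 2) = 2 / 25 * ((L + 50 + q / 2) / (L + 58)).
    by field; rewrite !gt_eqF.
  by rewrite ler_piMr ?divr_ge0// ler_pdivrMr//; lra.
exists n.-1, chi, nu; have n0 : (0 < n)%N by case/andP: nKN => /(leq_trans K0).
split.
- by rewrite prednK.
- apply: strongly_leading_le sl; case/andP: nKN => _ nN.
  by rewrite prednK.
- by rewrite prednK.
Qed.

End SpectralGap.

Unset Implicit Arguments.
Theorem proposition2 (R : realType) (b : R) (hb : ln 3 / pi < b) :
  exists2 cb : R, 0 < cb &
    forall (W : R) (N : nat), 0 < W -> W < 1 / 2 -> (0 < N)%N ->
      cb <= pi * N%:R * W ->
      pi * N%:R * W
        <= expR (alpha b * (sin (2 * pi * W) / W ^+ 3) - 2 * ln 2 - pi / b) ->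
      exists N0 : nat,
        [/\ Num.floor (2 * N%:R * W) <= N0%:Z, (N0 <= N)%N
          & (opnorm (fun f : R -> R => (eigen_proj (sinc_op (pi * N%:R * W)) N0 f
                              \- eigen_proj (dirichlet_op W N) N0 f)%R)
             <= (W ^+ 3 * (4 * b * pi / (3 * sin (2 * pi * W)))
                 * ((ln (pi * N%:R * W) + 2 * ln 2 + pi / b)
                    / (1 - 3 / (1 + expR (pi * b)))))%:E)%E].
Proof.
have p4 : pi <= 4 :> R by have := @pihalf_lt2 R; lra.
have ge1000D (x y : R) : 0 <= x -> 1000 + 20000 * x <= y -> 1000 <= y by clear; lra.
have ge1000 (y : R) : 1000 <= y -> 0 <= y /\ 1 <= y by clear; move=> ?; split; lra.
have ge1000S (y z : R) : 1000 <= y -> 1 + y <= z -> 1000 <= z by clear; lra.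
have le100 (x w : R) : 0 <= w -> w * (1000 + 20000 * x) <= 2 * x -> w * x <= (1 / 100) ^+ 2 * x by clear; lra.
have lt_half (u v x : R) : 0 < u -> 0 <= x -> x <= 1 / 8 -> u <= x * (v - u) -> 2 * u < v by clear; nra.
have ge1 (y z : R) : 1000 <= y -> y <= 4 * z -> 1 <= 2 * z by clear; lra.
have half_lt (x : R) : x < 1 / 2 -> 2 * x < 1 by clear; lra.
have p0 := pi_gt0 R; have a0 := alpha_gt0 hb.
(* With L = ln c this gives L >= 1000 and, against W^2 L <= 2 pi alpha, W^2 <= 1/10000. *)
exists (expR (1000 + 20000 * (pi * alpha b))); first exact: expR_gt0.
move=> W N W0 W1 N0; set c := pi * N%:R * W => cb cle.
have pa0 : 0 <= pi * alpha b by apply: mulr_ge0; exact: ltW.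
have c0 : 0 < c by apply: lt_le_trans cb; exact: expR_gt0.
have Lge : 1000 + 20000 * (pi * alpha b) <= ln c by rewrite -ler_expR lnK.
have Lle : ln c <= alpha b * (sin (2 * pi * W) / W ^+ 3) - 2 * ln 2 - pi / b.
  by rewrite -ler_expR lnK.
have L1000 : 1000 <= ln c by exact: ge1000D pa0 Lge.
have [L0 _] := ge1000 _ L1000.
have c1000 : 1000 <= c.
  by apply: ge1000S L1000 _; have := expR_ge1Dx (ln c); rewrite lnK.
have [_ c1] := ge1000 _ c1000.
have Wsmall : W <= 1 / 100.
  have W2 := W_small hb W0 Lle.
  have w : W ^+ 2 <= (1 / 100) ^+ 2.
    have W20 : 0 <= W ^+ 2 by exact: sqr_ge0.
    have h := le_trans (ler_wpM2l W20 Lge) W2; rewrite -(mulrA 2) in h.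
    have pa : 0 < pi * alpha b by exact: mulr_gt0.
    by rewrite -(ler_pM2r pa); exact: le100.
  by move: w; rewrite ler_pXn2r ?nnegrE ?divr_ge0// ltW.
have X8 := rhs_le hb W0 W1 Lle.
have Xge := rhs_ge hb W0 W1 L0.
set X := W ^+ 3 * _ * _ in X8 Xge *.
have X0 : 0 <= X.
  apply: le_trans Xge; apply: mulr_ge0; first by rewrite divr_ge0// mulr_ge0// ltW.
  by apply: mulr_ge0 => //; exact: sqr_ge0.
pose delta : R := 2 / 25 * pi ^+ 2 / (ln c + 58).
pose d : R := pi * W ^+ 2 / 10.
have dX : d <= X * (delta - d) := gap_numerics p0 W0 L1000 X8 Xge.
have d0 : 0 < d by rewrite divr_gt0// mulr_gt0// exprn_gt0.
have d2 : 2 * d < delta := lt_half _ _ _ d0 X0 X8 dX.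
pose t : R := 2 * N%:R * W.
have NW0 : 0 <= N%:R * W by rewrite mulr_ge0// ltW.
have t1 : 1 <= t.
  have := ler_wpM2r NW0 p4; rewrite mulrA -/c /t -mulrA.
  exact: ge1.
have tN : t < N%:R.
  by rewrite /t -mulrA mulrCA gtr_pMr ?ltr0n//; exact: half_lt.
have t0 : 0 <= t by apply: le_trans t1.
pose K := Num.truncn t.
have Kt : K%:R <= t by rewrite /K truncn_le.
have K0 : (0 < K)%N by rewrite /K truncn_gt0.
have KN : (K <= N)%N by rewrite -(ler_nat R); apply: le_trans Kt (ltW tN).
have [|n [chi [nu [/andP[Kn nN] sl gap]]]] := sinc_spectral_gap W0 Wsmall erefl c0 c1 _ Kt.
  by rewrite K0.
(* Eigenvalues are numbered from 0, so the gap between [nu n] and [nu n.+1] cuts off the first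
   [n.+1] eigenfunctions. *)
exists n.+1; split=> //.
  by move: Kn; rewrite /K truncn_floor t0 -lez_nat gez0_abs// floor_ge0.
have AP := trig_approx_positive (sincL2_approx c0).
have Ac := trig_approx_compact (sincL2_approx c0).
have Ab := trig_approx_bounded (sincL2_approx c0).
have BP := trig_approx_positive (@dirL2_approx R W N W0 W1).
have Bc := trig_approx_compact (@dirL2_approx R W N W0 W1).
have Bb := trig_approx_bounded (@dirL2_approx R W N W0 W1).
have ipP := ip2_semi R.
have ldex (T : LfunType (@mu11 R) (lee1n 2) -> LfunType (@mu11 R) (lee1n 2)) :
    positive_op (@ip2 R) T -> compact_op (@ip2 R) T -> bounded_op (@ip2 R) T ->
    exists psi : 'I_n.+1 -> _, exists lam, leading (@ip2 R) T psi lam.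
  move=> TP Tc Tb; have [xi [l h]] := strongly_leading_exists ipP TP Tc Tb (@L2_infinite_dim R) n.+1.
  by exists (fun i => xi i), (fun i => l i); exact: strongly_leading_leading.
have [psi [lam [psiE psiP]]] := first_eigenfunctions_leading (sincL2E c0) (ldex _ AP Ac Ab).
have [phi [be [phiE phiP]]] := first_eigenfunctions_leading (@dirL2E R W N W0 W1) (ldex _ BP Bc Bb).
apply: opnorm_le => // f.
exists (span_proj (@ip2 R) psi f - span_proj (@ip2 R) phi f); split.
  have [onA _ _ _] := psiP; have [onB _ _ _] := phiP.
  by rewrite (eigen_projE onA psiE) (eigen_projE onB phiE).
apply: (spectral_projection_close ipP AP Ac Ab BP Bc Bb W0 (ltW d0) X0 d2 dX _ sl gap psiP phiP).
by move=> g; exact: sinc_dirichlet_form.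
Qed.
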